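(* Let integers $p_0\ge1$, $q_0\ge0$, $m,K_0\ge1$ be given and $d=p_0+q_0+m$. Let $\{\mathcal F_\lambda,\lambda>0\}$ (hypothesized) and $\{\mathcal F^A_\lambda,\lambda>0\}$ (true) be two different families of distributions as in the context, with probability generating functions $g_\lambda$ and $g^A_\lambda$. Let $h_0$ be a link function and let $\Delta_{T,W}$ be the statistic of the context, computed with $h_0$ and $\{\mathcal F_\lambda\}$. Assume the following. (1) $h_0:[0,\infty)^{p_0+q_0}\times\mathbb R^{m+K_0}\to(c_h,\infty)$ for some $c_h>0$, and $h_0(y,l,x;\theta)=r(y,l;\theta)+\pi(x;\theta)$ with continuous $r:[0,\infty)^{p_0+q_0}\times\mathbb R^{K_0}\to(0,\infty)$ and $\pi:\mathbb R^{m+K_0}\to(0,\infty)$. The set $\Theta\subset\mathbb R^{K_0}$ is such that, for some constants $\alpha_i,\beta_j$ with $\sum_{i=1}^{p_0}\alpha_i+\sum_{j=1}^{q_0}\beta_j<1$, $|r(y_1,l_1;\theta)-r(y_2,l_2;\theta)|\le\sum_{i=1}^{p_0}\alpha_i|y_{1i}-y_{2i}|+\sum_{j=1}^{q_0}\beta_j|l_{1j}-l_{2j}|$ for all $\theta\in\Theta$, $y_1,y_2\in[0,\infty)^{p_0}$, $l_1,l_2\in[0,\infty)^{q_0}$. (2) $\{X_t\}$ is a strictly stationary and ergodic sequence of $m$-dimensional random vectors; $\{\mathcal F^A_\lambda\}$ satisfies the stochastic order condition of the context; $\{(Y_t,\lambda_t)\}$ is the stationary and ergodic solution of $Y_t|\mathcal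 I_{t-1}\sim\mathcal F^A_{\lambda_t}$, $\lambda_t=h_0(Z_t;\theta_0)$, $Z_t=(Y_{t-1},\dots,Y_{t-p_0},\lambda_{t-1},\dots,\lambda_{t-q_0},X_{t-1}^\top)^\top$, for some $\theta_0\in\mathrm{int}(\Theta_0)$, $\Theta_0$ a compact subset of $\Theta$; and $\mathbb E\|Z_t\|^2<\infty$. (3) For all $y\in[0,\infty)^{p_0}$, $r(y,\cdot,\cdot)$ is three times continuously differentiable on $(0,\infty)^{q_0}\times\Theta$. The derivative $\partial r(y,l;\theta)/\partial l=d(\theta)$ is constant with respect to $y$ and $l$, and $\sup_{\theta\in\Theta_0}\rho(\mathbf D(\theta))<1$, where $\rho$ is the spectral radius and $\mathbf D(\theta)$ is the $q_0\times q_0$ matrix with first row $d(\theta)$ and remaining rows $(I_{q_0-1}\ \ 0)$. The function $\pi$ is twice continuously differentiable with respect to $\theta$. With $r_\theta=\partial r/\partial\theta$, $\pi_\theta=\partial\pi/\partial\theta$, there is $\kappa>0$ with $\mathbb E\sup_{\theta\in\Theta_0}\|\pi_\theta(X_{t-1};\theta)\|^\kappa<\infty$ and $\mathbb E\sup_{\theta\in\Theta_0}\|r_\theta((Y_{t-1},\dots,Y_{t-p_0}),(\lambda_{t-1},\dots,\lambda_{t-q_0});\theta)\|^\kappa<\infty$. (4) $\partial^2\lambda_t(\theta)/\partial\theta\partial\theta^\top$ exists and is continuous in $\theta$, and there is a neighborhood $\mathcal V(\theta_0)$ of $\theta_0$ such that, for all $i,j$, $\mathbb E\sup_{\theta\in\mathcal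 V(\theta_0)}\left|\frac{\partial\lambda_t(\theta)}{\partial\theta_i}\frac{\partial\lambda_t(\theta)}{\partial\theta_j}\right|<\infty$ and $\mathbb E\sup_{\theta\in\mathcal V(\theta_0)}\left|\frac{\partial^2\lambda_t(\theta)}{\partial\theta_i\partial\theta_j}\right|<\infty$. Moreover $\mathbb E H^2(\lambda_t(\theta_0))<\infty$ for a finite positive function $H$ with $|\partial^2g_z(u)/\partial z\partial u|\le H(z)$ for all $(u,z)\in(0,1)\times(0,\infty)$. (5) $W(u,v)=w(u)\omega(v)$ for measurable $w:(0,1)\to(0,\infty)$ and $\omega:\mathbb R^d\to(0,\infty)$ with $\omega(v)=\omega(-v)$ for all $v$, $0<\int_0^1w(u)\,du<\infty$, and $0<\int_{\mathbb R^d}\|v\|^k\omega(v)\,dv<\infty$ for $k\in\{0,1,2,3,4\}$. (6) For some $M_1>0$, $|\partial g_\lambda(u)/\partial\lambda|<M_1$ for all $u\in[0,1]$ and all $\lambda\in(0,\infty)$. (7) $\widehat\theta_T\to\theta_0$ in probability as $T\to\infty$. Then, as $T\to\infty$, $$\frac{\Delta_{T,W}}{T}\ \xrightarrow{\ P\ }\ \int_0^1\int_{\mathbb R^d}\zeta^2(u,v)W(u,v)\,dv\,du,\qquad \zeta(u,v)=\mathbb E\big\{[g^A_{\lambda_1}(u)-g_{\lambda_1}(u)]\,\alpha(Z_1,v)\big\},$$ where $\alpha(a,b)=\cos(a^\top b)+\sin(a^\top b)$ for $a,b\in\mathbb R^d$.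
   Context: $\{Y_t\}$ is a time series with values in $\mathbb N_0$, $\{X_t\}$ is an $\mathbb R^m$-valued series of exogenous covariates, and $\mathcal I_t$ is the information ($\sigma$-field) generated by $(Y_s,X_s)$, $s\le t$. All families $\{\mathcal F_\lambda,\lambda>0\}$ consist of distributions on $\mathbb N_0$, $\mathcal F_\lambda$ having mean $\lambda$, and satisfy the stochastic order condition: $\lambda_1\le\lambda_2$ implies $\mathcal F_{\lambda_1}(y)\ge\mathcal F_{\lambda_2}(y)$ for all $y\in\mathbb R$ (distribution functions). The probability generating function of $\mathcal F_\lambda$ is $g_\lambda(u)=\sum_{k\ge0}u^k\mathcal F_\lambda(\{k\})$, $u\in[0,1]$. Stationary and ergodic solution means that the joint process $\{(Y_t,\lambda_t,X_t)\}$ is strictly stationary and ergodic. For $\theta\in\Theta$, $\{\lambda_t(\theta)\}$ denotes the stationary sequence, with $\lambda_t(\theta)$ a measurable function of $(Y_s,X_s)_{s<t}$, solving $\lambda_t(\theta)=r((Y_{t-1},\dots,Y_{t-p_0}),(\lambda_{t-1}(\theta),\dots,\lambda_{t-q_0}(\theta));\theta)+\pi(X_{t-1};\theta)$; thus $\lambda_t=\lambda_t(\theta_0)$. When $q_0=0$, conditions concerning $\lambda$-arguments of $r$ are void. Test statistic. Data $(Y_t,X_{t-1})$, $t=1,\dots,T$, are observed and $\widehat\theta_T$ is a $\Theta$-valued estimator computed from them. Starting from some fixed nonnegative initial values for $Y_t$ and $\widehat\lambda_t$, $t\le0$, define recursively for $t=1,\dots,T$: $\widehat Z_t=(Y_{t-1},\dots,Y_{t-p_0},\widehat\lambda_{t-1},\dots,\widehat\lambda_{t-q_0},X_{t-1}^\top)^\top$,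 $\widehat\lambda_t=h_0(\widehat Z_t;\widehat\theta_T)$. Put $\widehat\varepsilon_t(u)=u^{Y_t}-g_{\widehat\lambda_t}(u)$ (with $g$ the generating function of the hypothesized family), $D_T(u;v)=\frac1T\sum_{t=1}^T\widehat\varepsilon_t(u)e^{\mathrm i v^\top\widehat Z_t}$ ($\mathrm i=\sqrt{-1}$), and $\Delta_{T,W}=T\int_0^1\int_{\mathbb R^d}|D_T(u;v)|^2W(u,v)\,dv\,du$. *)

(* Defs.v *)
From HB Require Import structures.
From mathcomp Require Import all_boot all_order all_algebra.
From mathcomp Require Import complex.
From mathcomp Require Import all_classical all_reals all_analysis.

Set Implicit Arguments.
Unset Strict Implicit.
Unset Printing Implicit Defensive.

Import Order.TTheory GRing.Theory Num.Theory.
Import numFieldNormedType.Exports.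

Local Open Scope classical_set_scope.
Local Open Scope ring_scope.

Definition measure_matrix_display : measure_display -> measure_display.
Proof. exact. Qed.

Section measurable_matrix.
Context {d} {T : measurableType d}.
Variables m n : nat.

Definition matrix_measurable : set (set 'M[T]_(m, n)) :=
  <<s [set A | exists i j (B : set T),
         measurable B /\ A = [set M : 'M[T]_(m, n) | B (M i j)]] >>.

Let matrix_set0 : matrix_measurable set0.
Proof. exact: sigma_algebra0. Qed.

Let matrix_setC A : matrix_measurable A -> matrix_measurable (~` A).
Proof. exact: sigma_algebraC. Qed.

Let matrix_bigcup (F : _^nat) : (forall i, matrix_measurable (F i)) ->
  matrix_measurable (\bigcup_i (F i)).
Proof. exact: sigma_algebra_bigcup. Qed.

HB.instance Definition _ := @isMeasurable.Build (measure_matrix_display d)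
  'M[T]_(m, n) matrix_measurable matrix_set0 matrix_setC matrix_bigcup.

End measurable_matrix.

Lemma measurable_fun_matrixP d1 d2 (T1 : measurableType d1)
    (T2 : measurableType d2) m n (f : T1 -> 'M[T2]_(m, n)) :
  measurable_fun setT f <->
  forall i j, measurable_fun setT (fun x => f x i j).
Proof.
split=> [mf i j _ B mB|mf].
  have -> : [set: T1] `&` (fun x => f x i j) @^-1` B =
            [set: T1] `&` f @^-1` [set M : 'M[T2]_(m, n) | B (M i j)] by [].
  by apply: mf => //; apply: sub_sigma_algebra; exists i, j, B.
apply: (@measurability _ _ _ _ setT f
  [set A | exists i j (B : set T2),
         measurable B /\ A = [set M : 'M[T2]_(m, n) | B (M i j)]]) => //.
move=> _ [_ [i [j [B [mB ->]]]] <-].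
by apply: (mf i j).
Qed.

Section lebesgue_row.
Context {R : realType}.

Definition cons_row n (p : measurableTypeR R * 'rV[R]_n) : 'rV[R]_n.+1 :=
  row_mx (const_mx p.1 : 'rV[R]_1) p.2.

Lemma cons_row0 n p : @cons_row n p 0 0 = p.1.
Proof.
rewrite /cons_row (_ : 0 = lshift n (0 : 'I_1)); last exact/val_inj.
by rewrite (row_mxEl (const_mx p.1 : 'rV[R]_1)) mxE.
Qed.

Lemma cons_rowS n p j : @cons_row n p 0 (lift 0 j) = p.2 0 j.
Proof.
rewrite /cons_row (_ : lift 0 j = rshift 1 j); last exact/val_inj.
by rewrite (row_mxEr (const_mx p.1 : 'rV[R]_1)).
Qed.

Lemma measurable_cons_row n : measurable_fun setT (@cons_row n).
Proof.
apply: (measurable_fun_matrixP _).2 => i j; rewrite ord1 {i}.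
have [k ->|->] := unliftP ord0 j.
- rewrite (_ : (fun x => _) = (fun M : 'rV[R]_n => M 0 k) \o snd); last first.
    by apply/funext => x /=; rewrite cons_rowS.
  apply: measurableT_comp => //.
  by apply: (measurable_fun_matrixP id).1; exact: measurable_id.
- rewrite (_ : (fun x => _) = fst); last first.
    by apply/funext => x /=; rewrite cons_row0.
  exact: measurable_fst.
Qed.

Lemma measurable_uncons_row n :
  measurable_fun setT
    (fun v : 'rV[R]_n.+1 => (v 0 0, \row_j v 0 (lift 0 j) : 'rV[R]_n)).
Proof.
have H j : measurable_fun setT (fun v : 'rV[R]_n.+1 => v 0 j).
  by apply: (measurable_fun_matrixP id).1; exact: measurable_id.
apply: measurable_fun_pair; first exact: H.
apply: (measurable_fun_matrixP _).2 => i j.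
rewrite (_ : (fun x => _) = fun x : 'rV[R]_n.+1 => x 0 (lift 0 j)); first exact: H.
by apply/funext => x /=; rewrite mxE.
Qed.

HB.instance Definition _ n := isMeasurableFun.Build _ _ _ _ (@cons_row n)
  (@measurable_cons_row n).

Section step.
Variable n : nat.
Variable mu : {sigma_finite_measure set 'rV[R]_n -> \bar R}.

Definition lebesgue_cons : set 'rV[R]_n.+1 -> \bar R :=
  pushforward (@lebesgue_measure R \x mu)%E (@cons_row n).

Let lebesgue_cons0 : lebesgue_cons set0 = 0%E.
Proof. exact: measure0. Qed.

Let lebesgue_cons_ge0 A : (0 <= lebesgue_cons A)%E.
Proof. exact: measure_ge0. Qed.

Let lebesgue_cons_sigma_additive : semi_sigma_additive lebesgue_cons.
Proof. exact: measure_semi_sigma_additive. Qed.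

HB.instance Definition _ := isMeasure.Build _ _ _ lebesgue_cons
  lebesgue_cons0 lebesgue_cons_ge0 lebesgue_cons_sigma_additive.

Let lebesgue_cons_sigma_finite : sigma_finite setT lebesgue_cons.
Proof.
have /sigma_finiteP[F [FT ndF Foo]] := sigma_finiteT (@lebesgue_measure R).
have /sigma_finiteP[G [GT ndG Goo]] := sigma_finiteT mu.
pose g (v : 'rV[R]_n.+1) := (v 0 0, \row_j v 0 (lift 0 j) : 'rV[R]_n).
have gK p : g (cons_row p) = p.
  case: p => x u; rewrite /g cons_row0; congr (_, _).
  by apply/rowP => j; rewrite mxE cons_rowS.
exists (fun i => g @^-1` (F i `*` G i)).
  apply/esym/seteqP; split=> // v _.
  have [i _ Fi] : (\bigcup_i F i) (g v).1 by rewrite -FT.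
  have [j _ Gj] : (\bigcup_i G i) (g v).2 by rewrite -GT.
  exists (maxn i j) => //; split.
    by move: Fi; apply/subsetPset/ndF/leq_maxl.
  by move: Gj; apply/subsetPset/ndG/leq_maxr.
move=> i; have [mF Fioo] := Foo i; have [mG Gioo] := Goo i.
have mFG : measurable (F i `*` G i) by exact: measurableX.
split.
  by rewrite -[X in measurable X]setTI; exact: measurable_uncons_row.
rewrite /lebesgue_cons /pushforward (_ : _ @^-1` _ = F i `*` G i).
  by rewrite product_measure1E// lte_mul_pinfty// ge0_fin_numE.
by rewrite -comp_preimage (_ : g \o _ = id) ?preimage_id//; apply/funext => p; exact: gK.
Qed.

HB.instance Definition _ := Measure_isSigmaFinite.Build _ _ _ lebesgue_cons
  lebesgue_cons_sigma_finite.

End step.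

(** On [R^0] this is the unit mass at the only point. *)
Fixpoint lebesgue_row n : {sigma_finite_measure set 'rV[R]_n -> \bar R} :=
  if n is n'.+1 then lebesgue_cons (lebesgue_row n')
  else dirac (0 : 'rV[R]_0).

Lemma lebesgue_row_box n (A : 'I_n -> set R) :
  (forall i, measurable (A i)) ->
  (lebesgue_row n [set v | forall i, A i (v 0%R i)] =
   \prod_(i < n) lebesgue_measure (A i))%E.
Proof.
elim: n A => [|n IH] A mA /=.
  rewrite big_ord0 diracE.
  by rewrite mem_set// => -[].
rewrite big_ord_recl -IH //.
pose B := [set v : 'rV[R]_n | forall i, A (lift ord0 i) (v 0 i)].
rewrite -/B.
have mB : measurable B.
  rewrite (_ : B = \bigcap_(i in [set: 'I_n])
    (fun v : 'rV[R]_n => v 0 i) @^-1` A (lift ord0 i)); last first.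
    by apply/seteqP; split => v /= H i; [move=> _ | ]; apply: H.
  apply: fin_bigcap_measurable => // i _; rewrite -[X in measurable X]setTI.
  by apply: ((measurable_fun_matrixP id).1 _ 0 i) => //; exact: measurable_id.
rewrite /lebesgue_cons /pushforward.
rewrite (_ : _ @^-1` _ = A ord0 `*` B); first by
  rewrite product_measure1E//; first exact: mA.
apply/seteqP; split => -[x v] /=.
  move=> H; split; first by have := H 0; rewrite cons_row0.
  by move=> i; have := H (lift 0 i); rewrite cons_rowS.
move=> [H0 H] i; have [k ->|->] := unliftP ord0 i; last by rewrite cons_row0.
by rewrite cons_rowS; exact: H.
Qed.

End lebesgue_row.

Section vectors.
Context {R : realType}.

(** The library norm on ['rV[R]_n] is the sup norm; this is the Euclidean one. *)
Definition enorm n (v : 'rV[R]_n) : R := Num.sqrt (\sum_(i < n) v 0 i ^+ 2).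

Definition dotp n (a b : 'rV[R]_n) : R := \sum_(i < n) a 0 i * b 0 i.

Definition nneg_row n (v : 'rV[R]_n) : Prop := forall i, 0 <= v 0 i.

Definition pos_row n (v : 'rV[R]_n) : Prop := forall i, 0 < v 0 i.

Definition partial n (i : 'I_n) (f : 'rV[R]_n -> R) : 'rV[R]_n -> R :=
  fun x => 'D_(delta_mx 0 i) f x.

Definition grad n (f : 'rV[R]_n -> R) (x : 'rV[R]_n) : 'rV[R]_n :=
  \row_(i < n) partial i f x.

Fixpoint iter_partial n (s : seq 'I_n) (f : 'rV[R]_n -> R) : 'rV[R]_n -> R :=
  if s is i :: s' then partial i (iter_partial s' f) else f.

(** [f] is of class C^k on [A] when, on some open set containing [A], all
    partial derivatives up to order [k] exist and are continuous. *)
Definition Ck n (k : nat) (A : set 'rV[R]_n) (f : 'rV[R]_n -> R) : Prop :=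
  exists U : set 'rV[R]_n, [/\ open U, A `<=` U &
    forall s x, U x ->
      ((size s <= k)%N -> {for x, continuous (iter_partial s f)}) /\
      ((size s < k)%N ->
         forall i, derivable (iter_partial s f) x (delta_mx 0 i))].

Definition spectral_radius n (A : 'M[R]_n) : R :=
  sup [set ComplexField.Normc.normc z | z in
        [set z : R[i] | eigenvalue (map_mx (real_complex R) A) z]].

(** First row [d], remaining rows [(I_{q-1} 0)]. *)
Definition companion q (d : 'rV[R]_q) : 'M[R]_q :=
  \matrix_(i < q, j < q)
    if (i == 0 :> nat) then d 0 j else ((i : nat) == j.+1)%:R.

Definition cis (x : R) : R[i] := Complex (cos x) (sin x).

End vectors.

(** Product sigma-algebra on the space of two-sided paths. *)
Definition path_measurable d (E : measurableType d) : set (set (int -> E)) :=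
  <<s [set A | exists (t : int) (B : set E),
         measurable B /\ A = [set x | B (x t)]] >>.

Section processes.
Context {R : realType} {dO : measure_display} {Omega : measurableType dO}.
Variable P : probability Omega R.

Definition strictly_stationary d (E : measurableType d)
    (S : int -> Omega -> E) : Prop :=
  forall (h : int) (A : set (int -> E)), path_measurable A ->
    P [set w | A (fun t => S (t + h) w)] = P [set w | A (fun t => S t w)].

Definition stationary_ergodic d (E : measurableType d)
    (S : int -> Omega -> E) : Prop :=
  strictly_stationary S /\
  forall A : set (int -> E), path_measurable A ->
    (forall x, A (fun t => x (t + 1)) <-> A x) ->
    P [set w | A (fun t => S t w)] = 0%E \/
    P [set w | A (fun t => S t w)] = 1%E.

Definition cvg_in_prob (X : nat -> Omega -> \bar R) (l : \bar R) : Prop :=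
  forall e : R, 0 < e ->
    (fun n => P [set w | (e%:E < `|X n w - l|)%E]) @ \oo --> 0%E.

(** The sigma-field generated by [Y s], [s] in [SY], and [X s], [s] in [SX]. *)
Definition info m (Y : int -> Omega -> nat) (X : int -> Omega -> 'rV[R]_m)
    (SY SX : set int) : set (set Omega) :=
  <<s [set A | (exists s (B : set nat), SY s /\ A = Y s @^-1` B) \/
               (exists s (B : set 'rV[R]_m),
                  [/\ SX s, measurable B & A = X s @^-1` B])] >>.

Definition past m (Y : int -> Omega -> nat) (X : int -> Omega -> 'rV[R]_m)
    (t : int) : set (set Omega) :=
  info Y X [set s | s <= t] [set s | s <= t].

Definition measurable_wrt d (E : measurableType d) (G : set (set Omega))
    (f : Omega -> E) : Prop :=
  forall B : set E, measurable B -> G (f @^-1` B).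

(** The conditional distribution of [N] given [G] is [w |-> K w]; the
    [G]-measurability of [w |-> K w B] is required separately, where used. *)
Definition cond_law (G : set (set Omega)) (N : Omega -> nat)
    (K : Omega -> probability nat R) : Prop :=
  forall (A : set Omega) (B : set nat), G A ->
    P (A `&` N @^-1` B) = (\int[P]_(w in A) K w B)%E.

End processes.

Section families.
Context {R : realType}.
Variable F : R -> probability nat R.

Definition mean_param : Prop :=
  forall l, 0 < l -> (\int[F l]_k (k%:R)%:E)%E = l%:E.

Definition stoch_order : Prop :=
  forall l1 l2, 0 < l1 -> l1 <= l2 -> forall y : R,
    (F l2 [set k : nat | (k%:R <= y)%R] <= F l1 [set k : nat | (k%:R <= y)%R])%E.

Definition pgf (l u : R) : R :=
  fine (\sum_(k <oo) ((u ^+ k)%:E * F l [set k]))%E.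

End families.

Section statistic.
Context {R : realType}.
Variables p q m K : nat.

Definition lagvec n (f : int -> R) (t : int) : 'rV[R]_n :=
  \row_(i < n) f (t - (i.+1)%:Z).

Definition zvec (y l : int -> R) (x : int -> 'rV[R]_m) (t : int) :
    'rV[R]_(p + q + m) :=
  row_mx (row_mx (lagvec p y t) (lagvec q l t)) (x (t - 1)).

Section recursion.
Variables (h : 'rV[R]_(p + q + m) -> 'rV[R]_K -> R) (th : 'rV[R]_K).
Variables (y l0 : int -> R) (x : int -> 'rV[R]_m).

(** Intensities at all times up to [n], starting from [l0] at times [<= 0]. *)
Fixpoint fitted_upto (n : nat) : int -> R :=
  if n is k.+1 then
    fun s => if s == (k.+1)%:Z
             then h (zvec y (fitted_upto k) x (k.+1)%:Z) th
             else fitted_upto k s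
  else l0.

Definition fitted (t : int) : R := fitted_upto `|t|%N t.

End recursion.

(** Observed counts at times [>= 1], initial values before. *)
Definition counts (y0 : int -> R) (Y : int -> nat) (t : int) : R :=
  if 0 < t then (Y t)%:R else y0 t.

Section test.
Variables (h : 'rV[R]_(p + q + m) -> 'rV[R]_K -> R).
Variables (F : R -> probability nat R) (W : R -> 'rV[R]_(p + q + m) -> R).
Variables (y0 l0 : int -> R) (th : 'rV[R]_K).
Variables (Y : int -> nat) (X : int -> 'rV[R]_m).

Definition lambda_hat (t : int) : R := fitted h th (counts y0 Y) l0 X t.

Definition Z_hat (t : int) : 'rV[R]_(p + q + m) :=
  zvec (counts y0 Y) lambda_hat X t.

Definition eps_hat (t : int) (u : R) : R :=
  u ^+ Y t - pgf F (lambda_hat t) u.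

Definition D_stat (T : nat) (u : R) (v : 'rV[R]_(p + q + m)) : R[i] :=
  real_complex R (T%:R^-1) *
  \sum_(1 <= t < T.+1)
     real_complex R (eps_hat t%:Z u) * cis (dotp v (Z_hat t%:Z)).

Definition Delta_stat (T : nat) : \bar R :=
  (T%:R%:E *
   \int[lebesgue_measure]_(u in `]0%R, 1%R[)
     \int[lebesgue_row (p + q + m)]_v
       ((ComplexField.Normc.normc (D_stat T u v) ^+ 2 * W u v)%R)%:E)%E.

End test.
End statistic.

Definition alpha_fun {R : realType} n (a b : 'rV[R]_n) : R :=
  cos (dotp a b) + sin (dotp a b).

(* Main.v *)
Require Import Defs.
From HB Require Import structures.
From mathcomp Require Import all_boot all_order all_algebra.
From mathcomp Require Import complex.
From mathcomp Require Import all_classical all_reals all_analysis.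
From mathcomp Require Import measurable_realfun.
From mathcomp Require Import ring lra zify.

Set Implicit Arguments.
Unset Strict Implicit.
Unset Printing Implicit Defensive.

Import Order.TTheory GRing.Theory Num.Theory.
Import numFieldNormedType.Exports.

Local Open Scope classical_set_scope.
Local Open Scope ring_scope.

(** Writing [a^c_T(u, v)] for the real and imaginary parts ([c = cos], [c = sin])
    of [D_T(u; v)] and [a^c] for their limits, [Delta_T / T] is the integral of
    [(a^cos_T)^2 + (a^sin_T)^2] against [W], and since [a^cos] is even and
    [a^sin] odd in [v], the symmetry of [omega] turns the limit into the
    integral of [(a^cos + a^sin)^2 = zeta^2].

    It thus suffices that [a^c_T - a^c] tends to [0] in [L^1(W)], in probability.
    With [lambda_t, Z_t] in place of their fitted versions this is Birkhoff's
    theorem for each [(u, v)], integrated against [W] by dominated convergence;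
    conditioning on the past replaces [u^Y] by the generating function of the
    true family.

    The error [e_t = |lambdahat_t - lambda_t|] obeys
    [e_t <= \sum_j beta_j e_(t-j) + eta_t], hence is dominated by the solution of
    [B_t = rho B_(t-1) + eta_t].  The term [eta_t] contains
    [|r(.; thetahat) - r(.; theta0)|] and its analogue for [pi], whose powers of
    exponent [k = min(kappa, 1)] are at most [|thetahat - theta0|^k] times a
    stationary integrable Lipschitz modulus.  Only [k]-th moments are available,
    but as the functions involved are bounded, [min(1, e) <= e^k] suffices, and
    [x |-> x^k] is subadditive. *)

(** * Birkhoff's ergodic theorem for bounded functions *)

(** Two measurability obstacles shape the proof. The suprema over [Theta0] in the moment hypotheses
    are uncountable: they need not be measurable and cannot be moved in time by stationarity. They
    are replaced by a modulus over a countable dense sequence in a box around [theta0]. It is a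
    measurable functional of the path, lies below the gradient supremum by the mean value
    inequality, and controls every point of the box by continuity. Also, [Omega] carries no shift,
    so the ergodic theorem is applied to the law of [(Y, lambda, X)] on two-sided paths, and a
    stationary quantity at time [t] is written as a fixed functional of the path shifted by [t].

    The envelope [B], started at time [0], is not stationary. Only the average of its [k]-th powers
    matters, and summing its recursion bounds that average by the average of the [k]-th powers of
    [eta] plus a term of order [1/T]. *)

Section birkhoff.
Context d (T : measurableType d) (R : realType) (mu : probability T R).

Lemma bounded_integrable (f : T -> R) (C : R) :
  measurable_fun setT f -> (forall x, `|f x| <= C) ->
  mu.-integrable setT (EFin \o f).
Proof.
move=> mf fC; apply: measurable_bounded_integrable => //.
  by apply: le_lt_trans (probability_le1 _ _) _ => //; rewrite ltry.
by exists C; split; [exact: num_real|move=> M CM x _ /=; apply: le_trans (fC x) (ltW CM)].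
Qed.

Variable tau : T -> T.
Hypothesis mtau : measurable_fun setT tau.
Hypothesis tau_inv : forall A, measurable A -> mu (tau @^-1` A) = mu A.
Hypothesis tau_erg : forall A, measurable A -> tau @^-1` A = A ->
  mu A = 0%E \/ mu A = 1%E.

Lemma measurable_iter k : measurable_fun setT (iter k tau).
Proof.
elim: k => [|k IH]; first exact: measurable_id.
exact: (measurableT_comp mtau IH).
Qed.

Lemma integral_invariant (f : T -> R) (C : R) :
  measurable_fun setT f -> (forall x, `|f x| <= C) ->
  (\int[mu]_x (f (tau x))%:E = \int[mu]_x (f x)%:E)%E.
Proof.
move=> mf fC.
pose X : {mfun T >-> T} := mfun_Sub (mem_set mtau).
have <- : (\int[distribution mu X]_x (f x)%:E = \int[mu]_x (f (tau x))%:E)%E.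
  rewrite integral_distribution //; first exact/measurable_EFinP.
  apply: (@bounded_integrable (f \o tau) C) => [|x]; last exact: fC.
  exact: (measurableT_comp mf mtau).
by apply: eq_measure_integral => A mA _; exact: tau_inv.
Qed.

(* [maxsum f n x] is the maximum of the first n.+1 nonempty ergodic sums. *)
Fixpoint maxsum (f : T -> R) (n : nat) (x : T) : R :=
  if n is n'.+1 then f x + Num.max 0 (maxsum f n' (tau x)) else f x.

Section maxsum_theory.
Variables (f : T -> R) (C : R).
Hypothesis mf : measurable_fun setT f.
Hypothesis fC : forall x, `|f x| <= C.

Lemma maxsum_measurable n : measurable_fun setT (maxsum f n).
Proof.
elim: n => [//|n IH] /=; apply: measurable_funD => //.
by apply: measurable_maxr => //; exact: (measurableT_comp IH mtau).
Qed.

Lemma maxsum_bounded n x : `|maxsum f n x| <= C *+ n.+1.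
Proof.
elim: n x => [|n IH] x //=.
rewrite mulrS (le_trans (ler_normD _ _))// lerD//.
have := IH (tau x); rewrite ler_norml => /andP[h1 h2].
have C0 : 0 <= C *+ n.+1 by apply: le_trans (IH x).
rewrite ger0_norm ?le_max ?lexx//.
by rewrite ge_max C0.
Qed.

Lemma maxsum_le n x : maxsum f n x <= maxsum f n.+1 x.
Proof.
elim: n x => [|n IH] x; first by rewrite /= lerDl le_max lexx.
rewrite /= lerD2l; apply: le_max2 => //; exact: IH.
Qed.

Lemma maxsum_ge n x : f x <= maxsum f n x.
Proof. by case: n => [//|n] /=; rewrite lerDl le_max lexx. Qed.

Lemma sum_le_maxsum n x : \sum_(k < n.+1) f (iter k tau x) <= maxsum f n x.
Proof.
elim: n x => [|n IH] x; first by rewrite big_ord1.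
rewrite big_ord_recl /= lerD2l le_max; apply/orP; right.
apply: le_trans (IH (tau x)); apply: ler_sum => i _.
by rewrite -iterSr.
Qed.

(** The points whose ergodic sums are unbounded above. Passing from [x] to [tau x] changes the sums
    by the fixed amount [f x], so [A] is exactly invariant and ergodicity applies to it. *)
Let A := [set x | forall M : nat, exists n, M%:R < maxsum f n x].

Let mA : measurable A.
Proof.
rewrite (_ : A = \bigcap_(M : nat) \bigcup_n ([set: T] `&` maxsum f n @^-1` `]M%:R, +oo[)).
  apply: bigcapT_measurable => M; apply: bigcupT_measurable => n.
  by apply: maxsum_measurable.
apply/seteqP; split => x /=.
  move=> h M _; have [n hn] := h M; exists n => //; split => //=.
  by rewrite in_itv /= hn.
move=> h M; have [//|n _ [_ /=]] := h M; rewrite in_itv /= andbT => hn.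
by exists n.
Qed.

Let A_inv : tau @^-1` A = A.
Proof.
apply/seteqP; split => x /= h M.
  have [n hn] := h (Num.trunc (M%:R - f x)).+1.
  exists n.+1; rewrite /= -ltrBlDl.
  apply: lt_trans (truncnS_gt _) _; apply: lt_le_trans hn _.
  by rewrite le_max lexx orbT.
have [n hn] := h (Num.trunc (M%:R + `|f x|)).+1.
have {}hn : M%:R + `|f x| < maxsum f n x by exact: lt_trans (truncnS_gt _) hn.
case: n hn => [|n] /= hn.
  by have := ler_norm (f x); have := ler0n R M; lra.
exists n; move: hn; rewrite -ltrBlDl lt_max => /orP[].
  by have := ler_norm (f x); have := ler0n R M; lra.
by have := ler_norm (f x); lra.
Qed.

(** If [A] had measure 1, then [g n = maxsum f n.+1 - maxsum f n \o tau] would converge boundedly to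
    [f] almost everywhere, since [g n x = f x] as soon as [maxsum f n (tau x) >= 0]. Invariance of
    [mu] and monotonicity of [maxsum] in [n] make each integral of [g n] nonnegative, so the
    integral of [f] would be nonnegative too. *)
Lemma maximal_ergodic : (\int[mu]_x (f x)%:E < 0)%E ->
  {ae mu, forall x, exists M : R, forall n, \sum_(k < n) f (iter k tau x) <= M}.
Proof.
move=> f_lt0; exists A; split => //; last first.
  move=> x /= nx M; apply: contrapT => /forallNP h; apply: nx.
  exists M%:R => -[|n]; first by rewrite big_ord0 ler0n.
  by apply: le_trans (sum_le_maxsum n x) _; rewrite leNgt; apply/negP.
have [//|A1] := tau_erg mA A_inv; exfalso.
have C0 : 0 <= C by exact: le_trans (fC point).
pose g n x := maxsum f n.+1 x - maxsum f n (tau x).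
have mg n : measurable_fun setT (g n).
  apply: measurable_funB; first exact: maxsum_measurable.
  exact: (measurableT_comp (maxsum_measurable n) mtau).
have gE n x : g n x = f x + Num.max (- maxsum f n (tau x)) 0.
  rewrite /g /= -addrA; congr (_ + _); set m := maxsum f n (tau x).
  by case: (leP 0 m) => hm; [rewrite max_r; lra|rewrite max_l; lra].
have g_bd n x : `|g n x| <= C + C.
  rewrite gE (le_trans (ler_normD _ _))// lerD//.
  rewrite ger0_norm ?le_max ?lexx ?orbT// ge_max C0 andbT lerNl.
  apply: le_trans (maxsum_ge n _); have := fC (tau x).
  by rewrite ler_norml => /andP[].
have int_m n : mu.-integrable setT (EFin \o maxsum f n).
  exact: bounded_integrable (maxsum_measurable n) (maxsum_bounded n).
have int_mt n : mu.-integrable setT (EFin \o (maxsum f n \o tau)).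
  apply: (@bounded_integrable _ (C *+ n.+1)) => [|x]; last exact: maxsum_bounded.
  exact: (measurableT_comp (maxsum_measurable n) mtau).
have g_ge0 n : (0 <= \int[mu]_x (g n x)%:E)%E.
  under eq_integral do rewrite /g EFinB.
  rewrite (integralB_EFin _ (int_m n.+1) (int_mt n)) //=.
  rewrite (integral_invariant (maxsum_measurable n) (maxsum_bounded n)).
  rewrite sube_ge0; last first.
    by rewrite (integrable_fin_num measurableT (int_m n)).
  apply: (le_integral measurableT (int_m n) (int_m n.+1)) => x _.
  by rewrite lee_fin; exact: maxsum_le.
have [|||||_ _ g_cvg] := @dominated_convergence _ _ _ mu setT measurableT
    (fun n x => (g n x)%:E) (EFin \o f) (cst (C + C)%:E).
- by move=> n; exact/measurable_EFinP.
- exact/measurable_EFinP.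
- exists (~` A); split; first exact: measurableC.
    by have := probability_setC mu mA; rewrite A1 subee.
  move=> x /= nx Ax; apply: nx => _; rewrite -A_inv in Ax.
  have [N hN] := Ax 0%N.
  apply: cvg_near_cst; exists N => // n /= Nn; congr EFin.
  rewrite gE max_r ?addr0 // oppr_le0.
  apply: ltW; apply: lt_le_trans hN _.
  have /nondecreasing_seqP h := fun k => maxsum_le k (tau x); exact: h.
- exact: finite_measure_integrable_cst.
- by apply: aeW => x n _; rewrite lee_fin.
suff : (0 <= \int[mu]_x (f x)%:E)%E by rewrite leNgt f_lt0.
rewrite -(cvg_lim _ g_cvg) //; apply: lime_ge; first by apply/cvg_ex; eexists; exact: g_cvg.
by apply: nearW.
Qed.
End maxsum_theory.

Lemma ergodic_sum_le (f : T -> R) (C a : R) :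
  measurable_fun setT f -> (forall x, `|f x| <= C) ->
  (\int[mu]_x (f x)%:E < a%:E)%E ->
  {ae mu, forall x, exists M : R, forall n,
     \sum_(k < n) f (iter k tau x) <= M + n%:R * a}.
Proof.
move=> mf fC fa.
have : (\int[mu]_x (f x - a)%:E < 0)%E.
  under eq_integral do rewrite EFinB.
  rewrite (integralB_EFin _ (bounded_integrable mf fC)) //; last first.
    exact: finite_measure_integrable_cst.
  by rewrite /= integral_cst //= probability_setT mule1 lteBlDr // add0e.
have mfa : measurable_fun setT (fun x => f x - a) by exact: measurable_funB.
have faC x : `|f x - a| <= C + `|a|.
  by apply: le_trans (ler_normB _ _) _; rewrite lerD.
move=> /(maximal_ergodic mfa faC); apply: filterS => x [M hM].
exists M => n; have := hM n; rewrite sumrB sumr_const card_ord -mulr_natl; lra.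
Qed.

(** The one-sided bounds for [f] and [- f], with slopes exceeding their means by [1/(j+1)], hold for
    all [j] off one null set; the constant [M] disappears after division by [n]. *)
Lemma birkhoff_bounded (f : T -> R) (C : R) :
  measurable_fun setT f -> (forall x, `|f x| <= C) ->
  {ae mu, forall x, (n%:R^-1 * \sum_(k < n) f (iter k tau x)) @[n --> \oo] -->
    fine (\int[mu]_x (f x)%:E)}.
Proof.
move=> mf fC; set l := fine _.
have lE : (\int[mu]_x (f x)%:E = l%:E)%E.
  by rewrite fineK //; exact: (integrable_fin_num measurableT (bounded_integrable mf fC)).
have mf' : measurable_fun setT (fun x => - f x) by exact: measurableT_comp.
have fC' x : `|- f x| <= C by rewrite normrN.
have lE' : (\int[mu]_x (- f x)%:E = (- l)%:E)%E.
  under eq_integral do rewrite EFinN.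
  by rewrite (integralN (integrable_add_def measurableT (bounded_integrable mf fC))) ?lE.
have up (j : nat) : {ae mu, forall x, exists M : R, forall n,
     \sum_(k < n) f (iter k tau x) <= M + n%:R * (l + j.+1%:R^-1)}.
  by apply: (ergodic_sum_le mf fC); rewrite lE lte_fin ltrDl invr_gt0.
have dn (j : nat) : {ae mu, forall x, exists M : R, forall n,
     \sum_(k < n) - f (iter k tau x) <= M + n%:R * (- l + j.+1%:R^-1)}.
  by apply: (ergodic_sum_le mf' fC'); rewrite lE' lte_fin ltrDl invr_gt0.
have /ae_foralln := up; have /ae_foralln := dn.
apply: filterS2 => x hdn hup.
apply/cvgrPdist_le => e e0.
have [j hj] : exists j : nat, j.+1%:R^-1 <= e / 2.
  exists (Num.trunc (2 / e)); rewrite -[e / 2]invrK lef_pV2 ?posrE ?invr_gt0 ?divr_gt0 //.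
  by rewrite invf_div ltW // truncnS_gt.
have [M1 h1] := hup j; have [M2 h2] := hdn j.
exists (Num.trunc (2 * (`|M1| + `|M2|) / e)).+1 => // n /= hn.
have n0 : 0 < n%:R :> R by rewrite ltr0n (leq_trans _ hn).
have hM : (`|M1| + `|M2|) <= n%:R * (e / 2).
  have : 2 * (`|M1| + `|M2|) / e <= n%:R.
    by apply: le_trans (ltW (truncnS_gt _)) _; rewrite ler_nat.
  by rewrite ler_pdivrMr //; lra.
have {h1} := h1 n; have {h2} := h2 n; rewrite sumrN; set S := \sum_(_ < _) _.
have hjn : n%:R * j.+1%:R^-1 <= n%:R * (e / 2) by rewrite ler_pM2l.
move=> h2 h1.
rewrite -(@ler_pM2l _ n%:R) // -{1}(gtr0_norm n0) -normrM mulrBr mulrA divff ?gt_eqF // mul1r.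
move: h1 h2 hM hjn; rewrite !mulrDr mulrN [n%:R * (e / 2)]mulrA.
move: (n%:R * l) (n%:R * j.+1%:R^-1) (n%:R * e) S => p a b s.
have := ler_norm M1; have := ler_norm M2.
have := normr_ge0 M1; have := normr_ge0 M2.
by move=> *; rewrite ler_norml; apply/andP; split; lra.
Qed.

Lemma mean_ergodic_bounded (f : T -> R) (C : R) :
  measurable_fun setT f -> (forall x, `|f x| <= C) ->
  (\int[mu]_x `|n%:R^-1 * \sum_(k < n) f (iter k tau x) -
               fine (\int[mu]_x (f x)%:E)|%:E)%E @[n --> \oo] --> 0%E.
Proof.
move=> mf fC; set l := fine _.
have C0 : 0 <= C by exact: le_trans (fC point).
have [|||||_ + _] := @dominated_convergence _ _ _ mu setT measurableT
    (fun n x => (n%:R^-1 * \sum_(k < n) f (iter k tau x))%:E) (cst l%:E) (cst C%:E).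
- move=> n; apply/measurable_EFinP; apply: measurable_funM => //.
  apply: measurable_sum => k; exact: (measurableT_comp mf (measurable_iter k)).
- exact: measurable_cst.
- have := birkhoff_bounded mf fC; apply: filterS => x h _.
  by apply/fine_cvgP; split => //; exact: nearW.
- exact: finite_measure_integrable_cst.
- apply: aeW => x n _; rewrite lee_fin normrM ger0_norm ?invr_ge0 //.
  case: n => [|n]; first by rewrite big_ord0 normr0 mulr0.
  rewrite ler_pdivrMl // (le_trans (ler_norm_sum _ _ _)) //.
  by rewrite mulr_natl -[X in _ *+ X]card_ord -sumr_const; apply: ler_sum.
by [].
Qed.

End birkhoff.

(** * Stationary ergodic processes on path space *)

Section path_space.
Context d (E : measurableType d).

Definition cylinders : set (set (int -> E)) :=
  [set A | exists (t : int) (B : set E), measurable B /\ A = [set x | B (x t)]].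

Definition path_space := g_sigma_algebraType cylinders.

Lemma measurable_eval (t : int) : measurable_fun setT (fun x : path_space => x t).
Proof.
move=> _ B mB; rewrite setTI; apply: sub_sigma_algebra.
by exists t, B.
Qed.

Lemma measurable_to_path d' (T : measurableType d') (f : T -> path_space) :
  (forall t, measurable_fun setT (fun w => f w t)) -> measurable_fun setT f.
Proof.
move=> mf; apply: (@measurability _ _ _ _ setT f cylinders) => //.
by move=> _ [_ [t [B [mB ->]]] <-]; exact: mf.
Qed.

Definition path_shift (h : int) (x : path_space) : path_space := fun t => x (t + h).

Lemma measurable_path_shift h : measurable_fun setT (path_shift h).
Proof. by apply: measurable_to_path => t; exact: measurable_eval. Qed.

Lemma iter_path_shift k x : iter k (path_shift 1) x = path_shift k%:Z x.
Proof.
elim: k => [|k IH] /=; first by apply/funext => t; rewrite /path_shift addr0.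
rewrite IH; apply/funext => t; rewrite /path_shift; congr (x _).
by rewrite -addrA -PoszD.
Qed.

End path_space.
Arguments path_space {d} E.

Section stationary_processes.
Context {R : realType} {dO : measure_display} {Omega : measurableType dO}.
Variable P : probability Omega R.
Context d (E : measurableType d).
Variable S : int -> Omega -> E.
Hypothesis mS : forall t, measurable_fun setT (S t).

Definition path_of (w : Omega) : path_space E := fun t => S t w.

Lemma measurable_path_of : measurable_fun setT path_of.
Proof. exact: measurable_to_path. Qed.

Let X : {mfun Omega >-> path_space E} := mfun_Sub (mem_set measurable_path_of).

(** The path and its shift have the same law. Nonnegativity replaces integrability, because the
    moduli transported by this lemma are not yet known to have finite mean. *)
Lemma stationary_integral (h : int) (g : path_space E -> \bar R) :
  strictly_stationary P S -> measurable_fun setT g -> (forall x, 0 <= g x)%E ->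
  (\int[P]_w g (path_shift h (path_of w)) = \int[P]_w g (path_of w))%E.
Proof.
move=> statS mg g0.
have mSh : measurable_fun setT (path_shift h \o path_of).
  exact: (measurableT_comp (@measurable_path_shift _ E h) measurable_path_of).
pose Xh : {mfun Omega >-> path_space E} := mfun_Sub (mem_set mSh).
transitivity (\int[distribution P Xh]_x g x)%E.
  by rewrite ge0_integral_distribution.
transitivity (\int[distribution P X]_x g x)%E; last first.
  by rewrite ge0_integral_distribution.
by apply: eq_measure_integral => A mA _; exact: statS.
Qed.

Lemma process_mean_ergodic (Phi : path_space E -> R) (C : R) :
  stationary_ergodic P S -> measurable_fun setT Phi -> (forall x, `|Phi x| <= C) ->
  (\int[P]_w `|n%:R^-1 * \sum_(k < n) Phi (path_shift k.+1 (path_of w)) -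
     fine (\int[P]_w (Phi (path_shift 1 (path_of w)))%:E)|%:E)%E
   @[n --> \oo] --> 0%E.
Proof.
move=> [statS ergS] mPhi PhiC.
pose mu : probability (path_space E) R := distribution P X.
(* The extra shift makes the averages run over the times [1, ..., n] of the sample instead of
   [0, ..., n-1]. *)
pose f := Phi \o path_shift 1.
have mf : measurable_fun setT f.
  exact: (measurableT_comp mPhi (@measurable_path_shift _ E 1)).
have fC x : `|f x| <= C by exact: PhiC.
have inv A : measurable A -> mu (path_shift 1 @^-1` A) = mu A.
  by move=> mA; exact: (statS 1 A mA).
have erg A : measurable A -> path_shift 1 @^-1` A = A -> mu A = 0%E \/ mu A = 1%E.
  by move=> mA AA; apply: (ergS A mA) => x; rewrite -{2}AA.
have := mean_ergodic_bounded (@measurable_path_shift _ E 1) inv erg mf fC.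
have -> : (\int[mu]_x (f x)%:E = \int[P]_w (Phi (path_shift 1 (path_of w)))%:E)%E.
  rewrite integral_distribution //; first exact/measurable_EFinP.
  apply: (@bounded_integrable _ _ _ _ (f \o X) C) => [|x]; last exact: fC.
  exact: (measurableT_comp mf measurable_path_of).
set l := fine _.
under eq_fun => n.
  rewrite ge0_integral_distribution //; last first.
    apply/measurable_EFinP; apply: measurableT_comp => //.
    apply: measurable_funB => //; apply: measurable_funM => //.
    apply: measurable_sum => k; apply: (measurableT_comp mf).
    exact: measurable_iter (@measurable_path_shift _ E 1) _.
  over.
apply: cvg_trans; apply: near_eq_cvg; apply: nearW => n /=.
apply: eq_integral => w _ /=; congr (`|_ * _ - _|%:E).
apply: eq_bigr => k _; rewrite iter_path_shift /f /=; congr Phi.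
by apply/funext => t; rewrite /path_shift -addrA -PoszD.
Qed.

End stationary_processes.

(** * Contractive recursions and real powers *)

Section real_powers.
Context {R : realType}.
Implicit Types a b k : R.

Lemma powR_le_add1 a k k' : 0 <= a -> 0 <= k' <= k -> a `^ k' <= 1 + a `^ k.
Proof.
move=> a0 /andP[k0 kk]; have [a1|a1] := leP 1 a.
  by rewrite (le_trans (ler_powR a1 kk)) // lerDr.
have : a `^ k' <= 1 `^ k' by apply: ge0_ler_powR; rewrite ?nnegrE // ltW.
by rewrite powR1 /= => h; rewrite (le_trans h) // lerDl powR_ge0.
Qed.

Lemma powR_le_add1r a k : 0 <= a -> 0 <= k <= 1 -> a `^ k <= 1 + a.
Proof. by move=> a0 k1; have := powR_le_add1 a0 k1; rewrite powRr1. Qed.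

Lemma min1_le_powR a k : 0 <= a -> 0 < k <= 1 -> Num.min 1 a <= a `^ k.
Proof.
move=> a0 /andP[k0 k1]; have [a1|a1] := leP 1 a.
  have : 1 `^ k <= a `^ k by apply: ge0_ler_powR; rewrite ?nnegrE // ltW.
  by rewrite powR1.
move: a0; rewrite le_eqVlt => /predU1P[<-|a0]; first exact: powR_ge0.
by apply: ger1_powR => //; rewrite a0 ltW.
Qed.

(** For [x = a] and [x = b] the ratio [x / (a + b)] lies in [[0, 1]], hence is at most its own
    [k]-th power; the two ratios add up to 1. *)
Lemma powR_subadd a b k : 0 <= a -> 0 <= b -> 0 < k <= 1 ->
  (a + b) `^ k <= a `^ k + b `^ k.
Proof.
move=> a0 b0 k1; have /andP[k0 k_le1] := k1.
have [ab|ab] := leP (a + b) 0.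
  have -> : a + b = 0 by apply/eqP; rewrite eq_le ab addr_ge0.
  by rewrite powR0 ?gt_eqF // addr_ge0 // powR_ge0.
have h x : 0 <= x -> x <= a + b -> x / (a + b) * (a + b) `^ k <= x `^ k.
  move=> x0 xab; have -> : x `^ k = (x / (a + b)) `^ k * (a + b) `^ k.
    by rewrite -powRM ?divr_ge0 ?(ltW ab) // divfK ?gt_eqF.
  apply: ler_wpM2r; first exact: powR_ge0.
  have := min1_le_powR (divr_ge0 x0 (ltW ab)) k1.
  by rewrite min_r // ler_pdivrMr // mul1r.
have := lerD (h a a0 _) (h b b0 _); rewrite lerDl lerDr => /(_ b0 a0).
by rewrite -mulrDl -mulrDl divff ?gt_eqF // mul1r.
Qed.

End real_powers.

Section contraction_recursion.
Context {R : realType}.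

(** Take [rho = 1 - x] with [x = (1 - b) / (q + 1)]: Bernoulli's inequality gives
    [rho ^ q >= 1 - q x >= b]. The power [q] pays for the longest lag of the recursion. *)
Lemma exists_decay_rate (q : nat) (b : R) : b < 1 ->
  exists rho : R, 0 < rho < 1 /\ b <= rho ^+ q.
Proof.
wlog b0 : b / 0 <= b => [hw|] b1.
  have [b0|b0] := leP 0 b; first exact: hw.
  have [rho [h1 h2]] := hw 0 (lexx 0) ltr01; exists rho; split => //.
  by apply: le_trans (ltW b0) h2.
pose x : R := (1 - b) / q.+1%:R.
have q0 : 0 < q.+1%:R :> R by rewrite ltr0n.
have x0 : 0 < x by rewrite divr_gt0 // subr_gt0.
have xq : x * q.+1%:R = 1 - b by rewrite divfK // gt_eqF.
have hx (n : nat) : (n <= q)%N -> 1 - x * n%:R <= (1 - x) ^+ n.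
  have x1 : x <= 1.
    rewrite ler_pdivrMr // mul1r (@le_trans _ _ 1) ?ler1n //; lra.
  elim: n => [|n IH] nq; first by rewrite mulr0 subr0 expr0.
  rewrite exprSr -natr1; have := IH (ltnW nq).
  have := ler0n R n; nra.
case: q q0 @x x0 xq hx => [|q] q0 x x0 xq hx.
  (* For [q = 0] the general choice would be [rho = b], which may be [0]. *)
  by exists (1 / 2); split; [apply/andP; split; lra|rewrite expr0 ltW].
have x1 : x < 1.
  rewrite ltr_pdivrMr // mul1r (@lt_le_trans _ _ 2) ?ler_nat //; lra.
exists (1 - x); split; first by apply/andP; split; lra.
apply: le_trans (hx q.+1 (leqnn _)).
have : x * q.+1%:R <= x * q.+2%:R by rewrite ler_pM2l // ler_nat.
by rewrite xq; lra.
Qed.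

Variables (q : nat) (beta : 'I_q -> R) (rho C0 : R) (e : int -> R) (eta : nat -> R).
Hypotheses (beta0 : forall j, 0 <= beta j) (rho01 : 0 < rho < 1).
Hypothesis beta_rho : \sum_j beta j <= rho ^+ q.
Hypotheses (e0 : forall t, 0 <= e t) (eta0 : forall n, 0 <= eta n) (C0_ge0 : 0 <= C0).
Hypothesis e_init : forall j : nat, (j < q)%N -> e (- j%:Z) <= C0.
Hypothesis e_rec : forall n : nat,
  e n.+1%:Z <= \sum_j beta j * e (n%:Z - (j : nat)%:Z) + eta n.+1.

Fixpoint envelope (n : nat) : R :=
  if n is n'.+1 then rho * envelope n' + eta n'.+1 else C0.

Let rho0 : 0 < rho. Proof. by case/andP: rho01. Qed.
Let rho1 : rho < 1. Proof. by case/andP: rho01. Qed.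

Lemma envelope_ge0 n : 0 <= envelope n.
Proof. by elim: n => [//|n IH] /=; rewrite addr_ge0 // mulr_ge0 // ltW. Qed.

Let lag_le_rho n (j : nat) : (j < q)%N -> rho ^+ j * e (n%:Z - j%:Z) <= envelope n ->
  e (n%:Z - j%:Z) <= rho * envelope n / rho ^+ q.
Proof.
move=> jq h; rewrite ler_pdivlMr ?exprn_gt0 //.
apply: le_trans (ler_wpM2l (ltW rho0) h).
rewrite [leLHS]mulrC mulrA -exprS; apply: ler_wpM2r => //.
by apply: ler_wiXn2l => //; rewrite ltW.
Qed.

(** Each lagged error is at most [rho * envelope n / rho ^ q], as [j < q]; the total weight
    [\sum_j beta j <= rho ^ q] cancels the denominator and leaves the recursion of the envelope. *)
Let step n : (forall j : nat, (j < q)%N -> rho ^+ j * e (n%:Z - j%:Z) <= envelope n) ->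
  e n.+1%:Z <= envelope n.+1.
Proof.
move=> IH; apply: le_trans (e_rec n) _; rewrite /= lerD2r.
apply: (@le_trans _ _ ((\sum_j beta j) * (rho * envelope n / rho ^+ q))).
  rewrite mulr_suml; apply: ler_sum => j _; apply: ler_wpM2l => //.
  by apply: lag_le_rho => //; exact: IH.
have h : 0 <= rho * envelope n by rewrite mulr_ge0 ?envelope_ge0 // ltW.
rewrite mulrC mulrAC ler_pdivrMr ?exprn_gt0 //.
exact: ler_wpM2l.
Qed.

(** The invariant of the induction: lag [j+1] at time [n+1] is lag [j] at time [n] with one more
    factor [rho], which [envelope n.+1 >= rho * envelope n] absorbs, while lag [0] is [step]. *)
Let lagged n (j : nat) : (j < q)%N -> rho ^+ j * e (n%:Z - j%:Z) <= envelope n.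
Proof.
elim: n j => [|n IH] j jq.
  rewrite sub0r; apply: le_trans (e_init jq).
  by rewrite ler_piMl // exprn_ile1 // ltW.
case: j jq => [|j] jq; first by rewrite expr0 mul1r subr0; exact: step.
rewrite (_ : n.+1%:Z - j.+1%:Z = n%:Z - j%:Z); last by lia.
rewrite /= exprS -mulrA; apply: le_trans (ler_wpM2l (ltW rho0) (IH j (ltnW jq))) _.
by rewrite lerDl.
Qed.

Lemma error_le_envelope n : e n.+1%:Z <= envelope n.+1.
Proof. by apply: step => j jq; exact: lagged. Qed.

Lemma lagged_error_le_envelope n (j : nat) : (j < q)%N ->
  e (n%:Z - j%:Z) <= envelope n.+1 / rho ^+ q.
Proof.
move=> jq; apply: le_trans (lag_le_rho jq (lagged n jq)) _.
by rewrite ler_pM2r ?invr_gt0 ?exprn_gt0 //= lerDl.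
Qed.

(** By subadditivity the [k]-th powers obey the same recursion with rate [r = rho ^ k], and
    summation over [n] gives the bound. *)
Lemma envelope_sum (k : R) N : 0 < k <= 1 ->
  (1 - rho `^ k) * \sum_(n < N) envelope n.+1 `^ k <=
    C0 `^ k + \sum_(n < N) eta n.+1 `^ k.
Proof.
move=> k1; set r := rho `^ k.
have r1 : r <= 1.
  have := @ge0_ler_powR _ k _ rho 1; rewrite powR1 /= !nnegrE; apply => //; last exact: ltW.
  - by case/andP: k1 => /ltW.
  - exact: ltW.
(* Keeping the boundary term [r * envelope N ^ k] on the left makes the induction on [N] close: its
   increment is exactly one instance of the recursion. *)
suff : (1 - r) * \sum_(n < N) envelope n.+1 `^ k + r * envelope N `^ k <=
    r * C0 `^ k + \sum_(n < N) eta n.+1 `^ k.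
  have : 0 <= r * envelope N `^ k by rewrite mulr_ge0 // powR_ge0.
  have : r * C0 `^ k <= C0 `^ k by rewrite ler_piMl // powR_ge0.
  lra.
elim: N => [|N IH]; first by rewrite !big_ord0 mulr0 add0r addr0.
rewrite !big_ord_recr /=.
have := powR_subadd (mulr_ge0 (ltW rho0) (envelope_ge0 N)) (eta0 N.+1) k1.
rewrite powRM ?(ltW rho0) ?envelope_ge0 // -/r.
move: IH; set s := \sum_(_ < _) _; set t := \sum_(_ < _) _.
move: (r * C0 `^ k) (r * _) => x y; nra.
Qed.

End contraction_recursion.

(** * Measurability of the link functions and generating functions *)

Section discretization.
Context d (Omega : measurableType d) (R : realType).

Lemma measurable_countable_comp (C : countType) d' (E : measurableType d')
    (c : Omega -> C) (g : C -> E) :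
  (forall x, measurable (c @^-1` [set x])) -> measurable_fun setT (g \o c).
Proof.
move=> mc _ B mB; rewrite setTI.
rewrite (_ : _ @^-1` B = \bigcup_x (if asbool (B (g x)) then c @^-1` [set x] else set0)).
  apply: countable_bigcupT_measurable; first exact: countableP.
  by move=> x; case: asboolP.
apply/seteqP; split => [w Bw|w [x _]] /=.
  by exists (c w) => //; rewrite asboolT.
by case: asboolP => //= Bx wx; rewrite wx.
Qed.

(* [xi] is a pointwise limit of countably-valued measurable maps with values
   in [A]; this is stable under products, whatever the Borel sets of the product
   topology, and makes [f \o xi] measurable for [f] continuous on [A]. *)
Definition discretizable (U : topologicalType) (A : set U) (xi : Omega -> U) :=
  exists (C : countType) (c : nat -> Omega -> C) (v : nat -> C -> U),
    [/\ forall k x, measurable (c k @^-1` [set x]),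
        forall k w, A (v k (c k w)) &
        forall w, A (xi w) /\ (fun k => v k (c k w)) @ \oo --> xi w].

Lemma discretizable_pair (U V : topologicalType) (A : set U) (B : set V)
    (xi : Omega -> U) (ups : Omega -> V) :
  discretizable A xi -> discretizable B ups ->
  discretizable [set p | A p.1 /\ B p.2] (fun w => (xi w, ups w)).
Proof.
move=> [C [c [v [mc Av cv]]]] [C' [c' [v' [mc' Bv' cv']]]].
exists (C * C')%type, (fun k w => (c k w, c' k w)), (fun k p => (v k p.1, v' k p.2)).
split=> [k [x x']|k w|w] /=.
- rewrite (_ : _ @^-1` _ = c k @^-1` [set x] `&` c' k @^-1` [set x']).
    exact: measurableI.
  by apply/seteqP; split => w /= [-> ->].
- by split.
- have [h1 h2] := cv w; have [h3 h4] := cv' w; split => //.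
  exact: cvg_pair.
Qed.

(** Continuity is only relative to [A]; it passes to the limit because the approximations themselves
    stay in [A]. *)
Lemma discretizable_measurable (U : topologicalType) (A : set U) (xi : Omega -> U)
    (f : U -> R) :
  discretizable A xi -> {within A, continuous f} ->
  measurable_fun setT (f \o xi).
Proof.
move=> [C [c [v [mc Av cv]]]] /subspace_continuousP fc.
apply: (@measurable_fun_cvg _ _ _ _ (fun k => (f \o v k) \o c k)).
  by move=> k; exact: measurable_countable_comp.
move=> w _ /=; have [Axi cw] := cv w.
apply: (cvg_comp (fun k => v k (c k w)) f _ (fc _ Axi)).
move=> B wB; have [N _ hN] := cw _ wB; exists N => // k Nk.
exact: (hN k Nk (Av k w)).
Qed.

Let rnd (k : nat) (x : R) : int := Num.floor (k.+1%:R * x).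

(** Coordinates are rounded down to the grid of mesh [1/(k+1)]. Rounding down preserves
    nonnegativity, so the approximations stay in the nonnegative orthant when [A] is that set. *)
Lemma discretizable_row n (A : set 'rV[R]_n) (xi : Omega -> 'rV[R]_n) :
  (forall j, measurable_fun setT (fun w => xi w 0 j)) ->
  (A = setT \/ A = [set v | nneg_row v]) -> (forall w, A (xi w)) ->
  discretizable A xi.
Proof.
move=> mxi hA Axi.
exists 'rV[int]_n, (fun k w => \row_j rnd k (xi w 0 j)),
  (fun (k : nat) (z : 'rV[int]_n) => \row_j ((z 0 j)%:~R / k.+1%:R) : 'rV[R]_n).
split=> [k z|k w|w].
- rewrite (_ : _ @^-1` _ = \bigcap_(j in [set: 'I_n])
     ((fun w => xi w 0 j) @^-1` [set x | rnd k x = z 0 j])).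
    apply: fin_bigcap_measurable => // j _; rewrite -[X in measurable X]setTI.
    apply: mxi => //.
    rewrite (_ : [set x | _] = [set` `[(z 0 j)%:~R / k.+1%:R, (z 0 j + 1)%:~R / k.+1%:R[ ]).
      exact: measurable_itv.
    apply/seteqP; split => x /=; rewrite in_itv /= /rnd.
      by move=> <-; rewrite ler_pdivrMr // ltr_pdivlMr // mulrC; exact: floor_itv.
    rewrite ler_pdivrMr // ltr_pdivlMr // mulrC => h; exact: floor_def.
  apply/seteqP; split => w /=; first by move=> <- j _; rewrite /= mxE.
  by move=> h; apply/rowP => j; rewrite mxE; exact: (h j I).
- case: hA Axi => -> // Axi j; rewrite !mxE divr_ge0 // ler0z.
  by rewrite floor_ge0 mulr_ge0 //; exact: Axi.
- split; first exact: Axi.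
  apply/cvg_ballP => e e0.
  exists (Num.trunc e^-1) => // k /= hk; split => // i j; rewrite ord1 !mxE.
  have k0 : 0 < k.+1%:R :> R by [].
  have := floor_itv (k.+1%:R * xi w 0 j); rewrite -/(rnd k _) => /andP[h1 h2].
  have h3 : e^-1 < k.+1%:R.
    by apply: lt_le_trans (truncnS_gt _) _; rewrite ler_nat.
  rewrite /ball /= -(@ltr_pM2l _ k.+1%:R) // -{1}(gtr0_norm k0) -normrM mulrBr.
  rewrite mulrCA divff ?gt_eqF // mulr1.
  have : 1 < k.+1%:R * e by rewrite -ltr_pdivrMr // div1r.
  apply: le_lt_trans; rewrite ger0_norm ?subr_ge0 //.
  by rewrite lerBlDl; move: h2; rewrite intrD => /ltW.
Qed.

End discretization.
Section row_measurability.
Context d (T : measurableType d) (R : realType).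

Lemma measurable_coord n (f : T -> 'rV[R]_n) j :
  measurable_fun setT f -> measurable_fun setT (fun w => f w 0 j).
Proof. by move=> mf; exact: (measurable_fun_matrixP f).1. Qed.

Lemma measurable_rowP n (f : T -> 'rV[R]_n) :
  (forall j, measurable_fun setT (fun w => f w 0 j)) -> measurable_fun setT f.
Proof. by move=> mf; apply: (measurable_fun_matrixP f).2 => i j; rewrite ord1. Qed.

Lemma measurable_row_mx n1 n2 (f : T -> 'rV[R]_n1) (g : T -> 'rV[R]_n2) :
  measurable_fun setT f -> measurable_fun setT g ->
  measurable_fun setT (fun w => row_mx (f w) (g w)).
Proof.
move=> mf mg; apply: measurable_rowP => j; case: (splitP j) => k jk.
  rewrite (_ : (fun _ => _) = fun w => f w 0 k); first exact: measurable_coord.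
  by apply/funext => w; rewrite (_ : j = lshift n2 k) ?row_mxEl //; exact/val_inj.
rewrite (_ : (fun _ => _) = fun w => g w 0 k); first exact: measurable_coord.
by apply/funext => w; rewrite (_ : j = rshift n1 k) ?row_mxEr //; exact/val_inj.
Qed.

Lemma measurable_dotp n (f g : T -> 'rV[R]_n) :
  measurable_fun setT f -> measurable_fun setT g ->
  measurable_fun setT (fun w => dotp (f w) (g w)).
Proof.
move=> mf mg; apply: measurable_sum => i.
by apply: measurable_funM; exact: measurable_coord.
Qed.

Lemma measurable_enorm n (f : T -> 'rV[R]_n) :
  measurable_fun setT f -> measurable_fun setT (fun w => enorm (f w)).
Proof.
move=> mf.
have ms : measurable_fun [set: R] (@Num.sqrt R).
  by apply: continuous_measurable_fun; exact: sqrt_continuous.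
apply: (measurableT_comp ms).
by apply: measurable_sum => i; apply: measurable_funX; exact: measurable_coord.
Qed.

Lemma measurable_lagvec n (f : T -> int -> R) t :
  (forall s, s < t -> measurable_fun setT (f ^~ s)) ->
  measurable_fun setT (fun w => lagvec n (f w) t).
Proof.
move=> mf; apply: measurable_rowP => j.
rewrite (_ : (fun _ => _) = f ^~ (t - (j.+1)%:Z)); first by apply: mf; lia.
by apply/funext => w; rewrite mxE.
Qed.

Lemma measurable_zvec p q m (y l : T -> int -> R) (x : T -> int -> 'rV[R]_m) t :
  (forall s, s < t -> measurable_fun setT (y ^~ s)) ->
  (forall s, s < t -> measurable_fun setT (l ^~ s)) ->
  measurable_fun setT (x ^~ (t - 1)) ->
  measurable_fun setT (fun w => zvec p q (y w) (l w) (x w) t).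
Proof.
move=> my ml mx; apply: measurable_row_mx => //; apply: measurable_row_mx.
  exact: measurable_lagvec.
exact: measurable_lagvec.
Qed.

End row_measurability.

(** * Generating functions and their measurability in the parameter *)

Section pgf_theory.
Context {R : realType}.
Variable F : R -> probability nat R.
Implicit Types l u : R.

Let atom (l : R) (k : nat) : R := fine (F l [set k]).

Lemma atom_ge0 l k : 0 <= fine (F l [set k]).
Proof. exact: fine_ge0. Qed.

Let atom_fin l k : F l [set k] = (atom l k)%:E.
Proof. by rewrite fineK // fin_num_measure. Qed.

Lemma pgf_seriesE l u :
  pgf F l u = fine (\sum_(k <oo) (u ^+ k * fine (F l [set k]))%:E)%E.
Proof. by congr fine; apply: eq_eseriesr => k _; rewrite atom_fin. Qed.

Lemma atom_series l : (\sum_(k <oo) (fine (F l [set k]))%:E = 1)%E.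
Proof.
rewrite -(probability_setT (F l)).
have -> : [set: nat] = \bigcup_k [set k] by apply/seteqP; split => // k _; exists k.
rewrite measure_bigcup //; last by move=> i j _ _ [k [/= <- <-]].
by apply/congr_lim/funext => n; apply: eq_big => [k|k _]; rewrite ?mem_setT ?fineK ?fin_num_measure.
Qed.

Lemma pgf_cvg l u : 0 <= u <= 1 ->
  (\sum_(0 <= k < n) u ^+ k * fine (F l [set k])) @[n --> \oo] --> pgf F l u.
Proof.
move=> /andP[u0 u1].
have t0 k : (0 <= (u ^+ k * atom l k)%:E)%E.
  by rewrite lee_fin mulr_ge0 ?exprn_ge0 ?atom_ge0.
have S1 : (\sum_(k <oo) (u ^+ k * atom l k)%:E <= 1)%E.
  rewrite -(atom_series l); apply: lee_nneseries => k _ //.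
  by rewrite lee_fin ler_piMl ?atom_ge0 // exprn_ile1.
have S0 : (0 <= \sum_(k <oo) (u ^+ k * atom l k)%:E)%E by exact: nneseries_ge0.
have : (\sum_(0 <= k < n) (u ^+ k * atom l k)%:E)%E @[n --> \oo] --> (pgf F l u)%:E.
  rewrite pgf_seriesE fineK.
    by apply: is_cvg_nneseries => n _ _; exact: t0.
  by rewrite ge0_fin_numE // (le_lt_trans S1) // ltry.
under eq_fun do rewrite sumEFin.
exact: fine_cvg.
Qed.

Lemma pgf_bounds l u : 0 <= u <= 1 -> 0 <= pgf F l u <= 1.
Proof.
move=> u01; have /andP[u0 u1] := u01.
have h := @pgf_cvg l u u01.
rewrite -(cvg_lim _ h) //; apply/andP; split.
  apply: limr_ge; first by apply/cvg_ex; eexists; exact: h.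
  by apply: nearW => n; apply: sumr_ge0 => k _; rewrite mulr_ge0 ?exprn_ge0 ?atom_ge0.
apply: limr_le; first by apply/cvg_ex; eexists; exact: h.
apply: nearW => n.
apply: (@le_trans _ _ (\sum_(0 <= k < n) fine (F l [set k]))).
  by apply: ler_sum => k _; rewrite ler_piMl ?atom_ge0 // exprn_ile1.
rewrite -lee_fin -sumEFin -(atom_series l).
by apply: (nneseries_lim_ge n) => k _ _; rewrite lee_fin atom_ge0.
Qed.

Hypothesis F_order : stoch_order F.

(** The stochastic order makes the distribution function at a fixed point nonincreasing in [l],
    hence measurable; the mass at [k] is its increment between [k - 1/2] and [k]. *)
Lemma measurable_atom k :
  measurable_fun setT (fun l : R => if 0 < l then fine (F l [set k]) else 0).
Proof.
have mcdf (y : R) : measurable_fun setT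
    (* The value [1] at [l <= 0] keeps the function nonincreasing on the whole line. *)
    (fun l : R => if 0 < l then fine (F l [set k : nat | k%:R <= y]) else 1).
  apply: nonincreasing_measurable => // l1 l2 l12 /=.
  have [l2_0|l2_0] := ltP 0 l2; have [l1_0|l1_0] := ltP 0 l1 => //.
  - by rewrite fine_le ?fin_num_measure //; exact: F_order.
  - by rewrite -lee_fin fineK ?fin_num_measure //; exact: probability_le1.
  - by have := lt_le_trans l1_0 l12; rewrite ltNge l2_0.
rewrite (_ : (fun _ => _) = fun l : R =>
    (if 0 < l then fine (F l [set j : nat | j%:R <= k%:R :> R]) else 1) -
    (if 0 < l then fine (F l [set j : nat | j%:R <= k%:R - 1 / 2 :> R]) else 1)).
  by apply: measurable_funB; exact: mcdf.
apply/funext => l; case: ifPn => _; last by rewrite subrr.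
rewrite (_ : [set j : nat | j%:R <= k%:R :> R] =
  [set j : nat | j%:R <= k%:R - 1 / 2 :> R] `|` [set k]).
  rewrite measureU //; last first.
    by apply/seteqP; split => // j /= [+ jk]; rewrite jk; lra.
  by rewrite fineD ?fin_num_measure // addrAC subrr add0r.
apply/seteqP; split => j /=; last by case=> [h|->//]; lra.
rewrite ler_nat leq_eqVlt => /predU1P[->|]; first by right.
by rewrite -(ler_nat R) -natr1 => h; left; lra.
Qed.

Lemma measurable_pgf d (T : measurableType d) (l u : T -> R) :
  measurable_fun setT l -> measurable_fun setT u -> (forall x, 0 <= u x <= 1) ->
  measurable_fun setT (fun x => if 0 < l x then pgf F (l x) (u x) else 0).
Proof.
move=> ml mu u01.
apply: (@measurable_fun_cvg _ _ _ _ (fun n x => \sum_(0 <= k < n)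
  (u x ^+ k * (if 0 < l x then fine (F (l x) [set k]) else 0)))).
  move=> n; apply: measurable_sum => k; apply: measurable_funM.
    exact: measurable_funX.
  exact: (measurableT_comp (measurable_atom k) ml).
move=> x _; case: ifPn => _; first exact: pgf_cvg.
rewrite (_ : (fun _ => _) = cst 0); first exact: cvg_cst.
by apply/funext => n; rewrite big1 // => k _; rewrite mulr0.
Qed.

End pgf_theory.

(** * Conditional generating functions *)

Lemma measurable_fun_nat d (T : measurableType d) (g : nat -> T) : measurable_fun setT g.
Proof. by move=> _ B _. Qed.

Section conditional_pgf.
Context {R : realType} {dO : measure_display} {Omega : measurableType dO}.
Variable P : probability Omega R.
Variables (G : set (set Omega)) (N : Omega -> nat) (F : R -> probability nat R).
Variables (lam : Omega -> R) (u : R).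
Hypothesis G_meas : forall A, G A -> measurable A.
Hypothesis GT : G setT.
Hypothesis mN : measurable_fun setT N.
Hypothesis mlam : measurable_fun setT lam.
Hypothesis lam_gt0 : forall w, 0 < lam w.
Hypothesis F_order : stoch_order F.
Hypothesis N_law : cond_law P G N (fun w => F (lam w)).
Hypothesis u01 : 0 <= u <= 1.

Let u0 : 0 <= u. Proof. by case/andP: u01. Qed.
Let u1 : u <= 1. Proof. by case/andP: u01. Qed.

Let m_atom k : measurable_fun setT (fun w => fine (F (lam w) [set k])).
Proof.
have := measurableT_comp (measurable_atom F_order k) mlam.
by apply: eq_measurable_fun => w _ /=; rewrite lam_gt0.
Qed.

Let m_pow : measurable_fun setT (fun w => u ^+ N w).
Proof. exact: (measurableT_comp (measurable_fun_nat (fun k => u ^+ k)) mN). Qed.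

Let m_pgf : measurable_fun setT (fun w => pgf F (lam w) u).
Proof.
have := measurable_pgf F_order mlam (measurable_cst u) (fun=> u01).
by apply: eq_measurable_fun => w _ /=; rewrite lam_gt0.
Qed.

Let D w := u ^+ N w - pgf F (lam w) u.

Let mD : measurable_fun setT D. Proof. exact: measurable_funB. Qed.

Let D_bd w : `|D w| <= 1.
Proof.
have := @pgf_bounds _ F (lam w) u u01; have := exprn_ge0 (N w) u0.
have := exprn_ile1 (N w) u0 u1; rewrite /D ler_norml => h1 h2 /andP[h3 h4].
by apply/andP; split; lra.
Qed.

Let series_pow w : (\sum_(k <oo) (u ^+ k * (N w == k)%:R)%:E = (u ^+ N w)%:E)%E.
Proof.
rewrite (@nneseriesD1 _ _ (N w)) //=; last first.
  by move=> k _; rewrite lee_fin mulr_ge0 // exprn_ge0.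
rewrite eqxx mulr1 eseries0 ?adde0 // => k _ /= kN.
by rewrite eq_sym (negbTE kN) mulr0.
Qed.

Let series_pgf w : (\sum_(k <oo) (u ^+ k * fine (F (lam w) [set k]))%:E =
  (pgf F (lam w) u)%:E)%E.
Proof.
apply/cvg_lim => //; under eq_fun do rewrite sumEFin.
by apply: cvg_EFin; [exact: nearW|exact: pgf_cvg].
Qed.

(** Both sides are power series in [u] with nonnegative terms; after exchanging sum and integral,
    the coefficients of [u ^ k] agree by the conditional law applied to [[set k]]. *)
Let event_eq A : G A ->
  (\int[P]_(w in A) (u ^+ N w)%:E = \int[P]_(w in A) (pgf F (lam w) u)%:E)%E.
Proof.
move=> GA; have mA := G_meas GA.
under eq_integral do rewrite -series_pow.
under [RHS]eq_integral do rewrite -series_pgf.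
have uk k : 0 <= u ^+ k by rewrite exprn_ge0.
have mNk k : measurable_fun setT (fun w => (N w == k)%:R : R).
  exact: (measurableT_comp (measurable_fun_nat (fun j => (j == k)%:R : R)) mN).
have F0 k w : (0 <= (fine (F (lam w) [set k]))%:E)%E by rewrite lee_fin fine_ge0.
rewrite !integral_nneseries //.
- apply: eq_eseriesr => k _.
  under eq_integral do rewrite EFinM.
  rewrite ge0_integralZl //; last 2 first.
    by apply: measurable_funS (measurableT) _ _ => //; exact/measurable_EFinP.
    by rewrite lee_fin.
  under [RHS]eq_integral do rewrite EFinM.
  rewrite ge0_integralZl //; last 2 first.
    by apply: measurable_funS (measurableT) _ _ => //; exact/measurable_EFinP.
    by rewrite lee_fin.
  congr (_ * _)%E.
  under [RHS]eq_integral do rewrite fineK ?fin_num_measure //.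
  rewrite -N_law //.
  rewrite (_ : (fun _ => _) = (fun w => (\1_(N @^-1` [set k]) w)%:E)).
    rewrite integral_indic // 1?setIC //.
    by rewrite -[X in measurable X]setTI; exact: mN.
  apply/funext => w; rewrite indicE; congr (_%:R%:E); congr nat_of_bool.
  apply/eqP/idP => [Nw|]; first by rewrite inE.
  by rewrite inE.
- move=> k; apply: measurable_funS (measurableT) _ _ => //.
  by apply/measurable_EFinP; apply: measurable_funM.
- by move=> k w _; rewrite lee_fin mulr_ge0 // fine_ge0.
- move=> k; apply: measurable_funS (measurableT) _ _ => //.
  by apply/measurable_EFinP; apply: measurable_funM.
- by move=> k w _; rewrite lee_fin mulr_ge0.
Qed.

Let event_zero A : G A -> \int[P]_w (D w * \1_A w) = 0.
Proof.
move=> GA; have mA := G_meas GA.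
have -> : \int[P]_w (D w * \1_A w) = \int[P]_(w in A) D w.
  rewrite [RHS]Rintegral_mkcond; apply: eq_Rintegral => w _.
  by rewrite patchE indicE; case: (w \in A); rewrite ?mulr1 ?mulr0.
have int1 (f : Omega -> R) : measurable_fun setT f -> (forall w, `|f w| <= 1) ->
    P.-integrable A (EFin \o f).
  move=> mf f1; apply: (@integrableS _ _ _ _ setT) => //.
  exact: bounded_integrable mf f1.
rewrite /D RintegralB //; first by rewrite /Rintegral event_eq // subrr.
- by apply: int1 => // w; rewrite ger0_norm ?exprn_ile1 ?exprn_ge0.
- apply: int1 => // w; have /andP[h1 h2] := @pgf_bounds _ F (lam w) u u01.
  by rewrite ger0_norm.
Qed.

Let int_D (f : Omega -> R) (C : R) : measurable_fun setT f -> (forall w, `|f w| <= C) ->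
  P.-integrable setT (EFin \o (fun w => D w * f w)).
Proof.
move=> mf fC; apply: (@bounded_integrable _ _ _ _ _ C) => [|w].
  exact: measurable_funM.
rewrite normrM (le_trans (ler_pM _ _ (D_bd w) (fC w))) ?mul1r //.
Qed.

(** From events to functions: [phi] is a uniform limit of averages of indicators of its superlevel
    sets, which belong to [G], and [D] is bounded by 1. *)
Let unit_zero (phi : Omega -> R) : (forall a : R, G [set w | a <= phi w]) ->
  measurable_fun setT phi -> (forall w, 0 <= phi w <= 1) ->
  \int[P]_w (D w * phi w) = 0.
Proof.
move=> Gphi mphi phi01.
suff h (n : nat) : `|\int[P]_w (D w * phi w)| <= n.+1%:R^-1.
  apply/eqP; rewrite -normr_eq0 eq_le normr_ge0 andbT leNgt; apply/negP => h0.
  have := h (Num.trunc `|\int[P]_w (D w * phi w)|^-1).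
  rewrite leNgt => /negP; apply; rewrite invf_plt ?posrE //.
  exact: truncnS_gt.
pose A (j : nat) := [set w | j.+1%:R / n.+1%:R <= phi w].
have GA j : G (A j) by exact: Gphi.
have n0 : 0 < n.+1%:R :> R by [].
(* At [k = n.+1] this counts the levels below [phi w]: it is the integer part of [(n+1) * phi w], so
   after division by [n+1] it misses [phi w] by at most [1/(n+1)]. *)
pose approx k w : R := \sum_(0 <= j < k) \1_(A j) w.
have m_approx k : measurable_fun setT (approx k).
  by apply: measurable_sum => j; exact/measurable_indicP/G_meas.
have approx_bd k w : `|approx k w| <= k%:R.
  rewrite (le_trans (ler_norm_sum _ _ _)) // -[k in k%:R]subn0 -sumr_const_nat.
  apply: ler_sum => j _; rewrite indicE ger0_norm //; by case: (_ \in _).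
have approx0 k : \int[P]_w (D w * approx k w) = 0.
  elim: k => [|k IH].
    under eq_Rintegral do rewrite /approx big_nil mulr0.
    by rewrite Rintegral_cst // mul0r.
  under eq_Rintegral do rewrite /approx big_nat_recr //= mulrDr.
  rewrite RintegralD //; first by rewrite IH event_zero // addr0.
    exact: int_D (m_approx k) (approx_bd k).
  apply: (@int_D _ 1) => [|w]; first exact/measurable_indicP/G_meas.
  by rewrite indicE ger0_norm //; case: (_ \in _).
have close w : `|phi w - n.+1%:R^-1 * approx n.+1 w| <= n.+1%:R^-1.
  have /andP[p0 p1] := phi01 w.
  have -> : approx n.+1 w = (Num.trunc (n.+1%:R * phi w))%:R.
    set t := Num.trunc _.
    have tn : (t <= n.+1)%N.
      by rewrite -(ler_nat R) (@le_trans _ _ (n.+1%:R * phi w)) ?truncn_le ?mulr_ge0 // ler_piMr.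
    rewrite /approx (eq_bigr (fun j => (j < t)%N%:R)); last first.
      move=> j _; rewrite indicE /t truncn_gt_nat; congr (nat_of_bool _)%:R.
      apply/idP/idP; first by rewrite inE /A /= ler_pdivrMr // mulrC.
      by rewrite inE /A /= ler_pdivrMr // mulrC.
    rewrite (big_cat_nat _ tn) //= [X in _ + X]big_nat_cond [X in _ + X]big1 ?addr0.
      rewrite big_nat_cond (eq_bigr (fun=> 1)); last by move=> j /andP[/andP[_ ->]].
      by rewrite -big_nat_cond sumr_const_nat subn0.
    by move=> j /andP[/andP[jt _] _]; rewrite ltnNge jt.
  have /andP[h1 h2] := truncn_itv (mulr_ge0 (ltW n0) p0).
  rewrite -(@ler_pM2l _ n.+1%:R) // -{1}(gtr0_norm n0) -normrM mulrBr mulrA.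
  rewrite divff ?gt_eqF // mul1r ger0_norm ?subr_ge0 //.
  by rewrite lerBlDl natr1 ltW.
have -> : \int[P]_w (D w * phi w) =
    \int[P]_w (D w * (phi w - n.+1%:R^-1 * approx n.+1 w)).
  under [RHS]eq_Rintegral do rewrite mulrBr mulrCA.
  rewrite RintegralB //.
  - by rewrite RintegralZl //; [rewrite approx0 mulr0 subr0|exact: int_D (m_approx _) (approx_bd
    _)].
  - by apply: (@int_D _ 1) => // w; have /andP[? ?] := phi01 w; rewrite ger0_norm.
  - under eq_fun do rewrite mulrCA.
    apply: (@int_D _ (n.+1%:R^-1 * n.+1%:R)) => [|w]; first exact: measurable_funM.
    by rewrite normrM ger0_norm ?invr_ge0 // ler_pM2l ?invr_gt0.
have mc : measurable_fun setT (fun w => phi w - n.+1%:R^-1 * approx n.+1 w).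
  by apply: measurable_funB => //; exact: measurable_funM.
have ic := int_D mc close.
apply: le_trans (le_normr_Rintegral measurableT ic) _.
have Rc : \int[P]_w n.+1%:R^-1 = n.+1%:R^-1.
  by rewrite Rintegral_cst //= probability_setT /= mulr1.
rewrite -[leRHS]Rc.
apply: le_Rintegral => //.
- exact: (integrable_norm ic).
- exact: finite_measure_integrable_cst.
- move=> w _; rewrite normrM -[leRHS]mul1r; exact: ler_pM.
Qed.

Lemma cond_pgf_integral (psi : Omega -> R) :
  (forall a : R, G [set w | a <= psi w]) -> measurable_fun setT psi ->
  (forall w, `|psi w| <= 1) ->
  \int[P]_w (u ^+ N w * psi w) = \int[P]_w (pgf F (lam w) u * psi w).
Proof.
move=> Gpsi mpsi psi1.
have int1 (f : Omega -> R) : measurable_fun setT f -> (forall w, `|f w| <= 1) ->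
    P.-integrable setT (EFin \o (fun w => f w * psi w)).
  move=> mf f1; apply: (@bounded_integrable _ _ _ _ _ 1) => [|w].
    exact: measurable_funM.
  by rewrite normrM mulr_ile1.
apply/eqP; rewrite -subr_eq0 -RintegralB //; last 2 first.
- by apply: int1 => // w; rewrite ger0_norm ?exprn_ile1 ?exprn_ge0.
- apply: int1 => // w; have /andP[h1 h2] := @pgf_bounds _ F (lam w) u u01.
  by rewrite ger0_norm.
under eq_Rintegral do rewrite -mulrBl -/(D _).
(* An affine change from [[-1, 1]] to [[0, 1]]: [psi = 2 phi - 1], and the constant is covered by
   the event [setT]. *)
pose phi w := (psi w + 1) / 2.
have mphi : measurable_fun setT phi.
  by apply: measurable_funM => //; exact: measurable_funD.
have phi01 w : 0 <= phi w <= 1.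
  by have := psi1 w; rewrite ler_norml /phi => /andP[? ?]; apply/andP; split; lra.
have phi0 : \int[P]_w (D w * phi w) = 0.
  apply: unit_zero => // a; rewrite (_ : [set w | _] = [set w | 2 * a - 1 <= psi w]) //.
  by apply/seteqP; split => w /=; rewrite /phi; lra.
have D0 : \int[P]_w D w = 0.
  have := event_zero GT; under eq_Rintegral do rewrite indicT mulr1.
  by [].
under eq_Rintegral => w _.
  rewrite (_ : D w * psi w = 2 * (D w * phi w) - D w); last by rewrite /phi; field.
  over.
rewrite /= RintegralB //.
- rewrite RintegralZl //; first by rewrite phi0 D0 mulr0 subr0.
  by apply: (@int_D _ 1) => // w; have /andP[? ?] := phi01 w; rewrite ger0_norm.
- under eq_fun do rewrite mulrCA.
  apply: (@int_D _ 2) => [|w]; first exact: measurable_funM.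
  have /andP[? ?] := phi01 w; rewrite ger0_norm; lra.
- exact: bounded_integrable mD D_bd.
Qed.

End conditional_pgf.

(** * Reflection invariance of Lebesgue measure *)

Section reflection.
Context {R : realType}.

Lemma ge0_integral_oppr (g : R -> \bar R) : measurable_fun setT g ->
  (forall x, 0 <= g x)%E ->
  (\int[lebesgue_measure]_x g (- (x : R))%R = \int[lebesgue_measure]_x g x)%E.
Proof.
move=> mg g0.
transitivity (\int[pushforward (@lebesgue_measure R) (-%R : _ -> measurableTypeR R)]_x g x)%E.
  by rewrite ge0_integral_pushforward //= preimage_setT.
by apply: eq_measure_integral => //= A mA _; exact: lebesgue_measureN.
Qed.

Lemma cons_rowN n (x : R) (v : 'rV[R]_n) :
  cons_row (- x, - v) = - cons_row (x, v).
Proof.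
apply/rowP => j; rewrite [RHS]mxE; have [k ->|->] := unliftP ord0 j.
  by rewrite !cons_rowS /= mxE.
by rewrite !cons_row0.
Qed.

Lemma integral_lebesgue_cons n (mu : {sigma_finite_measure set 'rV[R]_n -> \bar R})
    (f : 'rV[R]_n.+1 -> \bar R) : measurable_fun setT f -> (forall v, 0 <= f v)%E ->
  (\int[lebesgue_cons mu]_v f v =
   \int[lebesgue_measure]_x \int[mu]_v f (cons_row (x, v)))%E.
Proof.
move=> mf f0; rewrite (ge0_integral_pushforward (@measurable_cons_row R n)) //.
rewrite preimage_setT (fubini_tonelli1 (f \o @cons_row R n)) //.
  exact: (measurableT_comp mf (@measurable_cons_row R n)).
by move=> x; exact: f0.
Qed.

Lemma measurable_oppv n : measurable_fun setT (fun v : 'rV[R]_n => - v).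
Proof.
apply: measurable_rowP => j; rewrite (_ : (fun _ => _) = fun v : 'rV[R]_n => - v 0 j).
  by apply: measurableT_comp => //; exact: measurable_coord.
by apply/funext => v; rewrite mxE.
Qed.

(** In the iterated integral over [cons_row], the induction hypothesis reflects the tail and the
    one-dimensional invariance reflects the head. *)
Lemma ge0_integral_row_opp n (f : 'rV[R]_n -> \bar R) : measurable_fun setT f ->
  (forall v, 0 <= f v)%E ->
  (\int[lebesgue_row n]_v f (- v)%R = \int[lebesgue_row n]_v f v)%E.
Proof.
elim: n f => [|n IH] f mf f0.
  by apply: eq_integral => v _; congr f; apply/rowP => -[].
have mfN : measurable_fun setT (fun v : 'rV[R]_n.+1 => f (- v)%R).
  exact: (measurableT_comp mf (@measurable_oppv _)).
rewrite /= !integral_lebesgue_cons //.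
have mpair (x : R) : measurable_fun setT (fun v : 'rV[R]_n => cons_row (x, v)).
  apply: measurable_rowP => j; have [k ->|->] := unliftP ord0 j.
    under eq_fun do rewrite cons_rowS.
    by apply: measurable_coord; exact: measurable_id.
  by under eq_fun do rewrite cons_row0; exact: measurable_cst.
transitivity (\int[lebesgue_measure]_x \int[lebesgue_row n]_v f (cons_row ((- (x : R))%R, v)))%E.
  apply: eq_integral => x _.
  rewrite -(IH (fun v => f (cons_row (- x, v)))) //.
    by apply: eq_integral => v _; rewrite cons_rowN.
  exact: (measurableT_comp mf (mpair _)).
apply: (ge0_integral_oppr (g := fun x => \int[lebesgue_row n]_v f (cons_row (x, v)))%E).
  apply: (measurable_fun_fubini_tonelli_F (f \o @cons_row R n)) => //.
  exact: (measurableT_comp mf (@measurable_cons_row R n)).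
  by move=> p; exact: f0.
by move=> x; exact: integral_ge0.
Qed.

(* The cross term [2 C S omega] is odd, hence [(C + S)^2] and [(C - S)^2] have
   the same integral. *)
Lemma integral_even_odd_sqr n (C S om : 'rV[R]_n -> R) :
  measurable_fun setT C -> measurable_fun setT S -> measurable_fun setT om ->
  (forall v, C (- v) = C v) -> (forall v, S (- v) = - S v) ->
  (forall v, om (- v) = om v) -> (forall v, 0 <= om v) ->
  (\int[lebesgue_row n]_v (((C v + S v) ^+ 2 * om v)%:E) =
   \int[lebesgue_row n]_v (((C v ^+ 2 + S v ^+ 2) * om v)%:E))%E.
Proof.
move=> mC mS mom evC oddS evom om0.
set p := fun v => ((C v + S v) ^+ 2 * om v)%:E.
set q := fun v => ((C v - S v) ^+ 2 * om v)%:E.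
have mp : measurable_fun setT p.
  apply/measurable_EFinP; apply: measurable_funM => //; apply: measurable_funX.
  exact: measurable_funD.
have mq : measurable_fun setT q.
  apply/measurable_EFinP; apply: measurable_funM => //; apply: measurable_funX.
  exact: measurable_funB.
have p0 v : (0 <= p v)%E by rewrite lee_fin mulr_ge0 ?sqr_ge0.
have q0 v : (0 <= q v)%E by rewrite lee_fin mulr_ge0 ?sqr_ge0.
have pq : (\int[lebesgue_row n]_v p v = \int[lebesgue_row n]_v q v)%E.
  by rewrite -ge0_integral_row_opp //; apply: eq_integral => v _; rewrite /p evC oddS evom.
have half : (0 <= 2^-1 :> R)%R by rewrite invr_ge0.
transitivity (\int[lebesgue_row n]_v ((2^-1)%:E * p v + (2^-1)%:E * q v))%E.
  rewrite ge0_integralD //; last 4 first.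
  - by move=> v _; rewrite mule_ge0 // lee_fin.
  - exact: measurable_funeM.
  - by move=> v _; rewrite mule_ge0 // lee_fin.
  - exact: measurable_funeM.
  rewrite !ge0_integralZl // -pq -ge0_muleDl ?lee_fin // -EFinD.
  by rewrite (_ : 2^-1 + 2^-1 = 1) ?mul1e //; field.
apply: eq_integral => v _; rewrite /p /q -!EFinM -EFinD; congr EFin.
by field.
Qed.

End reflection.

(** * Lipschitz moduli in the parameter *)

Section mean_value_bounds.
Context {R : realType}.

Lemma derivable_lipschitz (g : R -> R) (a b M : R) :
  (forall x, Num.min a b <= x <= Num.max a b -> derivable g x 1 /\ `|derive1 g x| <= M) ->
  `|g b - g a| <= M * `|b - a|.
Proof.
wlog ab : a b / a < b => [hw h|].
  have [ab|ba|->] := ltgtP a b; first exact: hw.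
    rewrite distrC [`|b - a|]distrC; apply: hw => // x hx; apply: h.
    by rewrite minC maxC.
  by rewrite !subrr !normr0 mulr0.
rewrite min_l ?(ltW ab) // max_r ?(ltW ab) // => h.
have [||c c_ab ->] := @MVT R g (derive1 g) a b ab.
- move=> x; rewrite in_itv /= => /andP[ax xb].
  have [|dg _] := h x; first by rewrite !ltW.
  by apply: DeriveDef => //; rewrite derive1E.
- apply: derivable_within_continuous => x; rewrite in_itv /= => hx.
  by have [] := h x hx.
rewrite normrM ler_wpM2r //; move: c_ab; rewrite in_itv /= => /andP[ac cb].
by have [|_] := h c; first by rewrite !ltW.
Qed.

Definition l1dist n (v w : 'rV[R]_n) : R := \sum_j `|v 0 j - w 0 j|.

Lemma l1dist_ge0 n (v w : 'rV[R]_n) : 0 <= l1dist v w.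
Proof. by apply: sumr_ge0. Qed.

Lemma normr_partial_le n (i : 'I_n) (f : 'rV[R]_n -> R) v :
  `|partial i f v| <= enorm (grad f v).
Proof.
rewrite -sqrtr_sqr ler_sqrt ?sumr_ge0 // => [|j _]; last exact: sqr_ge0.
rewrite (bigD1 i) //= mxE lerDl; apply: sumr_ge0 => j _; exact: sqr_ge0.
Qed.

Definition in_box n (c : 'rV[R]_n) (delta : R) (v : 'rV[R]_n) : Prop :=
  forall j, `|v 0 j - c 0 j| < delta.

(* Moving one coordinate at a time keeps the path inside the box. *)
Lemma box_lipschitz n (f : 'rV[R]_n -> R) (c v : 'rV[R]_n) (delta M : R) :
  (forall w, in_box c delta w -> forall i,
     derivable f w (delta_mx 0 i) /\ `|partial i f w| <= M) ->
  in_box c delta v -> `|f v - f c| <= M * l1dist v c.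
Proof.
move=> hf hv.
pose u (k : nat) : 'rV[R]_n := \row_j (if (j < k)%N then v 0 j else c 0 j).
have u0 : u 0%N = c by apply/rowP => j; rewrite mxE.
have un : u n = v by apply/rowP => j; rewrite mxE ltn_ord.
rewrite -{1}un -{1}u0 -(telescope_sumr (fun k => f (u k))) // big_mkord.
rewrite mulr_sumr; apply: le_trans (ler_norm_sum _ _ _) _; apply: ler_sum => k _.
pose e : 'rV[R]_n := delta_mx 0 k.
pose g (s : R) := f (u k + s *: e).
have coord s j : (u k + s *: e) 0 j = if j == k then c 0 k + s else
    (if (j < k)%N then v 0 j else c 0 j).
  rewrite !mxE eqxx /=; case: eqP => [->|/eqP jk]; first by rewrite ltnn mulr1.
  by rewrite mulr0 addr0.
have -> : f (u k.+1) = g (v 0 k - c 0 k).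
  congr f; apply/rowP => j; rewrite coord mxE ltnS leq_eqVlt.
  have [->|jk] := eqVneq j k; first by rewrite eqxx /=; lra.
  by rewrite -val_eqE in jk; rewrite (negbTE jk).
have -> : f (u k) = g 0 by rewrite /g scale0r addr0.
have -> : `|v 0 k - c 0 k| = `|(v 0 k - c 0 k) - 0| by rewrite subr0.
apply: derivable_lipschitz => s hs.
have box : in_box c delta (u k + s *: e).
  move=> j; rewrite coord; case: eqP => [->|_]; last first.
    by case: ifP => _ //; rewrite subrr normr0 (le_lt_trans _ (hv j)).
  rewrite addrC addKr; apply: le_lt_trans (hv k).
  move: hs; case: (leP (v 0 k - c 0 k) 0) => h.
    by move=> /andP[h1 h2]; rewrite !ler0_norm //; lra.
  by move=> /andP[h1 h2]; rewrite !ger0_norm ?(ltW h).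
have [df dM] := hf _ box k.
(* The difference quotients of [g] at [s] are those of [f] along the [k]-th axis, so derivability
   and derivative transfer together. *)
have quotE : (fun h : R => h^-1 *: ((g \o shift s) (h *: 1) - g s)) =
    (fun h : R => h^-1 *: ((f \o shift (u k + s *: e)) (h *: e) - f (u k + s *: e))).
  apply/funext => h; rewrite /g /=; congr (_ *: (f _ - _)).
  by rewrite [h%:A]mulr1 scalerDl addrCA.
split; first by rewrite /derivable quotE.
by rewrite derive1E /derive quotE.
Qed.

End mean_value_bounds.

Section countable_lipschitz_modulus.
Context {R : realType}.
Variables (n : nat) (c : 'rV[R]_n) (delta : R).
Hypothesis delta_gt0 : 0 < delta.

(** Rational vectors are enumerated, those outside the box being replaced by its centre. Each
    coordinate of an approximation is chosen in the intersection of two open intervals, so that it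
    is close to [v] and inside the box at once. *)
Lemma exists_dense_box_seq : exists en : nat -> 'rV[R]_n,
  (forall k, in_box c delta (en k)) /\
  forall v, in_box c delta v -> forall e : R, 0 < e -> exists k, ball v e (en k).
Proof.
pose to (q : 'rV[rat]_n) : 'rV[R]_n := \row_j ratr (q 0 j).
pose en k := if unpickle k is Some q then
  (if asbool (in_box c delta (to q)) then to q else c) else c.
have cc : in_box c delta c by move=> j; rewrite subrr normr0.
exists en; split => [k|v hv e e0].
  by rewrite /en; case: unpickle => // q; case: asboolP.
have hq j : exists q : rat, ratr q \in
    `]Num.max (v 0 j - e) (c 0 j - delta), Num.min (v 0 j + e) (c 0 j + delta)[.
  apply: rat_in_itvoo; have := hv j; rewrite ltr_norml => /andP[h1 h2].
  by rewrite gt_max !lt_min; apply/andP; split; apply/andP; split; lra.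
pose q : 'rV[rat]_n := \row_j sval (cid (hq j)).
have toq j : to q 0 j \in
    `]Num.max (v 0 j - e) (c 0 j - delta), Num.min (v 0 j + e) (c 0 j + delta)[.
  by rewrite !mxE; exact: svalP (cid (hq j)).
exists (pickle q); rewrite /en pickleK asboolT.
  split => // i j; rewrite ord1 /ball /=; have := toq j.
  rewrite in_itv /= gt_max lt_min => /andP[/andP[h1 _] /andP[h2 _]].
  by rewrite ltr_norml; apply/andP; split; lra.
move=> j; have := toq j.
rewrite in_itv /= gt_max lt_min => /andP[/andP[_ h1] /andP[_ h2]].
by rewrite ltr_norml; apply/andP; split; lra.
Qed.

Definition box_seq : nat -> 'rV[R]_n := sval (cid exists_dense_box_seq).

(* When [box_seq k = c] the quotient is [0 / 0 = 0], which is harmless. *)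
Definition lip_modulus (k : R) (f : 'rV[R]_n -> R) : \bar R :=
  ereal_sup (range (fun i =>
    ((`|f (box_seq i) - f c| / l1dist (box_seq i) c) `^ k)%:E)).

Lemma lip_modulus_ge0 k f : (0 <= lip_modulus k f)%E.
Proof. by apply: ereal_sup_ge; exists ((`|f (box_seq 0) - f c| / l1dist (box_seq 0) c) `^ k)%:E;
  [exists 0%N|rewrite lee_fin powR_ge0]. Qed.

Lemma measurable_lip_modulus d (T : measurableType d) k (f : 'rV[R]_n -> T -> R) :
  (forall v, measurable_fun setT (f v)) ->
  measurable_fun setT (fun x => lip_modulus k (f^~ x)).
Proof.
move=> mf.
have := @measurable_fun_esups _ T R setT (fun i x =>
  ((`|f (box_seq i) x - f c x| / l1dist (box_seq i) c) `^ k)%:E) _ 0%N.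
rewrite (_ : (fun x => esups _ 0) = fun x => lip_modulus k (f^~ x)).
  apply => i; apply/measurable_EFinP.
  apply: (measurableT_comp (@measurable_powR R k)).
  apply: measurable_funM => //; apply: measurableT_comp => //.
  exact: measurable_funB.
apply/funext => x; rewrite /esups /lip_modulus /sdrop /=; congr ereal_sup.
by apply/seteqP; split => y /= [i _ <-]; exists i.
Qed.

(** With [G] the supremum on the right, [G ^ (1/k)] bounds every partial derivative on the box, so
    the coordinatewise mean value inequality bounds each quotient. An infinite [G] is set aside
    first. *)
Lemma lip_modulus_le_grad k (f : 'rV[R]_n -> R) (A : set 'rV[R]_n) : 0 < k ->
  (forall w, in_box c delta w -> A w) ->
  (forall w, in_box c delta w -> forall i, derivable f w (delta_mx 0 i)) ->
  (lip_modulus k f <= ereal_sup [set (enorm (grad f w) `^ k)%:E | w in A])%E.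
Proof.
move=> k0 boxA df; apply: ge_ereal_sup => _ [i _ <-].
set G := ereal_sup _.
have hG w : in_box c delta w -> ((enorm (grad f w) `^ k)%:E <= G)%E.
  by move=> bw; apply: ereal_sup_ubound; exists w => //; exact: boxA.
have [ebox _] := svalP (cid exists_dense_box_seq).
have [Gy|Gy] := eqVneq G +oo%E; first by rewrite Gy leey.
have cc : in_box c delta c by move=> j; rewrite subrr normr0.
have Gfin : G \is a fin_num.
  rewrite fin_numE Gy andbT; apply/eqP => GN.
  by have := hG c cc; rewrite GN leeNy_eq.
have en0 w : 0 <= enorm (grad f w) by exact: sqrtr_ge0.
pose M := fine G `^ k^-1.
have MG : M `^ k = fine G.
  rewrite /M -powRrM mulVf ?gt_eqF // powRr1 //.
  by rewrite -lee_fin fineK // (le_trans _ (hG c cc)) // lee_fin powR_ge0.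
have hM w : in_box c delta w -> enorm (grad f w) <= M.
  move=> bw; have := hG w bw; rewrite -(fineK Gfin) lee_fin => h.
  have : (enorm (grad f w) `^ k) `^ k^-1 <= M.
    by apply: ge0_ler_powR; rewrite ?nnegrE ?invr_ge0 ?(ltW k0) ?powR_ge0 // (le_trans _ h)
      ?powR_ge0.
  by rewrite -powRrM mulfV ?gt_eqF // powRr1.
have lip := @box_lipschitz R n f c (box_seq i) delta M _ (ebox i).
rewrite -(fineK Gfin) lee_fin -MG; apply: ge0_ler_powR; rewrite ?nnegrE ?(ltW k0) //.
- by rewrite divr_ge0 // l1dist_ge0.
- exact: powR_ge0.
have [d0|d0] := ltP 0 (l1dist (box_seq i) c).
  rewrite ler_pdivrMr //; apply: lip => w bw j; split; first exact: df.
  exact: le_trans (normr_partial_le _ _ _) (hM w bw).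
have -> : l1dist (box_seq i) c = 0 by apply/eqP; rewrite eq_le d0 l1dist_ge0.
by rewrite invr0 mulr0 powR_ge0.
Qed.

(** Density and continuity carry the Lipschitz constant [M = L ^ (1/k)] from the sequence to [v].
    The summand 1 pays for lowering the exponent: [M ^ k' <= 1 + M ^ k]. *)
Lemma lip_modulus_bound k k' (f : 'rV[R]_n -> R) v : 0 < k' <= k ->
  in_box c delta v -> {for v, continuous f} ->
  ((`|f v - f c| `^ k')%:E <= (l1dist v c `^ k')%:E * (1 + lip_modulus k f))%E.
Proof.
move=> /andP[k'0 kk] bv cf.
have k0 : 0 < k by exact: lt_le_trans kk.
have [_ dense] := svalP (cid exists_dense_box_seq).
set L := lip_modulus k f.
have L0 : (0 <= L)%E := lip_modulus_ge0 k f.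
have [d0|d0] := leP (l1dist v c) 0.
  have /eqP : l1dist v c = 0 by apply/eqP; rewrite eq_le d0 l1dist_ge0.
  rewrite psumr_eq0 // => /allP h.
  have -> : v = c.
    by apply/rowP => j; apply/eqP; rewrite -subr_eq0 -normr_eq0; apply: h; rewrite mem_index_enum.
  by rewrite subrr normr0 powR0 ?gt_eqF // mule_ge0 ?lee_fin ?powR_ge0 // adde_ge0.
have [Ly|Ly] := eqVneq L +oo%E.
  by rewrite Ly addey // gt0_muley ?leey // lte_fin powR_gt0.
have Lfin : L \is a fin_num by rewrite ge0_fin_numE // ltey.
pose M := fine L `^ k^-1.
have M0 : 0 <= M by exact: powR_ge0.
have fL0 : 0 <= fine L by exact: fine_ge0.
have MG : M `^ k = fine L by rewrite /M -powRrM mulVf ?gt_eqF // powRr1.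
have hi i : `|f (box_seq i) - f c| <= M * l1dist (box_seq i) c.
  have [di|di] := ltP 0 (l1dist (box_seq i) c); last first.
    have /eqP : l1dist (box_seq i) c = 0 by apply/eqP; rewrite eq_le di l1dist_ge0.
    rewrite psumr_eq0 // => /allP h.
    have -> : box_seq i = c.
      by apply/rowP => j; apply/eqP; rewrite -subr_eq0 -normr_eq0; apply: h; rewrite mem_index_enum.
    by rewrite subrr normr0 mulr_ge0 // l1dist_ge0.
  rewrite -ler_pdivrMr //; set a := _ / _.
  have a0 : 0 <= a by rewrite divr_ge0 // l1dist_ge0.
  have : ((a `^ k)%:E <= L)%E by apply: ereal_sup_ubound; exists i.
  rewrite -(fineK Lfin) lee_fin => h.
  have : (a `^ k) `^ k^-1 <= M.
    by apply: ge0_ler_powR; rewrite ?nnegrE ?invr_ge0 ?(ltW k0) ?powR_ge0.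
  by rewrite -powRrM mulfV ?gt_eqF // powRr1.
have hv : `|f v - f c| <= M * l1dist v c.
  apply/ler_addgt0Pr => e e0.
  have e1 : 0 < e / 2 by rewrite divr_gt0.
  have e2 : 0 < e / 2 / (M * n%:R + 1).
    by rewrite divr_gt0 // ltr_wpDl // mulr_ge0.
  have /cvgrPdist_lt /(_ _ e1) /nbhs_ballP [r /= r0 hr] := cf.
  (* Within [s] of [v], the function moves by less than [e / 2], and [M] times the change of the l1
     distance is at most [M n s <= e / 2]; the [+ 1] avoids a zero denominator. *)
  pose s := Num.min r (e / 2 / (M * n%:R + 1)).
  have s0 : 0 < s by rewrite lt_min r0.
  have [i [_ hb]] := dense v bv s s0.
  have hf : `|f v - f (box_seq i)| < e / 2.
    by apply: hr; apply: le_ball (_ : ball v s (box_seq i)); [rewrite ge_min lexx|split].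
  have hd : l1dist (box_seq i) c <= l1dist v c + n%:R * s.
    have -> : n%:R * s = \sum_(j < n) s by rewrite sumr_const card_ord mulr_natl.
    rewrite -big_split /=; apply: ler_sum => j _.
    have := hb 0 j; rewrite /ball /= => h1.
    have -> : box_seq i 0 j - c 0 j = (v 0 j - c 0 j) - (v 0 j - box_seq i 0 j) by lra.
    by apply: le_trans (ler_normB _ _) _; rewrite lerD2l ltW.
  have hMs : M * (n%:R * s) <= e / 2.
    have hs : s <= e / 2 / (M * n%:R + 1) by rewrite ge_min lexx orbT.
    have hn : 0 <= M * n%:R by rewrite mulr_ge0.
    rewrite mulrA; apply: le_trans (ler_wpM2l hn hs) _.
    by rewrite mulrA ler_pdivrMr ?ltr_wpDl // mulrC ler_pM2l // lerDl.
  have := hi i; have := ler_wpM2l M0 hd; rewrite mulrDr.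
  have -> : f v - f c = (f v - f (box_seq i)) + (f (box_seq i) - f c) by lra.
  move=> h1 h2; apply: le_trans (ler_normD _ _) _; lra.
rewrite -(fineK Lfin) -EFinD -EFinM lee_fin.
apply: (@le_trans _ _ ((M * l1dist v c) `^ k')).
  by apply: ge0_ler_powR; rewrite ?nnegrE ?(ltW k'0) ?mulr_ge0 ?(ltW d0).
rewrite powRM ?(ltW d0) // mulrC; apply: ler_wpM2l; first exact: powR_ge0.
by rewrite -MG; apply: powR_le_add1; rewrite ?(ltW k'0).
Qed.

End countable_lipschitz_modulus.

(** Without any measurability: the integral of a nonnegative function is a supremum over simple
    functions below it. This admits the suprema over [Theta0] on the larger side. *)
Lemma ge0_le_integral_upper d (T : measurableType d) (R : realType)
    (mu : {measure set T -> \bar R}) (f g : T -> \bar R) :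
  (forall x, 0 <= f x)%E -> (forall x, f x <= g x)%E ->
  (\int[mu]_x f x <= \int[mu]_x g x)%E.
Proof.
move=> f0 fg; rewrite !ge0_integralTE //; last by move=> x; exact: le_trans (fg x).
by apply: le_ereal_sup => _ [h /= hf <-]; exists h => // x; exact: le_trans (fg x).
Qed.

(** * Smallness in probability *)

Section small_in_probability.
Context {R : realType} {dO : measure_display} {Omega : measurableType dO}.
Variable P : probability Omega R.

(* Convergence to zero in probability, phrased with exceptional sets so that
   the [X n] need not be measurable. *)
Definition small_in_prob (X : nat -> Omega -> \bar R) := forall e d : R, 0 < e -> 0 < d ->
  \forall n \near \oo, exists A : set Omega,
    [/\ measurable A, (P A <= d%:E)%E & forall w, ~ A w -> (X n w <= e%:E)%E].

Lemma small_in_probD X Y : small_in_prob X -> small_in_prob Y ->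
  small_in_prob (fun n w => X n w + Y n w)%E.
Proof.
move=> sX sY e d e0 d0.
have e2 : 0 < e / 2 by rewrite divr_gt0. have d2 : 0 < d / 2 by rewrite divr_gt0.
near=> n.
have [A [mA PA hA]] : exists A : set Omega,
    [/\ measurable A, (P A <= (d / 2)%:E)%E & forall w, ~ A w -> (X n w <= (e / 2)%:E)%E].
  by near: n; exact: sX.
have [B [mB PB hB]] : exists A : set Omega,
    [/\ measurable A, (P A <= (d / 2)%:E)%E & forall w, ~ A w -> (Y n w <= (e / 2)%:E)%E].
  by near: n; exact: sY.
exists (A `|` B); split; first exact: measurableU.
  apply: le_trans (measureU2 _ mA mB) _.
  by rewrite [d]splitr EFinD leeD.
move=> w /not_orP[nA nB].
by rewrite [e]splitr EFinD leeD // ?hA ?hB.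
Unshelve. all: by end_near. Qed.

Lemma small_in_prob_le (N : set Omega) X Y : P.-negligible N -> small_in_prob X ->
  (\forall n \near \oo, forall w, ~ N w -> (Y n w <= X n w)%E) -> small_in_prob Y.
Proof.
move=> [M [mM PM NM]] sX XY e d e0 d0; near=> n.
have [A [mA PA hA]] : exists A : set Omega,
    [/\ measurable A, (P A <= d%:E)%E & forall w, ~ A w -> (X n w <= e%:E)%E].
  by near: n; exact: sX.
exists (A `|` M); split; first exact: measurableU.
  apply: le_trans (measureU2 _ mA mM) _; rewrite -[d%:E]adde0; apply: leeD => //.
  by rewrite le_eqVlt; apply/orP; left; apply/eqP; exact: PM.
move=> w /not_orP[nA nM]; apply: le_trans (hA w nA).
have : forall w, ~ N w -> (Y n w <= X n w)%E by near: n.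
by apply; move=> /NM.
Unshelve. all: by end_near. Qed.

Lemma small_in_probZ (c : R) X : 0 <= c -> (forall n w, 0 <= X n w)%E -> small_in_prob X ->
  small_in_prob (fun n w => c%:E * X n w)%E.
Proof.
move=> c0 X0 sX e d e0 d0.
have c1 : 0 < c + 1 by rewrite ltr_wpDl.
have e1 : 0 < e / (c + 1) by rewrite divr_gt0.
have := sX _ _ e1 d0; apply: filterS => n [A [mA PA hA]].
exists A; split => // w /hA h.
apply: (@le_trans _ _ ((c + 1)%:E * X n w)%E).
  by apply: lee_wpmul2r => //; rewrite lee_fin lerDl.
by rewrite -lee_pdivlMl // -EFinM mulrC.
Qed.

Lemma markov_ge0 (f : Omega -> \bar R) (a : R) : 0 < a -> measurable_fun setT f ->
  (forall w, 0 <= f w)%E ->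
  (P [set w | a%:E <= f w]%E <= (a^-1)%:E * \int[P]_w f w)%E.
Proof.
move=> a0 mf f0; set A := [set w | _].
have mA : measurable A.
  by rewrite -[A]setTI; exact: emeasurable_fun_c_infty.
rewrite muleC lee_pdivlMr //.
apply: (@le_trans _ _ (\int[P]_(w in A) f w)%E).
  rewrite muleC -integral_cst //; apply: ge0_le_integral => //.
    by move=> w _; rewrite lee_fin ltW.
  exact: measurable_funTS.
exact: ge0_subset_integral.
Qed.

Lemma small_in_prob_mean (X : nat -> Omega -> \bar R) :
  (forall n, measurable_fun setT (X n)) -> (forall n w, 0 <= X n w)%E ->
  (\int[P]_w X n w)%E @[n --> \oo] --> 0%E -> small_in_prob X.
Proof.
move=> mX X0 cX e d e0 d0.
have ed : 0 < e * d by rewrite mulr_gt0.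
have : \forall n \near \oo, (\int[P]_w X n w < (e * d)%:E)%E.
  move/fine_cvgP : cX => [fX cX].
  have /cvgrPdist_lt /(_ _ ed) := cX.
  apply: filterS2 fX => n fn; rewrite sub0r normrN /= => h.
  by rewrite -(fineK fn) lte_fin; apply: le_lt_trans h; exact: ler_norm.
apply: filterS => n hn; exists [set w | e%:E <= X n w]%E; split.
- by rewrite -[X in measurable X]setTI; exact: emeasurable_fun_c_infty.
- apply: le_trans (markov_ge0 e0 (mX n) (X0 n)) _.
  by rewrite muleC lee_pdivrMr // -EFinM mulrC ltW.
- by move=> w /= /negP; rewrite -ltNge => /ltW.
Qed.

(** Moments of [C] are replaced by continuity from above: the events [n e < C] decrease to the empty
    set because [C] is finite everywhere. *)
Lemma small_in_prob_const (C : Omega -> R) : measurable_fun setT C ->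
  small_in_prob (fun n w => (n%:R^-1 * C w)%:E).
Proof.
move=> mC e d e0 d0.
pose A (n : nat) := [set w | n%:R * e < C w].
have mA n : measurable (A n).
  rewrite -[A n]setTI (_ : _ `&` _ = setT `&` C @^-1` [set` `]n%:R * e, +oo[]).
    exact: mC.
  by apply/seteqP; split => w /= [_]; rewrite /A /= in_itv /= andbT.
have A0 : \bigcap_n A n = set0.
  apply/seteqP; split => // w h.
  have := h (Num.trunc (C w / e)).+1 I; rewrite /A /= -ltr_pdivlMr // => h1.
  by have := truncnS_gt (C w / e); rewrite ltNge (ltW h1).
have ndA : nonincreasing_seq A.
  move=> n k nk; apply/subsetPset => w; apply: le_lt_trans.
  by rewrite ler_pM2r // ler_nat.
have := @nonincreasing_cvg_mu _ _ _ P A _ mA _ ndA.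
rewrite A0 measure0 => /(_ _ measurable0) cA.
have {}cA : P (A n) @[n --> \oo] --> 0%E.
  by apply: cA; rewrite ltey_eq fin_num_measure.
have : \forall n \near \oo, (P (A n) < d%:E)%E.
  move/fine_cvgP : cA => [fX cX].
  have /cvgrPdist_lt /(_ _ d0) := cX.
  apply: filterS2 fX => n fn; rewrite sub0r normrN /= => h.
  by rewrite -(fineK fn) lte_fin; apply: le_lt_trans h; exact: ler_norm.
move=> h; near=> n; exists (A n); split => //.
  by apply: ltW; near: n.
move=> w /negP; rewrite -leNgt => hw; rewrite lee_fin.
by rewrite ler_pdivrMl // ltr0n; near: n; exists 1%N.
Unshelve. all: by end_near. Qed.

(** Measurability is asked only for large [n], since at sample size [0] the estimator is
    unconstrained. *)
Lemma small_cvg_in_prob (X : nat -> Omega -> \bar R) (l : \bar R) :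
  (\forall n \near \oo, measurable_fun setT (X n)) ->
  l \is a fin_num -> small_in_prob (fun n w => `|X n w - l|)%E ->
  cvg_in_prob P X l.
Proof.
move=> mX lf sX e e0; apply/fine_cvgP; split.
  near=> n; rewrite fin_num_measure //.
  have mXn : measurable_fun setT (X n) by near: n.
  rewrite -[X in measurable X]setTI; apply: emeasurable_fun_o_infty => //.
  apply: measurableT_comp => //; exact: emeasurable_funB.
apply/cvgrPdist_le => d d0; near=> n; rewrite sub0r normrN /=.
rewrite ger0_norm ?fine_ge0 //.
have [A [mA PA hA]] : exists A : set Omega,
    [/\ measurable A, (P A <= d%:E)%E & forall w, ~ A w -> (`|X n w - l| <= e%:E)%E].
  by near: n; exact: sX.
have mXn : measurable_fun setT (X n) by near: n.
have mE : measurable [set w | (e%:E < `|X n w - l|)%E].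
  rewrite -[X in measurable X]setTI; apply: emeasurable_fun_o_infty => //.
  apply: measurableT_comp => //; exact: emeasurable_funB.
rewrite -lee_fin fineK ?fin_num_measure //.
apply: le_trans PA; apply: le_measure; rewrite ?inE //.
move=> w /= h; apply: contrapT => nA; have := hA w nA.
by rewrite leNgt h.
Unshelve. all: by end_near. Qed.

End small_in_probability.

(** * Weighted L^1 distances *)

Section weighted_l1.
Context {R : realType} {dO : measure_display} {Omega : measurableType dO}.
Variable P : probability Omega R.
Context {dU : measure_display} {U : measurableType dU}.
Variables (rho : {sigma_finite_measure set U -> \bar R}) (Wt : U -> R).
Hypotheses (mWt : measurable_fun setT Wt) (Wt0 : forall x, 0 <= Wt x).
Hypothesis Wt_int : (\int[rho]_x (Wt x)%:E < +oo)%E.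

Lemma weighted_integrable (f : U -> R) (C : R) : measurable_fun setT f ->
  (forall x, `|f x| <= C) -> rho.-integrable setT (fun x => (f x * Wt x)%:E).
Proof.
move=> mf fC; apply/integrableP; split.
  by apply/measurable_EFinP; exact: measurable_funM.
apply: (@le_lt_trans _ _ (\int[rho]_x (`|C|%:E * (Wt x)%:E))%E).
  apply: ge0_le_integral => //.
  - apply: measurableT_comp => //; apply/measurable_EFinP; exact: measurable_funM.
  - by apply: measurable_funeM; exact/measurable_EFinP.
  - move=> x _; rewrite abse_EFin -EFinM lee_fin normrM (ger0_norm (Wt0 x)).
    by rewrite ler_wpM2r // (le_trans (fC x)) // ler_norm.
rewrite ge0_integralZl //; last 2 first.
- exact/measurable_EFinP.
- by move=> x _; rewrite lee_fin.
by rewrite lte_mul_pinfty // lee_fin.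
Qed.

(** On [[-1, 1]], [|a^2 - b^2| <= 2 |a - b|]: for bounded transforms the quadratic functional is
    Lipschitz in the weighted L^1 distance. *)
Lemma integral_sqr_diff_le (f g f' g' : U -> R) :
  measurable_fun setT f -> measurable_fun setT g ->
  measurable_fun setT f' -> measurable_fun setT g' ->
  (forall x, `|f x| <= 1) -> (forall x, `|g x| <= 1) ->
  (forall x, `|f' x| <= 1) -> (forall x, `|g' x| <= 1) ->
  (`|\int[rho]_x ((f x ^+ 2 + g x ^+ 2) * Wt x)%:E -
     \int[rho]_x ((f' x ^+ 2 + g' x ^+ 2) * Wt x)%:E| <=
   2%:E * (\int[rho]_x (`|f x - f' x| * Wt x)%:E + \int[rho]_x (`|g x - g' x| * Wt x)%:E))%E.
Proof.
move=> mf mg mf' mg' f1 g1 f'1 g'1.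
have sq (h k : U -> R) : measurable_fun setT h -> measurable_fun setT k ->
    (forall x, `|h x| <= 1) -> (forall x, `|k x| <= 1) ->
    rho.-integrable setT (fun x => ((h x ^+ 2 + k x ^+ 2) * Wt x)%:E).
  move=> mh mk h1 k1; apply: (@weighted_integrable (fun x => h x ^+ 2 + k x ^+ 2) 2).
    by apply: measurable_funD; exact: measurable_funX.
  move=> x; rewrite ger0_norm ?addr_ge0 ?sqr_ge0 //.
  rewrite -(real_normK (num_real (h x))) -(real_normK (num_real (k x))).
  by rewrite (_ : 2 = 1 + 1) // lerD // exprn_ile1.
have df (h k : U -> R) : measurable_fun setT h -> measurable_fun setT k ->
    measurable_fun setT (fun x => (`|h x - k x| * Wt x)%:E).
  move=> mh mk; apply/measurable_EFinP; apply: measurable_funM => //.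
  by apply: measurableT_comp => //; exact: measurable_funB.
rewrite -integralB //; last 2 first; [exact: sq|exact: sq|].
apply: le_trans (le_abse_integral _ _ _) _ => //.
  by apply: emeasurable_funB; apply: (measurable_int rho); exact: sq.
rewrite -ge0_integralD //; last 4 first.
- by move=> x _; rewrite lee_fin mulr_ge0.
- exact: df.
- by move=> x _; rewrite lee_fin mulr_ge0.
- exact: df.
rewrite -ge0_integralZl //; last 2 first.
- by apply: emeasurable_funD; exact: df.
- by move=> x _; rewrite adde_ge0 // lee_fin mulr_ge0.
apply: ge0_le_integral => //.
- apply: measurableT_comp => //.
  by apply: emeasurable_funB; apply: (measurable_int rho); exact: sq.
- by apply: measurable_funeM; apply: emeasurable_funD; exact: df.
move=> x _; rewrite -EFinB abse_EFin -EFinD -EFinM lee_fin.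
rewrite -mulrBl -mulrDl mulrA normrM (ger0_norm (Wt0 x)); apply: ler_wpM2r => //.
have sqd (a b : R) : `|a| <= 1 -> `|b| <= 1 -> `|a ^+ 2 - b ^+ 2| <= 2 * `|a - b|.
  move=> a1 b1; rewrite subr_sqr normrM mulrC; apply: ler_wpM2r => //.
  by apply: le_trans (ler_normD _ _) _; rewrite (_ : 2 = 1 + 1) // lerD.
rewrite opprD addrACA mulrDr; apply: le_trans (ler_normD _ _) _.
by rewrite lerD // sqd.
Qed.

(** Tonelli turns the mean of the integral into an integral of the means. These tend to zero
    pointwise and are dominated by [C * Wt], and Markov's inequality concludes. *)
Lemma small_weighted_l1 (f : nat -> Omega * U -> R) (C : R) :
  (forall n, measurable_fun setT (f n)) -> (forall n z, `|f n z| <= C) ->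
  (forall x, (\int[P]_w `|f n (w, x)|%:E)%E @[n --> \oo] --> 0%E) ->
  small_in_prob P (fun n w => \int[rho]_x (`|f n (w, x)| * Wt x)%:E)%E.
Proof.
move=> mf fC cf.
have C0 : 0 <= C by exact: le_trans (fC 0%N point).
pose F n (z : Omega * U) := (`|f n z| * Wt z.2)%:E.
have mF n : measurable_fun setT (F n).
  apply/measurable_EFinP; apply: measurable_funM; first exact: measurableT_comp.
  exact: (measurableT_comp mWt measurable_snd).
have F0 n z : (0 <= F n z)%E by rewrite lee_fin mulr_ge0.
apply: small_in_prob_mean => [n|n w|].
- exact: (measurable_fun_fubini_tonelli_F (F n)).
- by apply: integral_ge0 => x _; exact: F0.
have E n : (\int[P]_w \int[rho]_x (`|f n (w, x)| * Wt x)%:E =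
    \int[rho]_x (\int[P]_w `|f n (w, x)|%:E * (Wt x)%:E))%E.
  rewrite (fubini_tonelli (F n)) //; apply: eq_integral => x _.
  rewrite -ge0_integralZr ?lee_fin //.
  apply/measurable_EFinP; apply: measurableT_comp => //.
  exact: (measurableT_comp (mf n) (pair2_measurable x)).
under eq_fun do rewrite E.
have m1 n : measurable_fun setT (fun x => \int[P]_w `|f n (w, x)|%:E)%E.
  apply: (measurable_fun_fubini_tonelli_G (fun z => `|f n z|%:E)) => //.
  by apply/measurable_EFinP; exact: measurableT_comp.
have b1 n x : (0 <= \int[P]_w `|f n (w, x)|%:E <= C%:E)%E.
  rewrite integral_ge0 //=.
  have -> : C%:E = (\int[P]_w C%:E)%E by rewrite integral_cst //= probability_setT mule1.
  apply: ge0_le_integral => //.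
  - apply/measurable_EFinP; apply: measurableT_comp => //.
    exact: (measurableT_comp (mf n) (pair2_measurable x)).
  - by move=> w _; rewrite lee_fin.
have [|||||_ _] := @dominated_convergence _ _ _ rho setT measurableT
   (fun n x => (\int[P]_w `|f n (w, x)|%:E * (Wt x)%:E)%E) (cst 0%E) (fun x => (C * Wt x)%:E).
- by move=> n; apply: emeasurable_funM => //; exact/measurable_EFinP.
- exact: measurable_cst.
- apply: aeW => x _; rewrite /= -[X in _ --> X](mul0e (Wt x)%:E).
  by apply: cvgeZr => //; exact: cf.
- by apply: (@weighted_integrable (cst C) `|C|) => //.
- apply: aeW => x n _; have /andP[h1 h2] := b1 n x.
  rewrite gee0_abs ?mule_ge0 ?lee_fin // EFinM.
  by apply: lee_wpmul2r; rewrite ?lee_fin.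
by rewrite integral0.
Qed.

End weighted_l1.

(** * Fitted versus stationary intensities *)

Section fitted_intensities.
Context {R : realType}.
Variables p q m K : nat.
Variables (h : 'rV[R]_(p + q + m) -> 'rV[R]_K -> R) (th : 'rV[R]_K).
Variables (y l0 : int -> R) (x : int -> 'rV[R]_m).

Lemma fitted_nonpos t : t <= 0 -> fitted h th y l0 x t = l0 t.
Proof.
move=> t0; rewrite /fitted; elim: `|t|%N => [//|k IH] /=.
by rewrite ifF //; apply/eqP => tk; rewrite tk in t0.
Qed.

(** Stage [k+1] overwrites time [k+1] only, so the values at times up to [k] are final at stage
    [k]. *)
Lemma fitted_uptoE k s : s <= k%:Z -> fitted_upto h th y l0 x k s = fitted h th y l0 x s.
Proof.
elim: k => [|k IH] sk; first by rewrite fitted_nonpos.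
rewrite /=; case: eqVneq => [->|sk']; first by rewrite /fitted /= eqxx.
apply: IH; lia.
Qed.

Lemma fitted_pos (k : nat) : fitted h th y l0 x k.+1%:Z =
  h (zvec p q y (fitted h th y l0 x) x k.+1%:Z) th.
Proof.
rewrite {1}/fitted /= eqxx; congr (h (row_mx (row_mx _ _) _) th).
apply/rowP => j; rewrite !mxE; apply: fitted_uptoE; lia.
Qed.

End fitted_intensities.

Section l1_bounds.
Context {R : realType}.

Lemma normr_coord_le_enorm n (v : 'rV[R]_n) j : `|v 0 j| <= enorm v.
Proof.
rewrite -sqrtr_sqr ler_sqrt ?sumr_ge0 // => [|i _]; last exact: sqr_ge0.
by rewrite (bigD1 j) //= lerDl; apply: sumr_ge0 => i _; exact: sqr_ge0.
Qed.

Lemma l1dist_le_enorm n (v w : 'rV[R]_n) : l1dist v w <= n%:R * enorm (v - w).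
Proof.
rewrite mulr_natl -[X in _ *+ X]card_ord -sumr_const; apply: ler_sum => j _.
by have := normr_coord_le_enorm (v - w) j; rewrite !mxE.
Qed.

Lemma dotp_diff_le n (v a b : 'rV[R]_n) : `|dotp v a - dotp v b| <= enorm v * l1dist a b.
Proof.
rewrite /dotp -sumrB mulr_sumr; apply: le_trans (ler_norm_sum _ _ _) _.
apply: ler_sum => j _; rewrite -mulrBr normrM; apply: ler_wpM2r => //.
exact: normr_coord_le_enorm.
Qed.

Lemma l1dist_row_mx n1 n2 (a a' : 'rV[R]_n1) (b b' : 'rV[R]_n2) :
  l1dist (row_mx a b) (row_mx a' b') = l1dist a a' + l1dist b b'.
Proof.
rewrite /l1dist big_split_ord /=; congr (_ + _); apply: eq_bigr => j _.
  by rewrite !row_mxEl.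
by rewrite !row_mxEr.
Qed.

End l1_bounds.

Section fitted_vs_stationary.
Context {R : realType}.
Variables p q m K : nat.
Variables (h0 : 'rV[R]_(p + q + m) -> 'rV[R]_K -> R).
Variables (r : 'rV[R]_p -> 'rV[R]_q -> 'rV[R]_K -> R) (pi : 'rV[R]_m -> 'rV[R]_K -> R).
Hypothesis h0_gt0 : forall y l x th, nneg_row y -> nneg_row l ->
  0 < h0 (row_mx (row_mx y l) x) th.
Hypothesis h0_split : forall y l x th, nneg_row y -> nneg_row l ->
  h0 (row_mx (row_mx y l) x) th = r y l th + pi x th.
Variables (alpha : 'I_p -> R) (beta : 'I_q -> R) (rho : R).
Hypothesis alpha01 : forall i, 0 <= alpha i <= 1.
Hypothesis beta0 : forall j, 0 <= beta j.
Hypothesis rho01 : 0 < rho < 1.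
Hypothesis beta_rho : \sum_j beta j <= rho ^+ q.
Variables (y0 l0 : int -> R) (th th0 : 'rV[R]_K).
Hypothesis y0_ge0 : forall t : int, t <= 0 -> 0 <= y0 t.
Hypothesis l0_ge0 : forall t : int, t <= 0 -> 0 <= l0 t.
Hypothesis r_lip : forall y1 y2 l1 l2,
  nneg_row y1 -> nneg_row y2 -> nneg_row l1 -> nneg_row l2 ->
  `|r y1 l1 th - r y2 l2 th| <= \sum_(i < p) alpha i * `|y1 0 i - y2 0 i| +
    \sum_(j < q) beta j * `|l1 0 j - l2 0 j|.
Variables (Y : int -> nat) (X : int -> 'rV[R]_m) (lam : int -> R).
Hypothesis lam_gt0 : forall t, 0 < lam t.

Let ynat (t : int) : R := (Y t)%:R.

Hypothesis lam_rec : forall n : nat, lam n.+1%:Z =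
  r (lagvec p ynat n.+1%:Z) (lagvec q lam n.+1%:Z) th0 + pi (X (n.+1%:Z - 1)) th0.

Let lh := lambda_hat h0 y0 l0 th Y X.

Lemma counts_ge0 t : 0 <= counts y0 Y t.
Proof. by rewrite /counts; case: ltP => // t0; exact: y0_ge0. Qed.

Lemma lambda_hat_ge0 t : 0 <= lh t.
Proof.
have [t0|t0] := leP t 0; first by rewrite /lh /lambda_hat fitted_nonpos // l0_ge0.
suff h (n : nat) : forall t : int, t <= n%:Z -> 0 <= lh t by apply: (h `|t|%N); lia.
elim: n => [|n IH] s sn; first by rewrite /lh /lambda_hat fitted_nonpos // l0_ge0.
have [sn'|sn'] := leP s n%:Z; first exact: IH.
have -> : s = n.+1%:Z by lia.
rewrite /lh /lambda_hat fitted_pos ltW //; apply: h0_gt0 => j; rewrite mxE.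
  exact: counts_ge0.
apply: IH; lia.
Qed.

Lemma lambda_hat_gt0 (n : nat) : 0 < lh n.+1%:Z.
Proof.
rewrite /lh /lambda_hat fitted_pos; apply: h0_gt0 => j; rewrite mxE.
  exact: counts_ge0.
exact: lambda_hat_ge0.
Qed.

Definition start_error : R := \sum_(j < q) `|l0 (- (j : nat)%:Z) - lam (- (j : nat)%:Z)|.

Definition count_error (n : nat) : R :=
  l1dist (lagvec p (counts y0 Y) n.+1%:Z) (lagvec p ynat n.+1%:Z).

Definition link_error_r (n : nat) : R :=
  `|r (lagvec p ynat n.+1%:Z) (lagvec q lam n.+1%:Z) th -
    r (lagvec p ynat n.+1%:Z) (lagvec q lam n.+1%:Z) th0|.

Definition link_error_pi (n : nat) : R :=
  `|pi (X (n.+1%:Z - 1)) th - pi (X (n.+1%:Z - 1)) th0|.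

Let e t := `|lh t - lam t|.
Let eta n := link_error_r n.-1 + link_error_pi n.-1 + count_error n.-1.
Let B := envelope rho start_error eta.

Lemma count_error_ge0 n : 0 <= count_error n. Proof. exact: l1dist_ge0. Qed.

(** For [p <= n] all lags [n, ..., n+1-p] are at least 1, where the counts are observed; the
    arbitrary initial values no longer enter. *)
Lemma count_error_eq0 n : (p <= n)%N -> count_error n = 0.
Proof.
move=> pn; rewrite /count_error /l1dist big1 // => i _; rewrite !mxE /counts ifT ?subrr ?normr0 //.
have := ltn_ord i; lia.
Qed.

Let start_ge0 : 0 <= start_error. Proof. exact: sumr_ge0. Qed.

Let eta_ge0 n : 0 <= eta n.
Proof. by rewrite /eta !addr_ge0 ?count_error_ge0 /link_error_r /link_error_pi. Qed.

Let e_init (j : nat) : (j < q)%N -> e (- j%:Z) <= start_error.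
Proof.
move=> jq; rewrite /e /lh /lambda_hat fitted_nonpos; last by lia.
by rewrite /start_error (bigD1 (Ordinal jq)) //= lerDl sumr_ge0.
Qed.

(** The arguments of [r] are changed first, at the fixed parameter [th], which costs the Lipschitz
    weights. The parameter is changed afterwards, at the stationary arguments, so the link errors
    depend on the recursion only through stationary quantities. *)
Let e_rec (n : nat) : e n.+1%:Z <= \sum_j beta j * e (n%:Z - (j : nat)%:Z) + eta n.+1.
Proof.
have ny : nneg_row (lagvec p ynat n.+1%:Z) by move=> i; rewrite mxE.
have nl : nneg_row (lagvec q lam n.+1%:Z) by move=> i; rewrite mxE ltW.
have nyh : nneg_row (lagvec p (counts y0 Y) n.+1%:Z) by move=> i; rewrite mxE counts_ge0.
have nlh : nneg_row (lagvec q lh n.+1%:Z) by move=> i; rewrite mxE lambda_hat_ge0.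
have lhE : lh n.+1%:Z = r (lagvec p (counts y0 Y) n.+1%:Z) (lagvec q lh n.+1%:Z) th +
    pi (X (n.+1%:Z - 1)) th.
  by rewrite /lh /lambda_hat fitted_pos h0_split.
have := r_lip nyh ny nlh nl.
have hy : \sum_(i < p) alpha i * `|lagvec p (counts y0 Y) n.+1%:Z 0 i - lagvec p ynat n.+1%:Z 0 i|
    <= count_error n.
  by apply: ler_sum => i _; rewrite ler_piMl //; have /andP[] := alpha01 i.
have hl : \sum_(j < q) beta j * `|lagvec q lh n.+1%:Z 0 j - lagvec q lam n.+1%:Z 0 j| =
    \sum_j beta j * e (n%:Z - (j : nat)%:Z).
  apply: eq_bigr => j _; rewrite !mxE /e; congr (_ * `|lh _ - lam _|); lia.
rewrite hl /e lhE lam_rec /eta /=.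
set s := \sum_j beta j * _; move: hy; set cy := \sum_(i < p) _ => hy.
rewrite /link_error_r /link_error_pi.
set a := r _ (lagvec q lh _) _; set b := r _ _ th; set c := r _ _ th0.
set u := pi _ th; set v := pi _ th0 => hr.
have -> : a + u - (c + v) = (a - b) + ((b - c) + (u - v)) by lra.
apply: le_trans (ler_normD _ _) _; have := ler_normD (b - c) (u - v); lra.
Qed.

Variable k : R.
Hypothesis k01 : 0 < k <= 1.

(** Only the last sum depends on the estimator or grows with [T]; the rest is the trace of the
    initial values. *)
Definition total_error (T : nat) : R :=
  start_error `^ k + \sum_(n < p) count_error n `^ k +
  \sum_(n < T) (link_error_r n `^ k + link_error_pi n `^ k).

Let decay_lt1 : 0 < 1 - rho `^ k.
Proof.
have /andP[r0 r1] := rho01; have /andP[k0 _] := k01.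
have := @gt0_ltr_powR _ k k0 rho 1; rewrite !nnegrE powR1 subr_gt0.
by apply => //; exact: ltW.
Qed.

Let sum_count_error T : \sum_(n < T) count_error n `^ k <= \sum_(n < p) count_error n `^ k.
Proof.
have kn0 : k != 0 by case/andP: k01 => k0 _; rewrite gt_eqF.
rewrite -!(big_mkord xpredT (fun n => count_error n `^ k)).
have [Tp|pT] := leqP T p.
  by rewrite (big_cat_nat _ Tp) //= lerDl sumr_ge0 // => i _; exact: powR_ge0.
rewrite (big_cat_nat _ (ltnW pT)) //= [X in _ + X]big_nat_cond [X in _ + X]big1 ?addr0 //.
by move=> i /andP[/andP[pi_ _] _]; rewrite count_error_eq0 // powR0.
Qed.

Lemma sum_envelope_le T :
  (1 - rho `^ k) * \sum_(n < T) B n.+1 `^ k <= total_error T.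
Proof.
apply: le_trans (envelope_sum rho01 eta_ge0 start_ge0 T k01) _.
rewrite /total_error -addrA lerD2l.
apply: (@le_trans _ _ (\sum_(n < T) (count_error n `^ k + (link_error_r n `^ k + link_error_pi n
  `^ k)))).
  apply: ler_sum => n _; rewrite /eta /= addrC.
  have h1 : 0 <= link_error_r n by exact: normr_ge0.
  have h2 : 0 <= link_error_pi n by exact: normr_ge0.
  apply: le_trans (powR_subadd (count_error_ge0 n) (addr_ge0 h1 h2) k01) _.
  by rewrite lerD2l; exact: powR_subadd.
by rewrite big_split /= lerD2r sum_count_error.
Qed.

Variables (F : R -> probability nat R) (M1 : R).
Hypothesis M1_ge0 : 0 <= M1.
Hypothesis pgf_lip : forall u l : R, 0 <= u <= 1 -> 0 < l ->
  derivable (fun l' => pgf F l' u) l 1 /\ `| derive1 (fun l' => pgf F l' u) l | <= M1.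
Variable c : R -> R.
Hypothesis c_bd : forall z, `|c z| <= 1.
Hypothesis c_lip : forall z z', `|c z - c z'| <= `|z - z'|.

Let Zh := Z_hat h0 y0 l0 th Y X.
Let Z := zvec p q ynat lam X.

Let lag_rate : R := (q%:R / rho ^+ q) `^ k.
(** [M1 ^ k] comes from the generating function and [2 * lag_rate] from the [q] lagged intensities
    in the trigonometric factor. Both multiply the sum of [B ^ k], whence the division by
    [1 - rho ^ k]; the final 2 accounts for the lagged counts. *)
Definition error_rate : R := (M1 `^ k + 2 * lag_rate) / (1 - rho `^ k) + 2.

Lemma error_rate_ge0 : 0 <= error_rate.
Proof.
rewrite addr_ge0 // divr_ge0 ?(ltW decay_lt1) // addr_ge0 ?powR_ge0 //.
by rewrite mulr_ge0 // powR_ge0.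
Qed.

Let pgf_diff (n : nat) (u : R) : 0 <= u <= 1 ->
  `|pgf F (lh n.+1%:Z) u - pgf F (lam n.+1%:Z) u| <= M1 `^ k * B n.+1 `^ k.
Proof.
move=> u01.
have B0 : 0 <= B n.+1 by exact: envelope_ge0.
have eB : e n.+1%:Z <= B n.+1 := error_le_envelope beta0 rho01 beta_rho (fun _ => normr_ge0 _)
  eta_ge0 start_ge0 e_init e_rec n.
have h1 : `|pgf F (lh n.+1%:Z) u - pgf F (lam n.+1%:Z) u| <= 1.
  have /andP[a0 a1] := @pgf_bounds _ F (lh n.+1%:Z) u u01.
  have /andP[b0 b1] := @pgf_bounds _ F (lam n.+1%:Z) u u01.
  by rewrite ler_norml; apply/andP; split; lra.
have h2 : `|pgf F (lh n.+1%:Z) u - pgf F (lam n.+1%:Z) u| <= M1 * B n.+1.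
  apply: (@le_trans _ _ (M1 * e n.+1%:Z)); last exact: ler_wpM2l.
  (* Both intensities are positive, so the segment between them lies where [pgf_lip] applies. *)
  apply: (@derivable_lipschitz _ (fun l => pgf F l u)) => z /andP[hz _].
  apply: pgf_lip => //; apply: lt_le_trans hz.
  by rewrite lt_min lam_gt0 lambda_hat_gt0.
rewrite -powRM //; apply: le_trans (min1_le_powR _ k01); last exact: mulr_ge0.
by rewrite le_min h1.
Qed.

(** Since [c] is bounded by 1 and 1-Lipschitz, the difference is at most [2 min(1, |v| S)], hence at
    most [2 (|v| S) ^ k]. Replacing [|v| ^ k] by [1 + |v|] makes the first moment of the weight
    sufficient. *)
Let trig_diff (n : nat) v :
  `|c (dotp v (Zh n.+1%:Z)) - c (dotp v (Z n.+1%:Z))| <=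
  2 * ((1 + enorm v) * (count_error n `^ k + lag_rate * B n.+1 `^ k)).
Proof.
have B0 : 0 <= B n.+1 by exact: envelope_ge0.
have v0 : 0 <= enorm v by exact: sqrtr_ge0.
have q0 : 0 <= q%:R / rho ^+ q.
  by rewrite divr_ge0 // exprn_ge0 // ltW //; case/andP: rho01.
pose S := count_error n + q%:R / rho ^+ q * B n.+1.
have S0 : 0 <= S by rewrite addr_ge0 ?count_error_ge0 // mulr_ge0.
have hS : l1dist (Zh n.+1%:Z) (Z n.+1%:Z) <= S.
  rewrite /Zh /Z /Z_hat /zvec !l1dist_row_mx -/(count_error n).
  have -> : l1dist (X (n.+1%:Z - 1)) (X (n.+1%:Z - 1)) = 0.
    by rewrite /l1dist big1 // => j _; rewrite subrr normr0.
  rewrite addr0 lerD2l -/lh.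
  apply: (@le_trans _ _ (\sum_(j < q) B n.+1 / rho ^+ q)).
    apply: ler_sum => j _; rewrite !mxE.
    have -> : n.+1%:Z - (j.+1)%:Z = n%:Z - (j : nat)%:Z.
      by rewrite !intS opprD addrACA subrr add0r.
    exact: (lagged_error_le_envelope beta0 rho01 beta_rho (fun _ => normr_ge0 _) eta_ge0
      start_ge0 e_init e_rec n (ltn_ord j)).
  rewrite sumr_const card_ord -mulr_natl; lra.
have h1 : `|c (dotp v (Zh n.+1%:Z)) - c (dotp v (Z n.+1%:Z))| <= 2 * Num.min 1 (enorm v * S).
  case: (leP 1 (enorm v * S)) => _.
    by rewrite mulr1 (le_trans (ler_normB _ _)) // (_ : 2 = 1 + 1) // lerD.
  apply: le_trans (c_lip _ _) _; apply: le_trans (dotp_diff_le _ _ _) _.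
  have : enorm v * l1dist (Zh n.+1%:Z) (Z n.+1%:Z) <= enorm v * S by exact: ler_wpM2l.
  have : 0 <= enorm v * S by rewrite mulr_ge0.
  by lra.
apply: le_trans h1 _; rewrite ler_pM2l //.
apply: le_trans (min1_le_powR _ k01) _; first exact: mulr_ge0.
rewrite powRM //; apply: ler_pM; rewrite ?powR_ge0 //.
  by apply: powR_le_add1r => //; case/andP: k01 => /ltW -> ->.
rewrite -powRM //; apply: powR_subadd => //; first exact: count_error_ge0.
exact: mulr_ge0.
Qed.

(** The product of two factors is compared one factor at a time. The resulting bound separates [v],
    through the integrable factor [1 + |v|], from the data, and is uniform in [u]. *)
Lemma empirical_transform_diff (T : nat) (u : R) v : 0 <= u <= 1 ->
  `|T%:R^-1 * \sum_(n < T) (eps_hat h0 F y0 l0 th Y X n.+1%:Z u * c (dotp v (Zh n.+1%:Z))) -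
    T%:R^-1 * \sum_(n < T) ((u ^+ Y n.+1%:Z - pgf F (lam n.+1%:Z) u) * c (dotp v (Z n.+1%:Z)))|
  <= (1 + enorm v) * (error_rate * (T%:R^-1 * total_error T)).
Proof.
move=> u01; have /andP[u0 u1] := u01.
have v0 : 0 <= enorm v by exact: sqrtr_ge0.
rewrite -mulrBr normrM ger0_norm ?invr_ge0 // -sumrB.
rewrite [leRHS](_ : _ = T%:R^-1 * ((1 + enorm v) * (error_rate * total_error T))); last first.
  by ring.
apply: ler_wpM2l; first by rewrite invr_ge0.
have term (n : nat) :
    `|eps_hat h0 F y0 l0 th Y X n.+1%:Z u * c (dotp v (Zh n.+1%:Z)) -
      (u ^+ Y n.+1%:Z - pgf F (lam n.+1%:Z) u) * c (dotp v (Z n.+1%:Z))| <=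
    (1 + enorm v) * ((M1 `^ k + 2 * lag_rate) * B n.+1 `^ k + 2 * count_error n `^ k).
  have := pgf_diff n u01; have := trig_diff n v.
  rewrite /eps_hat -/lh.
  set g := pgf F (lh _) u; set g' := pgf F (lam _) u; set w := u ^+ _.
  set x := c _; set x' := c _ => h1 h2.
  have -> : (w - g) * x - (w - g') * x' = (g' - g) * x + (w - g') * (x - x') by ring.
  apply: le_trans (ler_normD _ _) _; rewrite !normrM.
  have e1 : `|g' - g| * `|x| <= M1 `^ k * B n.+1 `^ k.
    by rewrite -[leRHS]mulr1 distrC; apply: ler_pM => //; exact: c_bd.
  have wg : `|w - g'| <= 1.
    have /andP[a0 a1] := @pgf_bounds _ F (lam n.+1%:Z) u u01.
    have w0 : 0 <= w by exact: exprn_ge0. have w1 : w <= 1 by exact: exprn_ile1.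
    by rewrite ler_norml /g'; apply/andP; split; lra.
  have e2 : `|w - g'| * `|x - x'| <=
      2 * ((1 + enorm v) * (count_error n `^ k + lag_rate * B n.+1 `^ k)).
    by rewrite -[leRHS]mul1r; apply: ler_pM.
  have e3 : M1 `^ k * B n.+1 `^ k <= (1 + enorm v) * (M1 `^ k * B n.+1 `^ k).
    by rewrite ler_peMl ?lerDl // mulr_ge0 ?powR_ge0.
  move: e1 e2 e3; set b := B _ `^ k; set y := count_error n `^ k.
  move: (M1 `^ k) lag_rate => a1 a2; nra.
apply: le_trans (ler_norm_sum _ _ _) _.
apply: (@le_trans _ _ (\sum_(n < T) (1 + enorm v) *
    ((M1 `^ k + 2 * lag_rate) * B n.+1 `^ k + 2 * count_error n `^ k))).
  by apply: ler_sum => n _; exact: term.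
rewrite -mulr_sumr; apply: ler_wpM2l; first by rewrite addr_ge0.
rewrite big_split /= -!mulr_sumr /error_rate [leRHS]mulrDl; apply: lerD.
  have r1 : 0 < 1 - rho `^ k.
    exact: decay_lt1.
  rewrite -mulrA; apply: ler_wpM2l.
    by rewrite addr_ge0 ?powR_ge0 // mulr_ge0 ?powR_ge0.
  by rewrite ler_pdivlMl //; exact: sum_envelope_le.
apply: ler_wpM2l => //; apply: le_trans (sum_count_error T) _.
rewrite /total_error -addrA addrCA lerDl addr_ge0 ?powR_ge0 //.
by apply: sumr_ge0 => n _; rewrite addr_ge0 ?powR_ge0.
Qed.

End fitted_vs_stationary.

Section small_bounded_mean.
Context {R : realType} {dO : measure_display} {Omega : measurableType dO}.
Variable P : probability Omega R.

(* o_P(1) times O_P(1). *)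
Lemma small_in_prob_bounded_mean (D : nat -> Omega -> R) (M X : nat -> Omega -> \bar R)
    (delta k Kc C : R) :
  0 < delta -> 0 < k -> 0 <= C -> (forall n w, 0 <= D n w) ->
  (\forall n \near \oo, measurable_fun setT (D n)) ->
  cvg_in_prob P (fun n w => (D n w)%:E) 0%E ->
  (forall n, measurable_fun setT (M n)) -> (forall n w, 0 <= M n w)%E ->
  (forall n, \int[P]_w M n w <= Kc%:E)%E ->
  (\forall n \near \oo, forall w, D n w < delta ->
     (X n w <= ((C * D n w) `^ k)%:E * M n w)%E) ->
  small_in_prob P X.
Proof.
move=> delta0 k0 C0 D0 mD cD mM M0 MK XM e d e0 d0.
have Kc0 : 0 <= Kc by rewrite -lee_fin (le_trans _ (MK 0%N)) // integral_ge0.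
(* Markov's inequality gives [P (M n >= a) <= Kc / a <= d / 2]. *)
pose a := 2 * (Kc + 1) / d.
have Kc1 : 0 < Kc + 1 by rewrite ltr_wpDl.
have a0 : 0 < a by rewrite divr_gt0 // mulr_gt0.
(* Chosen so that [((C + 1) * eta) ^ k = e / a], to be multiplied by [M n < a]; the minimum with
   [delta / 2] below keeps [D n] within the range of the domination. *)
pose eta := (e / a) `^ k^-1 / (C + 1).
have C1 : 0 < C + 1 by rewrite ltr_wpDl.
have eta0 : 0 < eta by apply: divr_gt0 => //; apply: powR_gt0; exact: divr_gt0.
pose s := Num.min eta (delta / 2).
have s0 : 0 < s by rewrite lt_min eta0 divr_gt0.
have d2 : 0 < d / 2 by rewrite divr_gt0.
have cDs : \forall n \near \oo, (P [set w | s%:E < `|(D n w)%:E - 0|] < (d / 2)%:E)%E.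
  have /fine_cvgP[fD cDf] := cD s s0.
  move/cvgrPdist_lt : cDf => /(_ _ d2).
  apply: filterS2 fD => n fn; rewrite sub0r normrN /= => h.
  by rewrite -(fineK fn) lte_fin; apply: le_lt_trans h; exact: ler_norm.
near=> n.
have hX : forall w, D n w < delta -> (X n w <= ((C * D n w) `^ k)%:E * M n w)%E by near: n.
have mDn : measurable_fun setT (D n) by near: n.
have PA1 : (P [set w | s%:E < `|(D n w)%:E - 0|] < (d / 2)%:E)%E by near: n.
pose A1 := [set w | (s%:E < `|(D n w)%:E - 0|)%E].
pose A2 := [set w | (a%:E <= M n w)%E].
have mA1 : measurable A1.
  rewrite -[A1]setTI; apply: emeasurable_fun_o_infty => //.
  apply: measurableT_comp => //; apply: emeasurable_funB => //.
  exact/measurable_EFinP.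
have mA2 : measurable A2 by rewrite -[A2]setTI; exact: emeasurable_fun_c_infty.
exists (A1 `|` A2); split; first exact: measurableU.
  apply: le_trans (measureU2 _ mA1 mA2) _.
  rewrite [d]splitr EFinD; apply: leeD; first exact: ltW.
  apply: le_trans (markov_ge0 P a0 (mM n) (M0 n)) _.
  rewrite muleC lee_pdivrMr //; apply: le_trans (MK n) _.
  rewrite -EFinM lee_fin (_ : d / 2 * a = Kc + 1) ?lerDl // /a.
  by field; rewrite gt_eqF.
move=> w /not_orP[/= /negP + /negP]; rewrite -leNgt -ltNge sube0 => hD hM.
have {}hD : D n w <= s by move: hD; rewrite abse_EFin lee_fin ger0_norm.
apply: le_trans (hX w _) _.
  apply: le_lt_trans hD _; rewrite gt_min; apply/orP; right; lra.
apply: (@le_trans _ _ ((e / a)%:E * a%:E)%E); last first.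
  by rewrite -EFinM divfK ?gt_eqF.
apply: lee_pmul => //; last exact: ltW.
  by rewrite lee_fin powR_ge0.
rewrite lee_fin.
rewrite [leRHS](_ : _ = ((e / a) `^ k^-1) `^ k); last first.
  by rewrite -powRrM mulVf ?gt_eqF // powRr1 // divr_ge0 // ltW.
apply: ge0_ler_powR; rewrite ?nnegrE ?(ltW k0) ?mulr_ge0 ?powR_ge0 //.
apply: (@le_trans _ _ ((C + 1) * eta)); last by rewrite /eta mulrC divfK ?gt_eqF.
apply: ler_pM => //; first by rewrite lerDl.
by apply: le_trans hD _; rewrite ge_min lexx.
Unshelve. all: by end_near. Qed.

End small_bounded_mean.

(** * Bounds for the transforms, clamping, and measurability of the links *)

Section auxiliary_facts.
Context {R : realType}.

Lemma normr_mean_le1 (T : nat) (a : nat -> R) : (forall n, `|a n| <= 1) ->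
  `|T%:R^-1 * \sum_(n < T) a n| <= 1.
Proof.
move=> a1; rewrite normrM ger0_norm ?invr_ge0 //.
case: T => [|T]; first by rewrite big_ord0 normr0 mulr0.
rewrite ler_pdivrMl // mulr1 (le_trans (ler_norm_sum _ _ _)) //.
by rewrite -[X in _ <= X%:R]card_ord -sumr_const; apply: ler_sum.
Qed.

Lemma pgf_gap_le1 (F : R -> probability nat R) (l u : R) k : 0 <= u <= 1 ->
  `|u ^+ k - pgf F l u| <= 1.
Proof.
move=> u01; have /andP[u0 u1] := u01; have /andP[h1 h2] := @pgf_bounds _ F l u u01.
have := exprn_ge0 k u0; have := exprn_ile1 k u0 u1.
by rewrite ler_norml => *; apply/andP; split; lra.
Qed.

Lemma cos_lipschitz (x y : R) : `|cos x - cos y| <= `|x - y|.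
Proof.
rewrite -[leRHS]mul1r; apply: derivable_lipschitz => z _.
split; first by have [] := is_derive_cos z.
rewrite derive1E; have [_ ->] := is_derive_cos z.
by rewrite normrN ler_norml sin_geN1 sin_le1.
Qed.

Lemma sin_lipschitz (x y : R) : `|sin x - sin y| <= `|x - y|.
Proof.
rewrite -[leRHS]mul1r; apply: derivable_lipschitz => z _.
split; first by have [] := is_derive_sin z.
rewrite derive1E; have [_ ->] := is_derive_sin z.
by rewrite ler_norml cos_geN1 cos_le1.
Qed.

Lemma measurable_cos : measurable_fun setT (@cos R).
Proof. by apply: continuous_measurable_fun; exact: continuous_cos. Qed.

Lemma measurable_sin : measurable_fun setT (@sin R).
Proof. by apply: continuous_measurable_fun; exact: continuous_sin. Qed.

(** Projection onto [[0, 1]]. It makes the transforms measurable and bounded by 1 on the whole space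
    without changing them for [u] in [(0, 1)], where the weight lives. *)
Definition clamp01 (u : R) : R := Num.max 0 (Num.min 1 u).

Lemma clamp01_bounds u : 0 <= clamp01 u <= 1.
Proof. by rewrite /clamp01 le_max lexx ge_max ler01 ge_min lexx. Qed.

Lemma clamp01_id u : 0 < u < 1 -> clamp01 u = u.
Proof. by move=> /andP[u0 u1]; rewrite /clamp01 min_r ?max_r // ltW. Qed.

Lemma measurable_clamp01 : measurable_fun setT clamp01.
Proof. by apply: measurable_maxr => //; exact: measurable_minr. Qed.

Lemma interior_box n (A : set 'rV[R]_n) (c : 'rV[R]_n) : interior A c ->
  exists2 delta : R, 0 < delta & forall v, in_box c delta v -> A v.
Proof.
move=> /nbhs_ballP[delta /= d0 hd]; exists delta => // v hv; apply: hd; split => // i j.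
by rewrite ord1 /ball /= distrC.
Qed.

(** Moving a coordinate of the right block moves [v] alone, so the difference quotients coincide.
    This extracts derivability in the parameter from joint smoothness in intensities and
    parameter. *)
Lemma derivable_rsubmx n1 n2 (f : 'rV[R]_n1 -> 'rV[R]_n2 -> R) a v i :
  derivable (fun z => f (lsubmx z) (rsubmx z)) (row_mx a v) (delta_mx 0 (rshift n1 i)) ->
  derivable (f a) v (delta_mx 0 i).
Proof.
rewrite /derivable; set g1 := fun h : R => _; set g2 := fun h : R => _.
suff -> : g1 = g2 by [].
apply/funext => h; rewrite /g1 /g2 /= row_mxKl row_mxKr; congr (_ *: (f _ _ - _)).
  apply/rowP => j; rewrite [LHS]mxE [LHS]mxE row_mxEl !mxE.
  by rewrite eq_lrshift andbF mulr0 add0r.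
by apply/rowP => j; rewrite [LHS]mxE [LHS]mxE row_mxEr !mxE eq_rshift.
Qed.

Lemma measurable_info dO (Omega : measurableType dO) m (Y : int -> Omega -> nat)
    (X : int -> Omega -> 'rV[R]_m) SY SX A :
  (forall t, SY t -> measurable_fun setT (Y t)) ->
  (forall t, SX t -> measurable_fun setT (X t)) ->
  info Y X SY SX A -> measurable A.
Proof.
move=> mY mX; apply: smallest_sub; first exact: sigma_algebra_measurable.
move=> _ [[s [B [sB ->]]]|[s [B [sB mB ->]]]]; rewrite -[X in measurable X]setTI.
  exact: mY.
exact: mX.
Qed.

Lemma measurable_link d (T : measurableType d) p q K (r : 'rV[R]_p -> 'rV[R]_q -> 'rV[R]_K -> R)
    (xi : T -> 'rV[R]_p) (ups : T -> 'rV[R]_q) (th : T -> 'rV[R]_K) :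
  {within [set z : 'rV[R]_p * 'rV[R]_q * 'rV[R]_K | nneg_row z.1.1 /\ nneg_row z.1.2],
     continuous (fun z => r z.1.1 z.1.2 z.2)} ->
  measurable_fun setT xi -> measurable_fun setT ups -> measurable_fun setT th ->
  (forall w, nneg_row (xi w)) -> (forall w, nneg_row (ups w)) ->
  measurable_fun setT (fun w => r (xi w) (ups w) (th w)).
Proof.
move=> cr mxi mups mth nxi nups.
have d1 : discretizable [set v | nneg_row v] xi.
  by apply: discretizable_row => // [j|]; [exact: measurable_coord|right].
have d2 : discretizable [set v | nneg_row v] ups.
  by apply: discretizable_row => // [j|]; [exact: measurable_coord|right].
have d3 : discretizable [set: 'rV[R]_K] th.
  by apply: discretizable_row => // [j|]; [exact: measurable_coord|left].
apply: (discretizable_measurable (discretizable_pair (discretizable_pair d1 d2) d3)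
  (f := fun z => r z.1.1 z.1.2 z.2)).
by apply: continuous_subspaceW cr => z /= [[]].
Qed.

Lemma measurable_covariate_link d (T : measurableType d) m K (pi : 'rV[R]_m -> 'rV[R]_K -> R)
    (x : T -> 'rV[R]_m) (th : T -> 'rV[R]_K) :
  continuous (fun z : 'rV[R]_m * 'rV[R]_K => pi z.1 z.2) ->
  measurable_fun setT x -> measurable_fun setT th ->
  measurable_fun setT (fun w => pi (x w) (th w)).
Proof.
move=> cpi mx mth.
have d1 : discretizable [set: 'rV[R]_m] x.
  by apply: discretizable_row => // [j|]; [exact: measurable_coord|left].
have d2 : discretizable [set: 'rV[R]_K] th.
  by apply: discretizable_row => // [j|]; [exact: measurable_coord|left].
apply: (discretizable_measurable (discretizable_pair d1 d2) (f := fun z => pi z.1 z.2)).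
exact: continuous_subspaceT.
Qed.

Lemma normc_sqr (a b : R) : ComplexField.Normc.normc (Complex a b) ^+ 2 = a ^+ 2 + b ^+ 2.
Proof. by rewrite /= sqr_sqrtr // addr_ge0 // sqr_ge0. Qed.

Lemma normc_D_stat p q m K (h : 'rV[R]_(p + q + m) -> 'rV[R]_K -> R) F y0 l0 th Y X T u v :
  ComplexField.Normc.normc (D_stat h F y0 l0 th Y X T u v) ^+ 2 =
  (T%:R^-1 * \sum_(n < T) (eps_hat h F y0 l0 th Y X n.+1%:Z u *
     cos (dotp v (Z_hat h y0 l0 th Y X n.+1%:Z)))) ^+ 2 +
  (T%:R^-1 * \sum_(n < T) (eps_hat h F y0 l0 th Y X n.+1%:Z u *
     sin (dotp v (Z_hat h y0 l0 th Y X n.+1%:Z)))) ^+ 2.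
Proof.
rewrite -normc_sqr; congr (ComplexField.Normc.normc _ ^+ 2).
rewrite /D_stat big_add1 /= big_mkord.
have -> : \sum_(i < T) real_complex R (eps_hat h F y0 l0 th Y X i.+1%:Z u) *
      cis (dotp v (Z_hat h y0 l0 th Y X i.+1%:Z)) =
   Complex (\sum_(n < T) (eps_hat h F y0 l0 th Y X n.+1%:Z u *
       cos (dotp v (Z_hat h y0 l0 th Y X n.+1%:Z))))
     (\sum_(n < T) (eps_hat h F y0 l0 th Y X n.+1%:Z u *
       sin (dotp v (Z_hat h y0 l0 th Y X n.+1%:Z)))).
  elim: T => [|T IH]; first by rewrite !big_ord0.
  rewrite !big_ord_recr /= IH /cis; apply/eqP; rewrite eq_complex /=.
  by rewrite !mul0r subr0 addr0 !eqxx.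
by apply/eqP; rewrite eq_complex /= !mul0r subr0 addr0 !eqxx.
Qed.

End auxiliary_facts.

Lemma cvg_section (U V : topologicalType) (x : U) (y : V) : (x, y') @[y' --> y] --> (x, y).
Proof. exact: (cvg_pair (@cvg_cst _ x _ (nbhs y) _) (@cvg_id _ (nbhs y))). Qed.

Lemma integral_one_plus_sum d (T : measurableType d) (R : realType) (P : probability T R)
    (f g : nat -> T -> \bar R) (a b : \bar R) :
  (a < +oo)%E -> (b < +oo)%E ->
  (forall t x, (0 <= f t x)%E) -> (forall t x, (0 <= g t x)%E) ->
  (forall t, measurable_fun setT (f t)) -> (forall t, measurable_fun setT (g t)) ->
  (forall t, \int[P]_x f t x = a)%E -> (forall t, \int[P]_x g t x = b)%E ->
  0 <= fine ((1 + a) + (1 + b))%E /\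
  forall t, (\int[P]_x ((1 + f t x) + (1 + g t x)) = (fine ((1 + a) + (1 + b)))%:E)%E.
Proof.
move=> afin bfin f0 g0 mf mg fa gb.
have a0 : (0 <= a)%E by rewrite -(fa 0%N); exact: integral_ge0.
have b0 : (0 <= b)%E by rewrite -(gb 0%N); exact: integral_ge0.
have ab0 : (0 <= (1 + a) + (1 + b))%E by rewrite !adde_ge0.
split=> [|t]; first exact: fine_ge0.
have i1 : (\int[P]_om (1 : \bar R) = 1)%E by rewrite integral_cst //= probability_setT mule1.
rewrite fineK; last by rewrite ge0_fin_numE // !lte_add_pinfty ?ltry.
rewrite ge0_integralD //; last 4 first.
- by move=> x _; rewrite adde_ge0.
- by apply: emeasurable_funD.
- by move=> x _; rewrite adde_ge0.
- by apply: emeasurable_funD.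
by rewrite !ge0_integralD // i1 fa gb.
Qed.

(** * Convergence of the test statistic *)

Lemma measurable_expn_nat d (T : measurableType d) (R : realType) (a : T -> R) (N : T -> nat) :
  measurable_fun setT a -> measurable_fun setT N -> measurable_fun setT (fun x => a x ^+ N x).
Proof.
move=> ma mN _ B mB; rewrite setTI.
rewrite (_ : _ @^-1` B = \bigcup_k (N @^-1` [set k] `&` (fun x => a x ^+ k) @^-1` B)).
  apply: bigcupT_measurable => k; apply: measurableI.
    by rewrite -[X in measurable X]setTI; exact: mN.
  by rewrite -[X in measurable X]setTI; exact: measurable_funX.
by apply/seteqP; split => [x Bx|x [k _ [/= <-]]] //; exists (N x).
Qed.

Section goodness_of_fit.
Context {R : realType} {dO : measure_display} {Omega : measurableType dO}.
Variable P : probability Omega R.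
Variables p0 q0 m K0 : nat.
Variables F FA : R -> probability nat R.
Hypotheses (F_order : stoch_order F) (FA_order : stoch_order FA).
Variables (h0 : 'rV[R]_(p0 + q0 + m) -> 'rV[R]_K0 -> R)
  (r : 'rV[R]_p0 -> 'rV[R]_q0 -> 'rV[R]_K0 -> R) (pi : 'rV[R]_m -> 'rV[R]_K0 -> R).
Hypothesis h0_gt0 : forall y l x th, nneg_row y -> nneg_row l ->
  0 < h0 (row_mx (row_mx y l) x) th.
Hypothesis h0_split : forall y l x th, nneg_row y -> nneg_row l ->
  h0 (row_mx (row_mx y l) x) th = r y l th + pi x th.
Hypothesis r_cont : {within
  [set z : 'rV[R]_p0 * 'rV[R]_q0 * 'rV[R]_K0 | nneg_row z.1.1 /\ nneg_row z.1.2],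
  continuous (fun z => r z.1.1 z.1.2 z.2)}.
Hypothesis pi_cont : continuous (fun z : 'rV[R]_m * 'rV[R]_K0 => pi z.1 z.2).
Variable Theta : set 'rV[R]_K0.
Variables (alpha : 'I_p0 -> R) (beta : 'I_q0 -> R).
Hypothesis contraction : \sum_(i < p0) alpha i + \sum_(j < q0) beta j < 1.
Hypothesis r_lip : forall th y1 y2 l1 l2, Theta th ->
  nneg_row y1 -> nneg_row y2 -> nneg_row l1 -> nneg_row l2 ->
  `|r y1 l1 th - r y2 l2 th| <=
    \sum_(i < p0) alpha i * `|y1 0 i - y2 0 i| +
    \sum_(j < q0) beta j * `|l1 0 j - l2 0 j|.
Variables (Y : int -> Omega -> nat) (X : int -> Omega -> 'rV[R]_m).
Hypotheses (Y_meas : forall t, measurable_fun setT (Y t))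
  (X_meas : forall t, measurable_fun setT (X t)).
Variables (Theta0 : set 'rV[R]_K0) (theta0 : 'rV[R]_K0).
Hypotheses (Theta0_sub : Theta0 `<=` Theta) (theta0_int : interior Theta0 theta0).
Variable lam : int -> Omega -> R.
Hypothesis lam_gt0 : forall t om, 0 < lam t om.
Hypothesis lam_past : forall t : int, measurable_wrt (past Y X (t - 1)) (lam t).
Hypothesis lam_rec : forall t : int, {ae P, forall om, lam t om =
  r (lagvec p0 (fun s => (Y s om)%:R) t) (lagvec q0 (fun s => lam s om) t) theta0 +
  pi (X (t - 1) om) theta0}.
Hypothesis joint_stat : stationary_ergodic P (fun t om => (Y t om, lam t om, X t om)).
Hypothesis Y_law : forall t : int,
  cond_law P (past Y X (t - 1)) (Y t) (fun om => FA (lam t om)).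
Hypothesis r_C3 : forall y, nneg_row y ->
  Ck 3 [set z : 'rV[R]_(q0 + K0) | pos_row (lsubmx z) /\ Theta (rsubmx z)]
    (fun z => r y (lsubmx z) (rsubmx z)).
Hypothesis pi_C2 : forall x, Ck 2 Theta (pi x).
Variable kappa : R.
Hypothesis kappa_gt0 : 0 < kappa.
Hypothesis pi_grad : forall t : int, (\int[P]_om ereal_sup
  [set (enorm (grad (pi (X (t - 1) om)) th) `^ kappa)%:E | th in Theta0] < +oo)%E.
Hypothesis r_grad : forall t : int, (\int[P]_om ereal_sup
  [set (enorm (grad (r (lagvec p0 (fun s => (Y s om)%:R) t)
                       (lagvec q0 (fun s => lam s om) t)) th) `^ kappa)%:E | th in Theta0]
    < +oo)%E.

Let n := (p0 + q0 + m)%N.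
Let Z (t : int) (om : Omega) : 'rV[R]_n :=
  zvec p0 q0 (fun s => (Y s om)%:R) (fun s => lam s om) (fun s => X s om) t.

Lemma theta0_Theta : Theta theta0.
Proof. exact: Theta0_sub (interior_subset theta0_int). Qed.

(** Comparing a unit vector with the zero vector in the Lipschitz condition isolates a single weight
    as an upper bound of an absolute value. *)
Lemma lipschitz_weights_ge0 : (forall i, 0 <= alpha i) /\ (forall j, 0 <= beta j).
Proof.
have nn0 k : nneg_row (0 : 'rV[R]_k) by move=> i; rewrite mxE.
have nnd k (i : 'I_k) : nneg_row (delta_mx 0 i : 'rV[R]_k) by move=> j; rewrite mxE ler0n.
have z0 k (a : 'I_k -> R) (v : 'rV[R]_k) : \sum_i a i * `|v 0 i - v 0 i| = 0.
  by rewrite big1 // => i _; rewrite subrr normr0 mulr0.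
have z1 k (a : 'I_k -> R) (i : 'I_k) :
    \sum_j a j * `|(delta_mx 0 i : 'rV[R]_k) 0 j - (0 : 'rV[R]_k) 0 j| = a i.
  rewrite (bigD1 i) //= !mxE !eqxx subr0 normr1 mulr1 big1 ?addr0 // => j ji.
  by rewrite !mxE (negbTE ji) andbF subr0 normr0 mulr0.
split=> i.
  have := r_lip theta0_Theta (nnd p0 i) (nn0 p0) (nn0 q0) (nn0 q0).
  by rewrite z1 z0 addr0; exact: le_trans.
have := r_lip theta0_Theta (nn0 p0) (nn0 p0) (nnd q0 i) (nn0 q0).
by rewrite z1 z0 add0r; exact: le_trans.
Qed.

Lemma lipschitz_weights_le1 i : 0 <= alpha i <= 1.
Proof.
have [a0 b0] := lipschitz_weights_ge0; rewrite a0 /=.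
have hb : 0 <= \sum_(j < q0) beta j by exact: sumr_ge0.
have : alpha i <= \sum_(i < p0) alpha i by rewrite (bigD1 i) //= lerDl sumr_ge0.
by have := contraction; lra.
Qed.

Lemma sum_beta_lt1 : \sum_j beta j < 1.
Proof.
have [a0 b0] := lipschitz_weights_ge0.
have : 0 <= \sum_(i < p0) alpha i by exact: sumr_ge0.
by have := contraction; lra.
Qed.

Lemma lam_meas t : measurable_fun setT (lam t).
Proof.
move=> _ B mB; rewrite setTI; have := @lam_past t B mB.
by apply: measurable_info.
Qed.

Let E : measurableType _ := (nat * R * 'rV[R]_m)%type.
Let S (t : int) (om : Omega) : E := (Y t om, lam t om, X t om).

Let mS t : measurable_fun setT (S t).
Proof. by apply: measurable_fun_pair => //; apply: measurable_fun_pair => //; exact: lam_meas. Qed.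

Let Sp (t : int) (om : Omega) : path_space E := path_shift t (path_of S om).

(* On the path space the intensity coordinate may be negative, where the link
   function is uncontrolled; its absolute value is used instead. *)
Let np (x : path_space E) (t : int) : nat := (x t).1.1.
Let yp (x : path_space E) (t : int) : R := (np x t)%:R.
Let lp (x : path_space E) (t : int) : R := `|(x t).1.2|.
Let xp (x : path_space E) (t : int) : 'rV[R]_m := (x t).2.

Let m_np t : measurable_fun setT (np^~ t).
Proof.
exact: (measurableT_comp measurable_fst (measurableT_comp measurable_fst (measurable_eval t))).
Qed.

Let m_yp t : measurable_fun setT (yp^~ t).
Proof. exact: (measurableT_comp (measurable_fun_nat (fun k => k%:R : R)) (m_np t)). Qed.

Let m_lp t : measurable_fun setT (lp^~ t).
Proof.
apply: measurableT_comp => //.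
exact: (measurableT_comp measurable_snd (measurableT_comp measurable_fst (measurable_eval t))).
Qed.

Let m_xp t : measurable_fun setT (xp^~ t).
Proof. exact: (measurableT_comp measurable_snd (measurable_eval t)). Qed.

(** This and the next three identities read the lags at time [0] of the path shifted by [t] as the
    lags at time [t], so that stationarity applies to functionals evaluated at time [0]. *)
Let lag_np t om : lagvec p0 (yp (Sp t om)) 0 = lagvec p0 (fun s => (Y s om)%:R) t.
Proof. by apply/rowP => j; rewrite !mxE /yp /np /Sp /path_shift /path_of /S /= sub0r addrC. Qed.

Let lag_lp t om : lagvec q0 (lp (Sp t om)) 0 = lagvec q0 (fun s => lam s om) t.
Proof.
apply/rowP => j; rewrite !mxE /lp /Sp /path_shift /path_of /S /= sub0r addrC.
by rewrite gtr0_norm.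
Qed.

Let xp_Sp t om : xp (Sp t om) (0 - 1) = X (t - 1) om.
Proof. by rewrite /xp /Sp /path_shift /path_of /S /= sub0r addrC. Qed.

Let zp (x : path_space E) : 'rV[R]_n := zvec p0 q0 (yp x) (lp x) (xp x) 0.

Let m_zp : measurable_fun setT zp.
Proof. by apply: measurable_zvec. Qed.

Let zp_Sp t om : zp (Sp t om) = Z t om.
Proof. by rewrite /zp /Z /zvec lag_np lag_lp xp_Sp. Qed.

Definition transform_term (c : R -> R) (x : R * 'rV[R]_n) (t : int) (om : Omega) : R :=
  (clamp01 x.1 ^+ Y t om - pgf F (lam t om) (clamp01 x.1)) * c (dotp x.2 (Z t om)).

Lemma transform_term_le1 c x t om : (forall z, `|c z| <= 1) -> `|transform_term c x t om| <= 1.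
Proof.
by move=> c1; rewrite normrM mulr_ile1 // pgf_gap_le1 // clamp01_bounds.
Qed.

(** The term at time [t] is one bounded path functional [Phi] evaluated at the path shifted by [t].
    The test [0 < lp s 0] gives [Phi] a value on paths with intensity [0], which [lam] never
    produces. *)
Lemma mean_ergodic_transform (c : R -> R) x : (forall z, `|c z| <= 1) -> measurable_fun setT c ->
  (\int[P]_om `|T%:R^-1 * \sum_(k < T) transform_term c x k.+1%:Z om -
     \int[P]_om transform_term c x 1 om|%:E)%E @[T --> \oo] --> 0%E.
Proof.
move=> c1 mc.
pose u := clamp01 x.1.
pose Phi (s : path_space E) : R :=
  (u ^+ np s 0 - (if 0 < lp s 0 then pgf F (lp s 0) u else 0)) * c (dotp x.2 (zp s)).
have PhiE t om : Phi (Sp t om) = transform_term c x t om.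
  rewrite /Phi /transform_term zp_Sp.
  rewrite /lp /np /Sp /path_shift /path_of /S /= add0r gtr0_norm //.
  by rewrite lam_gt0.
have mPhi : measurable_fun setT Phi.
  apply: measurable_funM.
    apply: measurable_funB; first exact: measurable_expn_nat.
    by apply: (measurable_pgf F_order) => // s; exact: clamp01_bounds.
  exact: (measurableT_comp mc (measurable_dotp (measurable_cst _) m_zp)).
have Phi1 s : `|Phi s| <= 1.
  rewrite normrM mulr_ile1 //; case: ifP => _.
    by rewrite pgf_gap_le1 // clamp01_bounds.
  have /andP[u0 u1] := clamp01_bounds x.1.
  by rewrite subr0 ger0_norm ?exprn_ge0 // exprn_ile1.
have := process_mean_ergodic mS joint_stat mPhi Phi1.
apply: cvg_trans; apply: near_eq_cvg; apply: nearW => T /=.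
apply: eq_integral => om _; congr (`|_ - _|%:E).
  by congr (_ * _); apply: eq_bigr => k _; rewrite -PhiE.
by apply: eq_Rintegral => om' _; rewrite -PhiE.
Qed.

(** * Conditioning on the past *)

Let G0 := [set A | (exists s (B : set nat), s <= 0 /\ A = Y s @^-1` B) \/
               (exists s (B : set 'rV[R]_m),
                  [/\ s <= 0, measurable B & A = X s @^-1` B])].
(** [Omega] with the past up to time [0] as its sigma-algebra: measurability with respect to the
    past becomes ordinary measurability, so the general lemmas on [zvec] and [dotp] apply to it. *)
Let T0 : measurableType _ := g_sigma_algebraType G0.

Let past0E : past Y X (1 - 1) = <<s G0 >>.
Proof. by rewrite subrr. Qed.

Let mZ1 : measurable_fun (setT : set T0) (Z 1 : T0 -> _).
Proof.
have mY0 s : s < 1 -> measurable_fun (setT : set T0) (fun om : T0 => (Y s om)%:R : R).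
  move=> s1 _ B mB; rewrite setTI; apply: sub_sigma_algebra; left.
  by exists s, [set k | B k%:R]; split => //; lia.
have mX0 : measurable_fun (setT : set T0) (X (1 - 1) : T0 -> _).
  move=> _ B mB; rewrite setTI; apply: sub_sigma_algebra; right.
  by exists (1 - 1), B; split => //; lia.
have ml0 s : s < 1 -> measurable_fun (setT : set T0) (fun om : T0 => lam s om).
  move=> s1 _ B mB; rewrite setTI.
  have := @lam_past s B mB; rewrite /past /info; apply: smallest_sub; first exact:
    smallest_sigma_algebra.
  move=> _ [[t [C [/= ts ->]]]|[t [C [/= ts mC ->]]]]; apply: sub_sigma_algebra.
    by left; exists t, C; split => //; lia.
  by right; exists t, C; split => //; lia.
exact: measurable_zvec.
Qed.

Lemma transform_mean_FA (c : R -> R) u v : (forall z, `|c z| <= 1) -> measurable_fun setT c ->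
  0 < u < 1 ->
  \int[P]_om transform_term c (u, v) 1 om =
  \int[P]_om ((pgf FA (lam 1 om) u - pgf F (lam 1 om) u) * c (dotp v (Z 1 om))).
Proof.
move=> c1 mc u01; have u01' : 0 <= u <= 1 by case/andP: u01 => /ltW -> /ltW ->.
have mpsi0 : measurable_fun (setT : set T0) (fun om : T0 => c (dotp v (Z 1 om))).
  exact: (measurableT_comp mc (measurable_dotp (measurable_cst _) mZ1)).
have G0_meas A : <<s G0 >> A -> measurable A.
  by rewrite -past0E; apply: measurable_info.
have mpsi : measurable_fun setT (fun om => c (dotp v (Z 1 om))).
  by move=> _ B mB; rewrite setTI; apply: G0_meas; have := mpsi0 measurableT B mB; rewrite setTI.
have Gpsi a : <<s G0 >> [set om | a <= c (dotp v (Z 1 om))].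
  have := mpsi0 measurableT _ (measurable_itv `[a, +oo[); rewrite setTI.
  rewrite (_ : _ @^-1` _ = [set om | a <= c (dotp v (Z 1 om))]) //.
  by apply/seteqP; split => om /=; rewrite in_itv /= andbT.
have mlam := lam_meas 1.
have mg (Q : R -> probability nat R) : stoch_order Q ->
    measurable_fun setT (fun om => pgf Q (lam 1 om) u).
  move=> oQ; have := measurable_pgf oQ mlam (measurable_cst u) (fun=> u01').
  by apply: eq_measurable_fun => om _ /=; rewrite lam_gt0.
have int1 (f : Omega -> R) : measurable_fun setT f -> (forall om, `|f om| <= 1) ->
    P.-integrable setT (EFin \o (fun om => f om * c (dotp v (Z 1 om)))).
  move=> mf f1; apply: (@bounded_integrable _ _ _ _ _ 1) => [|om].
    exact: measurable_funM.
  by rewrite normrM mulr_ile1.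
have ig (Q : R -> probability nat R) : stoch_order Q ->
    P.-integrable setT (EFin \o (fun om => pgf Q (lam 1 om) u * c (dotp v (Z 1 om)))).
  move=> oQ; apply: int1; first exact: mg.
  by move=> om; have /andP[h1 h2] := @pgf_bounds _ Q (lam 1 om) u u01'; rewrite ger0_norm.
have /andP[u0 u1] := u01'.
rewrite /transform_term /= clamp01_id //.
under eq_Rintegral do rewrite mulrBl.
under [RHS]eq_Rintegral do rewrite mulrBl.
rewrite !RintegralB //; [congr (_ - _)|exact: ig|exact: ig| |exact: ig].
  apply: (cond_pgf_integral G0_meas _ (Y_meas 1) mlam (lam_gt0 1) FA_order) => //.
    exact: (@measurableT _ T0).
  by have := @Y_law 1; rewrite past0E.
apply: int1; first by apply: measurable_expn_nat.
by move=> om; rewrite ger0_norm ?exprn_ge0 // exprn_ile1.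
Qed.

(** * Integrable Lipschitz moduli along the stationary path *)

Lemma exists_theta_box : exists delta : R, 0 < delta /\
  forall w, in_box theta0 delta w -> Theta0 w.
Proof. by have [delta d0 hd] := interior_box theta0_int; exists delta. Qed.

Let delta : R := sval (cid exists_theta_box).
Let delta_gt0 : 0 < delta. Proof. by have [] := svalP (cid exists_theta_box). Qed.
Let box_Theta0 w : in_box theta0 delta w -> Theta0 w.
Proof. by have [_] := svalP (cid exists_theta_box); exact. Qed.

Let Lr (x : path_space E) : \bar R := lip_modulus theta0 delta_gt0 kappa
  (fun th => r (lagvec p0 (yp x) 0) (lagvec q0 (lp x) 0) th).
Let Lpi (x : path_space E) : \bar R := lip_modulus theta0 delta_gt0 kappa (pi (xp x (0 - 1))).

Let mLr : measurable_fun setT Lr.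
Proof.
apply: (@measurable_lip_modulus R K0 theta0 delta delta_gt0 _ _ kappa (fun th x => r (lagvec p0
  (yp x) 0) (lagvec q0 (lp x) 0) th)).
move=> th; apply: (measurable_link r_cont) => //.
- by apply: measurable_lagvec => s _; exact: m_yp.
- by apply: measurable_lagvec => s _; exact: m_lp.
- by move=> x j; rewrite mxE.
- by move=> x j; rewrite mxE normr_ge0.
Qed.

Let mLpi : measurable_fun setT Lpi.
Proof.
apply: (@measurable_lip_modulus R K0 theta0 delta delta_gt0 _ _ kappa (fun th x => pi (xp x (0 -
  1)) th)).
by move=> th; apply: (measurable_covariate_link pi_cont).
Qed.

Let Lr_ge0 x : (0 <= Lr x)%E. Proof. exact: lip_modulus_ge0. Qed.
Let Lpi_ge0 x : (0 <= Lpi x)%E. Proof. exact: lip_modulus_ge0. Qed.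

Let Lr_stat t : (\int[P]_om Lr (Sp t om) = \int[P]_om Lr (path_of S om))%E.
Proof. by case: joint_stat => st _; exact: (stationary_integral mS t st mLr Lr_ge0). Qed.

Let Lpi_stat t : (\int[P]_om Lpi (Sp t om) = \int[P]_om Lpi (path_of S om))%E.
Proof. by case: joint_stat => st _; exact: (stationary_integral mS t st mLpi Lpi_ge0). Qed.

(** The modulus is moved to time 1, where it is below the gradient supremum of the moment
    hypothesis. Positivity of [lam] puts the arguments inside the domain of smoothness of [r]. *)
Let Lr_fin : (\int[P]_om Lr (path_of S om) < +oo)%E.
Proof.
rewrite -(Lr_stat 1); apply: le_lt_trans (r_grad 1).
apply: ge0_le_integral_upper => // om; rewrite /Lr lag_np lag_lp.
apply: lip_modulus_le_grad => // w bw i.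
have ny : nneg_row (lagvec p0 (fun s => (Y s om)%:R : R) 1) by move=> j; rewrite mxE.
have [U [_ AU hU]] := r_C3 ny.
apply: derivable_rsubmx.
have zU : U (row_mx (lagvec q0 (fun s => lam s om) 1) w).
  apply: AU => /=; rewrite row_mxKl row_mxKr; split; last exact/Theta0_sub/box_Theta0.
  by move=> j; rewrite mxE.
by have [_] := hU [::] _ zU; exact.
Qed.

Let Lpi_fin : (\int[P]_om Lpi (path_of S om) < +oo)%E.
Proof.
rewrite -(Lpi_stat 1); apply: le_lt_trans (pi_grad 1).
apply: ge0_le_integral_upper => // om; rewrite /Lpi xp_Sp.
apply: lip_modulus_le_grad => // w bw i.
have [U [_ AU hU]] := pi_C2 (X (1 - 1) om).
have wU : U w by apply/AU/Theta0_sub/box_Theta0.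
by have [_] := hU [::] _ wU; exact.
Qed.

(** * Measurability of the fitted quantities *)

Variables (y0 l0 : int -> R).
Hypotheses (y0_ge0 : forall t : int, t <= 0 -> 0 <= y0 t)
  (l0_ge0 : forall t : int, t <= 0 -> 0 <= l0 t).
Variable thhat : nat -> Omega -> 'rV[R]_K0.
Hypothesis thhat_Theta : forall T om, (0 < T)%N -> Theta (thhat T om).
Hypothesis thhat_meas : forall T, (0 < T)%N -> measurable_fun setT (thhat T).
Hypothesis thhat_cvg :
  cvg_in_prob P (fun T om => (enorm (thhat T om - theta0))%:E) 0%E.

Let lh (T : nat) (om : Omega) : int -> R :=
  lambda_hat h0 y0 l0 (thhat T om) (Y^~ om) (X^~ om).
Let Zh (T : nat) (om : Omega) : int -> 'rV[R]_n :=
  Z_hat h0 y0 l0 (thhat T om) (Y^~ om) (X^~ om).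

Let lh_ge0 T om t : 0 <= lh T om t.
Proof.
have [rho [rho01 hrho]] := exists_decay_rate q0 sum_beta_lt1.
exact: (lambda_hat_ge0 h0_gt0 rho01 hrho).
Qed.

Let lh_gt0 T om (t : nat) : 0 < lh T om t.+1%:Z.
Proof.
have [rho [rho01 hrho]] := exists_decay_rate q0 sum_beta_lt1.
exact: (lambda_hat_gt0 h0_gt0 rho01 hrho).
Qed.

Let m_counts t : measurable_fun setT (fun om => counts y0 (Y^~ om) t).
Proof.
have [t0|t0] := ltP 0 t; last first.
  rewrite (_ : (fun om => _) = cst (y0 t)) //; apply/funext => om.
  by rewrite /counts ltNge t0.
rewrite (_ : (fun om => _) = (fun om => (Y t om)%:R)); last first.
  by apply/funext => om; rewrite /counts t0.
exact: (measurableT_comp (measurable_fun_nat (fun k => k%:R : R)) (Y_meas t)).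
Qed.

Let m_lh T t : (0 < T)%N -> measurable_fun setT (fun om => lh T om t).
Proof.
move=> Tgt0.
have init s : s <= 0 -> measurable_fun setT (fun om => lh T om s).
  move=> s0; rewrite (_ : (fun om => _) = cst (l0 s)) //.
  by apply/funext => om; rewrite /lh /lambda_hat fitted_nonpos.
have [/init//|t0] := leP t 0.
suff h (k : nat) : forall t : int, t <= k%:Z -> measurable_fun setT (fun om => lh T om t).
  by apply: (h `|t|%N); lia.
elim: k => [|k IH] s sk; first exact: init.
have [|sk'] := leP s k%:Z; first exact: IH.
have -> : s = k.+1%:Z by lia.
rewrite (_ : (fun om => _) = fun om =>
  r (lagvec p0 (counts y0 (Y^~ om)) k.+1%:Z) (lagvec q0 (lh T om) k.+1%:Z) (thhat T om) +
  pi (X (k.+1%:Z - 1) om) (thhat T om)); last first.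
  apply/funext => om; rewrite /lh /lambda_hat fitted_pos h0_split // => j; rewrite mxE.
    exact: counts_ge0.
  exact: lh_ge0.
apply: measurable_funD; last by apply: (measurable_covariate_link pi_cont) => //; exact: thhat_meas.
apply: (measurable_link r_cont).
- by apply: measurable_lagvec => *; exact: m_counts.
- by apply: (measurable_lagvec (f := lh T)) => u us; apply: IH; lia.
- exact: thhat_meas.
- by move=> om j; rewrite mxE counts_ge0.
- by move=> om j; rewrite mxE lh_ge0.
Qed.

Let m_Zh T t : (0 < T)%N -> measurable_fun setT (fun om => Zh T om t).
Proof.
move=> Tgt0; apply: (measurable_zvec (y := fun om => counts y0 (Y^~ om)) (l := lh T)
  (x := fun om s => X s om)) => // s _; exact: m_lh.
Qed.

Let m_Z t : measurable_fun setT (Z t).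
Proof.
apply: (measurable_zvec (y := fun om s => (Y s om)%:R) (l := fun om s => lam s om)
  (x := fun om s => X s om)) => // s _; last exact: lam_meas.
exact: (measurableT_comp (measurable_fun_nat (fun k => k%:R : R)) (Y_meas s)).
Qed.

(** The pair [(u, v)] packed as one vector: [lebesgue_row n.+1] is then [du dv] as a single
    sigma-finite measure, and Tonelli is used on [Omega * U]. *)
Let U : measurableType _ := 'rV[R]_n.+1.
Let split (x : U) : R * 'rV[R]_n := (x 0 0, \row_j x 0 (lift 0 j)).

Let split_cons u v : split (cons_row (u, v)) = (u, v).
Proof.
rewrite /split cons_row0; congr (_, _); apply/rowP => j; by rewrite mxE cons_rowS.
Qed.

Let m_split1 : measurable_fun setT (fun x : U => (split x).1).
Proof. by apply: measurable_coord; exact: measurable_id. Qed.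

Let m_split2 : measurable_fun setT (fun x : U => (split x).2).
Proof.
apply: measurable_rowP => j; under eq_fun do rewrite mxE.
by apply: measurable_coord; exact: measurable_id.
Qed.

Section joint_measurability.
Variables (c : R -> R).
Hypotheses (c1 : forall z, `|c z| <= 1) (mc : measurable_fun setT c).

Let m_term (N : Omega -> nat) (l : Omega -> R) (z : Omega -> 'rV[R]_n) :
  measurable_fun setT N -> measurable_fun setT l -> measurable_fun setT z ->
  (forall om, 0 < l om) ->
  measurable_fun setT (fun p : Omega * U =>
    (clamp01 (split p.2).1 ^+ N p.1 - pgf F (l p.1) (clamp01 (split p.2).1)) *
    c (dotp (split p.2).2 (z p.1))).
Proof.
move=> mN ml mz l_gt0.
have mu : measurable_fun setT (fun p : Omega * U => clamp01 (split p.2).1).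
  exact: (measurableT_comp measurable_clamp01 (measurableT_comp m_split1 measurable_snd)).
apply: measurable_funM.
  apply: measurable_funB.
    by apply: measurable_expn_nat => //; exact: (measurableT_comp mN measurable_fst).
  have := measurable_pgf F_order (measurableT_comp ml measurable_fst) mu
    (fun p => clamp01_bounds _).
  by apply: eq_measurable_fun => p _ /=; rewrite l_gt0.
apply: (measurableT_comp mc); apply: measurable_dotp.
  exact: (measurableT_comp m_split2 measurable_snd).
exact: (measurableT_comp mz measurable_fst).
Qed.

Definition fitted_transform (T : nat) (om : Omega) (x : R * 'rV[R]_n) : R :=
  T%:R^-1 * \sum_(k < T) (eps_hat h0 F y0 l0 (thhat T om) (Y^~ om) (X^~ om) k.+1%:Z (clamp01 x.1) *
    c (dotp x.2 (Zh T om k.+1%:Z))).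

Definition empirical_transform (T : nat) (om : Omega) (x : R * 'rV[R]_n) : R :=
  T%:R^-1 * \sum_(k < T) transform_term c x k.+1%:Z om.

Definition limit_transform (x : R * 'rV[R]_n) : R := \int[P]_om transform_term c x 1 om.

Lemma measurable_fitted_transform T : (0 < T)%N ->
  measurable_fun setT (fun p : Omega * U => fitted_transform T p.1 (split p.2)).
Proof.
move=> Tgt0; apply: measurable_funM => //; apply: measurable_sum => k.
exact: (m_term (Y_meas _) (m_lh _ Tgt0) (m_Zh _ Tgt0) (fun om => lh_gt0 T om k)).
Qed.

Lemma measurable_transform_term t :
  measurable_fun setT (fun p : Omega * U => transform_term c (split p.2) t p.1).
Proof. exact: (m_term (Y_meas t) (lam_meas t) (m_Z t) (lam_gt0 t)). Qed.

Lemma measurable_empirical_transform T :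
  measurable_fun setT (fun p : Omega * U => empirical_transform T p.1 (split p.2)).
Proof.
apply: measurable_funM => //; apply: measurable_sum => k.
exact: measurable_transform_term.
Qed.

Lemma fitted_transform_le1 T om x : `|fitted_transform T om x| <= 1.
Proof.
apply: (@normr_mean_le1 _ _ (fun k => eps_hat h0 F y0 l0 (thhat T om) (Y^~ om) (X^~ om)
  k.+1%:Z (clamp01 x.1) * c (dotp x.2 (Zh T om k.+1%:Z)))) => k.
by rewrite normrM mulr_ile1 // pgf_gap_le1 // clamp01_bounds.
Qed.

Lemma empirical_transform_le1 T om x : `|empirical_transform T om x| <= 1.
Proof. by apply: (@normr_mean_le1 _ _ (fun k => transform_term c x k.+1%:Z om)) => k; exact:
  transform_term_le1. Qed.

Let m_term_x x t : measurable_fun setT (fun om => transform_term c x t om).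
Proof.
have -> : x = split (cons_row x) by case: x => u v; rewrite split_cons.
exact: (measurableT_comp (measurable_transform_term t) (pair2_measurable (cons_row x : U))).
Qed.

Lemma transform_term_integrable x t : P.-integrable setT (EFin \o transform_term c x t).
Proof.
exact: (@bounded_integrable _ _ _ P _ 1 (m_term_x x t) (fun om => transform_term_le1 x t om c1)).
Qed.

Lemma limit_transform_le1 x : `|limit_transform x| <= 1.
Proof.
have i1 := transform_term_integrable x 1.
apply: le_trans (le_normr_Rintegral measurableT i1) _.
have Rc : \int[P]_om (1 : R) = 1 by rewrite Rintegral_cst //= probability_setT /= mulr1.
rewrite -[leRHS]Rc; apply: le_Rintegral => //.
- exact: (integrable_norm i1).
- exact: finite_measure_integrable_cst.
- by move=> om _; exact: transform_term_le1.
Qed.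

(** Adding 1 makes the integrand nonnegative, so that the measurability part of Tonelli's theorem
    applies to its mean. *)
Lemma measurable_limit_transform : measurable_fun setT (fun x : U => limit_transform (split x)).
Proof.
have E0 (x : U) : limit_transform (split x) =
    fine (\int[P]_om (transform_term c (split x) 1 om + 1)%:E)%E - 1.
  have i1 := transform_term_integrable (split x) 1.
  have := @RintegralD _ _ _ P setT (transform_term c (split x) 1) (cst 1) measurableT i1
    (finite_measure_integrable_cst P 1 measurableT).
  rewrite /Rintegral => -> /=; rewrite -/(Rintegral _ _ _) /limit_transform.
  by rewrite -[X in _ = _ + X - _]/(\int[P]_om (1 : R)) Rintegral_cst //= probability_setT /=
    mulr1 addrK.
under eq_fun do rewrite E0.
apply: measurable_funB => //.
apply: (measurableT_comp (fine_measurable measurableT)).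
apply: (measurable_fun_fubini_tonelli_G
  (fun p : Omega * U => (transform_term c (split p.2) 1 p.1 + 1)%:E)).
  apply/measurable_EFinP; apply: measurable_funD => //; exact: measurable_transform_term.
move=> p; rewrite lee_fin; have := transform_term_le1 (split p.2) 1 p.1 c1.
by rewrite ler_norml => /andP[h _]; rewrite -lerBlDr sub0r.
Qed.

End joint_measurability.

(** * Smallness of the accumulated error *)

Let k := Num.min kappa 1.

Let k01 : 0 < k <= 1.
Proof. by rewrite /k lt_min kappa_gt0 ltr01 ge_min lexx orbT. Qed.

Let k_kappa : 0 < k <= kappa.
Proof. by rewrite /k lt_min kappa_gt0 ltr01 ge_min lexx. Qed.

Let total (T : nat) (om : Omega) : R :=
  total_error r pi y0 l0 (thhat T om) theta0 (Y^~ om) (X^~ om) (lam^~ om) k T.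

Let initial (om : Omega) : R :=
  start_error q0 l0 (lam^~ om) `^ k + \sum_(j < p0) count_error p0 y0 (Y^~ om) j `^ k.

Let m_initial : measurable_fun setT initial.
Proof.
have mp (f : Omega -> R) : measurable_fun setT f -> measurable_fun setT (fun om => f om `^ k).
  exact: (measurableT_comp (@measurable_powR R k)).
apply: measurable_funD.
  apply: mp; apply: measurable_sum => j; apply: measurableT_comp => //.
  by apply: measurable_funB => //; exact: lam_meas.
apply: measurable_sum => j; apply: mp; apply: measurable_sum => i.
apply: measurableT_comp => //; apply: measurable_funB.
  by under eq_fun do rewrite mxE; exact: m_counts.
under eq_fun do rewrite mxE.
exact: (measurableT_comp (measurable_fun_nat (fun k => k%:R : R)) (Y_meas _)).
Qed.

Let r_cont_theta (y : 'rV[R]_p0) (l : 'rV[R]_q0) (th : 'rV[R]_K0) :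
  nneg_row y -> nneg_row l -> {for th, continuous (r y l)}.
Proof.
move=> ny nl; have /subspace_continuousP h := r_cont.
have hc := h (y, l, th) (conj ny nl).
have hp : (y, l, th') @[th' --> th] --> (y, l, th) by exact: cvg_section.
move=> A nA; apply: (@filterS _ (nbhs th) _ _ _ _ (hp _ (hc A nA))) => th' hA.
exact: (hA (conj ny nl)).
Qed.

Let pi_cont_theta (x : 'rV[R]_m) (th : 'rV[R]_K0) : {for th, continuous (pi x)}.
Proof.
have hp : (x, th') @[th' --> th] --> (x, th) by exact: cvg_section.
move=> A nA; exact: (@filterS _ (nbhs th) _ _ _ _ (hp _ (@pi_cont (x, th) _ nA))).
Qed.

(** The summands 1 are those of [lip_modulus_bound], due to using the exponent [k] with moduli of
    exponent [kappa]. *)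
Let Mt (t : nat) (om : Omega) : \bar R :=
  ((1 + Lr (Sp t.+1%:Z om)) + (1 + Lpi (Sp t.+1%:Z om)))%E.

Let mSp t : measurable_fun setT (Sp t).
Proof.
exact: (measurableT_comp (@measurable_path_shift _ E t) (measurable_path_of mS)).
Qed.

Let Mt_ge0 t om : (0 <= Mt t om)%E.
Proof. by rewrite !adde_ge0. Qed.

Let mMt t : measurable_fun setT (Mt t).
Proof.
apply: emeasurable_funD; apply: emeasurable_funD => //.
  exact: (measurableT_comp mLr (mSp _)).
exact: (measurableT_comp mLpi (mSp _)).
Qed.

Let Mt_mean : exists Kc : R, 0 <= Kc /\ forall t, (\int[P]_om Mt t om = Kc%:E)%E.
Proof.
have mlr t : measurable_fun setT (fun om => Lr (Sp t.+1%:Z om)).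
  exact: (measurableT_comp mLr (mSp _)).
have mlpi t : measurable_fun setT (fun om => Lpi (Sp t.+1%:Z om)).
  exact: (measurableT_comp mLpi (mSp _)).
exists (fine ((1 + \int[P]_om Lr (path_of S om)) + (1 + \int[P]_om Lpi (path_of S om)))%E).
exact: (integral_one_plus_sum Lr_fin Lpi_fin (fun t om => Lr_ge0 _) (fun t om => Lpi_ge0 _)
  mlr mlpi (fun t => Lr_stat _) (fun t => Lpi_stat _)).
Qed.

(** The initial part is a fixed random variable divided by [T]. Once the estimator is in the box,
    the rest is at most [(K0 |thhat - theta0|) ^ k] times an average of the [Mt], whose mean does
    not depend on [T]; [K0] converts the Euclidean norm into the l1 distance. *)
Lemma total_error_small : small_in_prob P (fun T om => (T%:R^-1 * total T om)%:E).
Proof.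
pose rest (T : nat) om := T%:R^-1 * \sum_(j < T)
  (link_error_r r (thhat T om) theta0 (Y^~ om) (lam^~ om) j `^ k +
   link_error_pi pi (thhat T om) theta0 (X^~ om) j `^ k).
have -> : (fun T om => (T%:R^-1 * total T om)%:E) =
    (fun T om => ((T%:R^-1 * initial om)%:E + (rest T om)%:E)%E).
  by apply/funext => T; apply/funext => om; rewrite -EFinD /rest -mulrDr.
apply: small_in_probD; first exact: small_in_prob_const.
have [Kc [Kc0 MK]] := Mt_mean.
have /andP[k0 _] := k01.
apply: (@small_in_prob_bounded_mean _ _ _ P (fun T om => enorm (thhat T om - theta0))
  (fun T om => (T%:R^-1)%:E * \sum_(j < T) Mt j om)%E _ delta k Kc K0%:R) => //.
- by move=> T om; exact: sqrtr_ge0.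
- exists 1%N => // T /= T1; apply: measurable_enorm; apply: measurable_rowP => j.
  under eq_fun do rewrite !mxE.
  by apply: measurable_funB => //; apply: measurable_coord; exact: thhat_meas.
- move=> T; apply: measurable_funeM; exact: emeasurable_sum.
- by move=> T om; rewrite mule_ge0 ?lee_fin ?invr_ge0 // sume_ge0.
- move=> T; rewrite ge0_integralZl ?lee_fin ?invr_ge0 //; last 2 first.
  + exact: emeasurable_sum.
  + by move=> om _; exact: sume_ge0.
  rewrite ge0_integral_sum //; under eq_bigr do rewrite MK.
  rewrite sumEFin -EFinM lee_fin sumr_const card_ord.
  case: T => [|T]; first by rewrite mulr0n mulr0.
  by rewrite -[Kc *+ _]mulr_natl mulKf.
- exists 1%N => // T /= T1 om hD.
  have bth : in_box theta0 delta (thhat T om).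
    move=> j; apply: le_lt_trans hD.
    by have := normr_coord_le_enorm (thhat T om - theta0) j; rewrite !mxE.
  set D := enorm _ in hD *.
  have dD : l1dist (thhat T om) theta0 `^ k <= (K0%:R * D) `^ k.
    apply: ge0_ler_powR; rewrite ?nnegrE ?(ltW k0) ?l1dist_ge0 ?mulr_ge0 ?sqrtr_ge0 //.
    exact: l1dist_le_enorm.
  have bound (f : 'rV[R]_K0 -> R) : {for thhat T om, continuous f} ->
      ((`|f (thhat T om) - f theta0| `^ k)%:E <=
       ((K0%:R * D) `^ k)%:E * (1 + lip_modulus theta0 delta_gt0 kappa f))%E.
    move=> cf; apply: le_trans (lip_modulus_bound delta_gt0 k_kappa bth cf) _.
    by apply: lee_wpmul2r; [rewrite adde_ge0 // lip_modulus_ge0|rewrite lee_fin].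
  rewrite /rest EFinM muleCA; apply: lee_wpmul2l; first by rewrite lee_fin invr_ge0.
  rewrite -sumEFin ge0_sume_distrr //; apply: lee_sum => j _.
  rewrite EFinD /Mt ge0_muleDr ?adde_ge0 //; apply: leeD.
    rewrite /Lr lag_np lag_lp; apply: bound; apply: r_cont_theta => i; rewrite mxE //.
    exact: ltW.
  by rewrite /Lpi xp_Sp; apply: bound; exact: pi_cont_theta.
Qed.

(** * Integration against the weight *)

Variables (w : R -> R) (omega : 'rV[R]_n -> R).
Hypotheses (w_meas : measurable_fun `]0 : R, 1 : R[%classic w)
  (omega_meas : measurable_fun setT omega).
Hypotheses (w_gt0 : forall u : R, 0 < u < 1 -> 0 < w u) (omega_gt0 : forall v, 0 < omega v).
Hypothesis omega_sym : forall v, omega v = omega (- v).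
Hypothesis w_int : (\int[lebesgue_measure]_(u in `]0%R, 1%R[) (w u)%:E < +oo)%E.
Hypothesis omega_int : forall j : nat, (j <= 1)%N ->
  (\int[lebesgue_row n]_v (enorm v ^+ j * omega v)%:E < +oo)%E.

Let w01 : R -> R := w \_ `]0 : R, 1 : R[%classic.

Let w01E u : w01 u = if 0 < u < 1 then w u else 0.
Proof.
rewrite /w01 patchE; have -> : (u \in `]0 : R, 1 : R[%classic) = (0 < u < 1) by rewrite mem_setE
  in_itv.
by [].
Qed.

Let m_w01 : measurable_fun setT w01.
Proof. by apply/(measurable_restrict _ _ measurableT) => //; rewrite setTI. Qed.

Let w01_ge0 u : 0 <= w01 u.
Proof. by rewrite w01E; case: ifP => // /w_gt0 /ltW. Qed.

Let Wt (x : U) : R := w01 (split x).1 * omega (split x).2.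

Let mWt : measurable_fun setT Wt.
Proof.
apply: measurable_funM; first exact: (measurableT_comp m_w01 m_split1).
exact: (measurableT_comp omega_meas m_split2).
Qed.

Let Wt_ge0 x : 0 <= Wt x.
Proof. by rewrite mulr_ge0 // ltW. Qed.

(** The zero extension of [w] turns the integral over [(0, 1)] into one over the line, so [H] and
    [G] have to match only for [u] in [(0, 1)]. This is where clamping becomes invisible. *)
Lemma iterated_integral (G : R * 'rV[R]_n -> R) (H : R -> 'rV[R]_n -> R) :
  measurable_fun setT (fun x : U => G (split x)) -> (forall x, 0 <= G x) ->
  (forall u v, 0 < u < 1 -> H u v = G (u, v) * (w u * omega v)) ->
  (\int[lebesgue_measure]_(u in `]0%R, 1%R[) \int[lebesgue_row n]_v (H u v)%:E =
   \int[lebesgue_row n.+1]_x (G (split x) * Wt x)%:E)%E.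
Proof.
move=> mG Gge0 HG.
rewrite [RHS]/= integral_lebesgue_cons; last 2 first.
- by apply/measurable_EFinP; exact: measurable_funM.
- by move=> x; rewrite lee_fin mulr_ge0.
rewrite integral_mkcond; apply: eq_integral => u _.
have uE : (u \in `]0 : R, 1 : R[%classic) = (0 < u < 1) by rewrite mem_setE in_itv.
rewrite patchE uE; case: ifPn => u01.
  by apply: eq_integral => v _; rewrite /Wt split_cons /= w01E u01 HG.
rewrite integral0_eq // => v _.
by rewrite /Wt split_cons /= w01E (negbTE u01) mul0r mulr0.
Qed.

Let weight_integral_lt_pinfty (g : 'rV[R]_n -> R) : measurable_fun setT g ->
  (forall v, 0 <= g v) -> (\int[lebesgue_row n]_v (g v * omega v)%:E < +oo)%E ->
  (\int[lebesgue_row n.+1]_x (g (split x).2 * Wt x)%:E < +oo)%E.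
Proof.
move=> mg g0 gfin.
rewrite -(@iterated_integral (fun x => g x.2) (fun u v => g v * (w u * omega v))) //; last first.
  exact: (measurableT_comp mg m_split2).
have I0 : (0 <= \int[lebesgue_row n]_v (g v * omega v)%:E)%E.
  by apply: integral_ge0 => v _; rewrite lee_fin mulr_ge0 // ltW.
have mgo : measurable_fun setT (fun v => (g v * omega v)%:E).
  by apply/measurable_EFinP; exact: measurable_funM.
under eq_integral => u.
  rewrite inE /= in_itv /= => u01.
  under eq_integral do rewrite mulrCA EFinM.
  rewrite ge0_integralZl //; last 2 first.
    by move=> v _; rewrite lee_fin mulr_ge0 // ltW.
    by rewrite lee_fin ltW // w_gt0.
  over.
rewrite ge0_integralZr //; last 2 first.
- exact/measurable_EFinP.
- by move=> u /=; rewrite in_itv /= => u01; rewrite lee_fin ltW // w_gt0.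
apply: lte_mul_pinfty => //.
  by apply: integral_ge0 => u /=; rewrite in_itv /= => u01; rewrite lee_fin ltW // w_gt0.
rewrite ge0_fin_numE //.
by apply: integral_ge0 => u /=; rewrite in_itv /= => u01; rewrite lee_fin ltW // w_gt0.
Qed.

Let omega_fin : (\int[lebesgue_row n]_v (1 * omega v)%:E < +oo)%E.
Proof. exact: (@omega_int 0%N isT). Qed.

Let Wt_fin : (\int[lebesgue_row n.+1]_x (Wt x)%:E < +oo)%E.
Proof.
have := weight_integral_lt_pinfty (measurable_cst (1 : R)) (fun=> ler01) omega_fin.
by under eq_integral do rewrite /= mul1r.
Qed.

Let m_enorm : measurable_fun setT (@enorm R n).
Proof. by apply: measurable_enorm; exact: measurable_id. Qed.

Let growth_fin : (\int[lebesgue_row n.+1]_x ((1 + enorm (split x).2) * Wt x)%:E < +oo)%E.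
Proof.
have e0 v : 0 <= @enorm R n v by exact: sqrtr_ge0.
apply: (weight_integral_lt_pinfty (g := fun v => 1 + enorm v)) => //.
- exact: measurable_funD.
- by move=> v; rewrite addr_ge0.
under eq_integral do rewrite mulrDl EFinD.
rewrite ge0_integralD //; last 4 first.
- by move=> v _; rewrite lee_fin mul1r ltW.
- by apply/measurable_EFinP; apply: measurable_funM.
- by move=> v _; rewrite lee_fin mulr_ge0 // ltW.
- by apply/measurable_EFinP; apply: measurable_funM.
by rewrite lte_add_pinfty //; exact: (@omega_int 1%N isT).
Qed.

Variable M1 : R.
Hypothesis M1_ge0 : 0 <= M1.
Hypothesis pgf_lip : forall u l : R, 0 <= u <= 1 -> 0 < l ->
  derivable (fun l' => pgf F l' u) l 1 /\ `| derive1 (fun l' => pgf F l' u) l | <= M1.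

(** The empirical transform at the true intensities lies in between. Its distance to the limit is
    small by the mean ergodic theorem; the fitted transform differs from it by the total error times
    a factor whose weighted integral is [er * CW]. *)
Lemma fitted_transform_small (c : R -> R) : (forall z, `|c z| <= 1) ->
  (forall z z', `|c z - c z'| <= `|z - z'|) -> measurable_fun setT c ->
  small_in_prob P (fun T om => \int[lebesgue_row n.+1]_x
    (`|fitted_transform c T om (split x) - limit_transform c (split x)| * Wt x)%:E)%E.
Proof.
move=> c1 c_lip mc.
have [rho [rho01 hrho]] := exists_decay_rate q0 sum_beta_lt1.
have [alpha0 beta0] := lipschitz_weights_ge0.
set CW := (\int[lebesgue_row n.+1]_x ((1 + enorm (split x).2) * Wt x)%:E)%E.
have CW0 : (0 <= CW)%E.
  by apply: integral_ge0 => x _; rewrite lee_fin mulr_ge0 // addr_ge0 // sqrtr_ge0.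
have CWf : CW \is a fin_num by rewrite ge0_fin_numE.
pose er := error_rate q0 rho k M1.
have er0 : 0 <= er := error_rate_ge0 q0 rho01 k01 M1.
have total0 T om : 0 <= total T om.
  rewrite /total /total_error !addr_ge0 ?powR_ge0 ?sumr_ge0 // => j _; rewrite ?addr_ge0
    ?powR_ge0 //.
have s1 : small_in_prob P (fun T om => (fine CW * er)%:E * (T%:R^-1 * total T om)%:E)%E.
  apply: small_in_probZ; [by rewrite mulr_ge0 // fine_ge0| |exact: total_error_small].
  by move=> T om; rewrite lee_fin mulr_ge0 ?invr_ge0.
have s2 : small_in_prob P (fun T om => \int[lebesgue_row n.+1]_x
    (`|empirical_transform c T om (split x) - limit_transform c (split x)| * Wt x)%:E)%E.
  apply: (@small_weighted_l1 _ _ _ P _ _ (lebesgue_row n.+1) Wt mWt Wt_ge0 Wt_fin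
    (fun T p => empirical_transform c T p.1 (split p.2) - limit_transform c (split p.2)) 2).
  - move=> T; apply: measurable_funB; first exact: measurable_empirical_transform.
    exact: (measurableT_comp (measurable_limit_transform c1 mc) measurable_snd).
  - move=> T p; apply: le_trans (ler_normB _ _) _.
    by rewrite (_ : 2 = 1 + 1) // lerD // ?empirical_transform_le1 ?limit_transform_le1.
  - by move=> x; exact: (mean_ergodic_transform (split x) c1 mc).
have s12 := small_in_probD s1 s2.
(* Each time has its own null set for the recursion; countably many times leave a common one, off
   which the pathwise comparison is run. *)
have /ae_foralln[N [mN PN hN]] := fun t : nat => @lam_rec t.+1%:Z.
have negN : P.-negligible N by exists N; split.
apply: (small_in_prob_le negN s12).
exists 1%N => // T /= T1 om nN.
have {}hN : forall t : nat, lam t.+1%:Z om =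
    r (lagvec p0 (fun s => (Y s om)%:R) t.+1%:Z) (lagvec q0 (fun s => lam s om) t.+1%:Z) theta0 +
    pi (X (t.+1%:Z - 1) om) theta0.
  by apply: contrapT => h; apply: nN; apply: hN => /= h'; apply: h.
have msec (f : Omega * U -> R) : measurable_fun setT f ->
    measurable_fun setT (fun x : U => f (om, x)).
  by move=> mf; exact: (measurableT_comp mf (pair1_measurable om)).
have mfT : measurable_fun setT (fun x : U => fitted_transform c T om (split x)).
  by apply: (msec (fun p => fitted_transform c T p.1 (split p.2))); exact:
    measurable_fitted_transform.
have mf0 : measurable_fun setT (fun x : U => empirical_transform c T om (split x)).
  by apply: (msec (fun p => empirical_transform c T p.1 (split p.2))); exact:
    measurable_empirical_transform.
have mfl := measurable_limit_transform c1 mc.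
have mabs (f g : U -> R) : measurable_fun setT f -> measurable_fun setT g ->
    measurable_fun setT (fun x => (`|f x - g x| * Wt x)%:E).
  move=> mf mg; apply/measurable_EFinP; apply: measurable_funM => //.
  by apply: measurableT_comp => //; exact: measurable_funB.
apply: (@le_trans _ _ (\int[lebesgue_row n.+1]_x
   ((`|fitted_transform c T om (split x) - empirical_transform c T om (split x)| * Wt x)%:E +
    (`|empirical_transform c T om (split x) - limit_transform c (split x)| * Wt x)%:E))%E).
  apply: ge0_le_integral => //.
  - by move=> x _; rewrite lee_fin mulr_ge0.
  - exact: mabs.
  - by apply: emeasurable_funD; exact: mabs.
  move=> x _; rewrite -EFinD lee_fin -mulrDl; apply: ler_wpM2r => //.
  exact: ler_distD.
rewrite ge0_integralD //; last 4 first.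
- by move=> x _; rewrite lee_fin mulr_ge0.
- exact: mabs.
- by move=> x _; rewrite lee_fin mulr_ge0.
- exact: mabs.
apply: leeD => //.
have -> : ((fine CW * er)%:E * (T%:R^-1 * total T om)%:E =
    (er * (T%:R^-1 * total T om))%:E * CW)%E.
  by rewrite -[in RHS](fineK CWf) -!EFinM; congr EFin; ring.
rewrite -ge0_integralZl //; last 3 first.
- by apply/measurable_EFinP; apply: measurable_funM => //; apply: measurable_funD => //;
    exact: (measurableT_comp m_enorm m_split2).
- by move=> x _; rewrite lee_fin mulr_ge0 // addr_ge0 // sqrtr_ge0.
- by rewrite lee_fin mulr_ge0 // mulr_ge0 // invr_ge0.
apply: ge0_le_integral => //.
- by move=> x _; rewrite lee_fin mulr_ge0.
- exact: mabs.
- apply: measurable_funeM; apply/measurable_EFinP; apply: measurable_funM => //.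
  by apply: measurable_funD => //; exact: (measurableT_comp m_enorm m_split2).
move=> x _; rewrite -EFinM lee_fin [leRHS]mulrA; apply: ler_wpM2r => //.
rewrite mulrC.
exact: (empirical_transform_diff h0_gt0 h0_split lipschitz_weights_le1 beta0 rho01 hrho
  y0_ge0 l0_ge0 (fun y1 y2 l1 l2 => r_lip (thhat_Theta om T1)) (fun t => lam_gt0 t om) hN k01
  M1_ge0 pgf_lip c1 c_lip T (split x).2 (clamp01_bounds _)).
Qed.

(** * Identification of the limit and conclusion *)

Let dotpC (a b : 'rV[R]_n) : dotp a b = dotp b a.
Proof. by apply: eq_bigr => i _; rewrite mulrC. Qed.

Let dotpNl (a b : 'rV[R]_n) : dotp (- a) b = - dotp a b.
Proof. by rewrite /dotp -sumrN; apply: eq_bigr => i _; rewrite mxE mulNr. Qed.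

Lemma gap_integrable (c : R -> R) (u : R) v : (forall z, `|c z| <= 1) -> measurable_fun setT c ->
  0 <= u <= 1 ->
  P.-integrable setT (EFin \o (fun om =>
    (pgf FA (lam 1 om) u - pgf F (lam 1 om) u) * c (dotp v (Z 1 om)))).
Proof.
move=> c1 mc u01.
have mg (Q : R -> probability nat R) : stoch_order Q ->
    measurable_fun setT (fun om => pgf Q (lam 1 om) u).
  move=> oQ; have := measurable_pgf oQ (lam_meas 1) (measurable_cst u) (fun=> u01).
  by apply: eq_measurable_fun => om _ /=; rewrite lam_gt0.
apply: (@bounded_integrable _ _ _ P _ 1) => [|om].
  apply: measurable_funM; first by apply: measurable_funB; exact: mg.
  exact: (measurableT_comp mc (measurable_dotp (measurable_cst v) (m_Z 1))).
have /andP[a0 a1] := @pgf_bounds _ FA (lam 1 om) u u01.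
have /andP[b0 b1] := @pgf_bounds _ F (lam 1 om) u u01.
by rewrite normrM mulr_ile1 // ler_norml; apply/andP; split; lra.
Qed.

Let zeta (u : R) (v : 'rV[R]_n) : R :=
  fine 'E_P[fun om => (pgf FA (lam 1 om) u - pgf F (lam 1 om) u) * alpha_fun (Z 1 om) v].

Lemma zeta_limit_transform u v : 0 < u < 1 ->
  zeta u v = limit_transform cos (u, v) + limit_transform sin (u, v).
Proof.
move=> u01; have u01' : 0 <= u <= 1 by case/andP: u01 => /ltW -> /ltW ->.
rewrite /zeta unlock /limit_transform.
rewrite (transform_mean_FA v (@cos_max R) (@measurable_cos R) u01).
rewrite (transform_mean_FA v (@sin_max R) (@measurable_sin R) u01).
rewrite -RintegralD //; last 2 first.
- exact: (gap_integrable v (@cos_max R) (@measurable_cos R) u01').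
- exact: (gap_integrable v (@sin_max R) (@measurable_sin R) u01').
by apply: eq_Rintegral => om _; rewrite /alpha_fun dotpC mulrDr.
Qed.

Lemma limit_transform_cosN u v : limit_transform cos (u, - v) = limit_transform cos (u, v).
Proof. by apply: eq_Rintegral => om _; rewrite /transform_term /= dotpNl cosN. Qed.

Lemma limit_transform_sinN u v : limit_transform sin (u, - v) = - limit_transform sin (u, v).
Proof.
rewrite -mulN1r -RintegralZl //; last first.
  exact: (transform_term_integrable (@sin_max R) (@measurable_sin R)).
by apply: eq_Rintegral => om _; rewrite /transform_term /= dotpNl sinN mulrN mulN1r.
Qed.

Variable W : R -> 'rV[R]_n -> R.
Hypothesis W_def : forall (u : R) v, 0 < u < 1 -> W u v = w u * omega v.

Let m_sqr (f g : U -> R) : measurable_fun setT f -> measurable_fun setT g ->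
  measurable_fun setT (fun x => f x ^+ 2 + g x ^+ 2).
Proof. by move=> mf mg; apply: measurable_funD; exact: measurable_funX. Qed.

Let mlim_cos := measurable_limit_transform (@cos_max R) (@measurable_cos R).
Let mlim_sin := measurable_limit_transform (@sin_max R) (@measurable_sin R).

Lemma limit_integral :
  (\int[lebesgue_measure]_(u in `]0%R, 1%R[) \int[lebesgue_row n]_v (zeta u v ^+ 2 * W u v)%:E =
   \int[lebesgue_row n.+1]_x
     ((limit_transform cos (split x) ^+ 2 + limit_transform sin (split x) ^+ 2) * Wt x)%:E)%E.
Proof.
rewrite -(@iterated_integral
  (fun x => limit_transform cos x ^+ 2 + limit_transform sin x ^+ 2)
  (fun u v => (limit_transform cos (u, v) ^+ 2 + limit_transform sin (u, v) ^+ 2) *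
     (w u * omega v))) //; last 2 first.
- by apply: m_sqr.
- by move=> x; rewrite addr_ge0 // sqr_ge0.
apply: eq_integral => u; rewrite inE /= in_itv /= => u01.
have msec (c : R -> R) : (forall z, `|c z| <= 1) -> measurable_fun setT c ->
    measurable_fun setT (fun v => limit_transform c (u, v)).
  move=> c1 mc.
  have := measurableT_comp (measurable_limit_transform c1 mc)
    (measurableT_comp (@measurable_cons_row R n) (pair1_measurable u)).
  by apply: eq_measurable_fun => v _ /=; rewrite split_cons.
rewrite -integral_even_odd_sqr.
- by apply: eq_integral => v _; rewrite zeta_limit_transform // W_def.
- exact: (msec _ (@cos_max R) (@measurable_cos R)).
- exact: (msec _ (@sin_max R) (@measurable_sin R)).
- by apply: measurable_funM.
- by move=> v; exact: limit_transform_cosN.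
- by move=> v; exact: limit_transform_sinN.
- by move=> v; rewrite -omega_sym.
- by move=> v; rewrite mulr_ge0 // ltW // w_gt0.
Qed.

Lemma statistic_integral T om : (0 < T)%N ->
  ((T%:R^-1)%:E * Delta_stat h0 F W y0 l0 (thhat T om) (Y^~ om) (X^~ om) T =
   \int[lebesgue_row n.+1]_x ((fitted_transform cos T om (split x) ^+ 2 +
     fitted_transform sin T om (split x) ^+ 2) * Wt x)%:E)%E.
Proof.
move=> Tgt0; rewrite /Delta_stat muleA -EFinM mulVf ?pnatr_eq0 -?lt0n // mul1e.
have msec (c : R -> R) : (forall z, `|c z| <= 1) -> measurable_fun setT c ->
    measurable_fun setT (fun x : U => fitted_transform c T om (split x)).
  move=> c1 mc.
  have mp : measurable_fun setT (fun p : Omega * U => fitted_transform c T p.1 (split p.2)).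
    exact: measurable_fitted_transform.
  exact: (measurableT_comp mp (pair1_measurable om)).
apply: (@iterated_integral
  (fun x => fitted_transform cos T om x ^+ 2 + fitted_transform sin T om x ^+ 2)).
- apply: m_sqr; first exact: (msec _ (@cos_max R) (@measurable_cos R)).
  exact: (msec _ (@sin_max R) (@measurable_sin R)).
- by move=> x; rewrite addr_ge0 // sqr_ge0.
by move=> u v u01; rewrite normc_D_stat W_def // /fitted_transform /= clamp01_id.
Qed.

Lemma statistic_cvg_in_prob :
  cvg_in_prob P (fun T om =>
    ((T%:R^-1)%:E * Delta_stat h0 F W y0 l0 (thhat T om) (Y^~ om) (X^~ om) T)%E)
   (\int[lebesgue_measure]_(u in `]0%R, 1%R[)
      \int[lebesgue_row n]_v (zeta u v ^+ 2 * W u v)%:E)%E.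
Proof.
have mfit (c : R -> R) T : (forall z, `|c z| <= 1) -> measurable_fun setT c -> (0 < T)%N ->
    measurable_fun setT (fun p : Omega * U => fitted_transform c T p.1 (split p.2)).
  by move=> c1 mc T1; exact: measurable_fitted_transform.
have msec (c : R -> R) T om : (forall z, `|c z| <= 1) -> measurable_fun setT c -> (0 < T)%N ->
    measurable_fun setT (fun x : U => fitted_transform c T om (split x)).
  by move=> c1 mc T1; exact: (measurableT_comp (mfit _ _ c1 mc T1) (pair1_measurable om)).
rewrite limit_integral; apply: small_cvg_in_prob.
- exists 1%N => // T /= T1.
  under eq_fun do rewrite statistic_integral //.
  apply: (@measurable_fun_fubini_tonelli_F _ _ Omega U R (lebesgue_row n.+1)
    (fun p => ((fitted_transform cos T p.1 (split p.2) ^+ 2 +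
      fitted_transform sin T p.1 (split p.2) ^+ 2) * Wt p.2)%:E)).
    apply/measurable_EFinP; apply: measurable_funM; last exact: (measurableT_comp mWt
      measurable_snd).
    apply: measurable_funD; apply: measurable_funX.
      exact: (mfit _ _ (@cos_max R) (@measurable_cos R) T1).
    exact: (mfit _ _ (@sin_max R) (@measurable_sin R) T1).
  by move=> p; rewrite lee_fin mulr_ge0 // addr_ge0 // sqr_ge0.
- apply: integrable_fin_num => //.
  apply: (weighted_integrable mWt Wt_ge0 Wt_fin (C := 2)); first exact: m_sqr.
  move=> x; rewrite ger0_norm ?addr_ge0 ?sqr_ge0 // (_ : 2 = 1 + 1) //.
  have sq1 (z : R) : `|z| <= 1 -> z ^+ 2 <= 1.
    by move=> z1; rewrite -real_normK ?num_real // exprn_ile1.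
  apply: lerD; apply: sq1.
    exact: (limit_transform_le1 (@cos_max R) (@measurable_cos R)).
  exact: (limit_transform_le1 (@sin_max R) (@measurable_sin R)).
have s1 := fitted_transform_small (@cos_max R) (@cos_lipschitz R) (@measurable_cos R).
have s2 := fitted_transform_small (@sin_max R) (@sin_lipschitz R) (@measurable_sin R).
have pos (c : R -> R) T om : (0 <= \int[lebesgue_row n.+1]_x
    (`|fitted_transform c T om (split x) - limit_transform c (split x)| * Wt x)%:E)%E.
  by apply: integral_ge0 => x _; rewrite lee_fin mulr_ge0.
(* The factor 2 is that of [integral_sqr_diff_le], with the cosine and sine parts together. *)
have s12 := small_in_probZ (ler0n R 2) (fun T om => adde_ge0 (pos cos T om) (pos sin T om))
  (small_in_probD s1 s2).
apply: (small_in_prob_le (negligible_set0 P) s12).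
exists 1%N => // T /= T1 om _; rewrite statistic_integral //.
apply: (integral_sqr_diff_le mWt Wt_ge0 Wt_fin).
- exact: (msec _ _ _ (@cos_max R) (@measurable_cos R) T1).
- exact: (msec _ _ _ (@sin_max R) (@measurable_sin R) T1).
- exact: mlim_cos.
- exact: mlim_sin.
- by move=> x; apply: fitted_transform_le1; exact: cos_max.
- by move=> x; apply: fitted_transform_le1; exact: sin_max.
- by move=> x; exact: (limit_transform_le1 (@cos_max R) (@measurable_cos R)).
- by move=> x; exact: (limit_transform_le1 (@sin_max R) (@measurable_sin R)).
Qed.

End goodness_of_fit.

Theorem theorem4p3 (R : realType)
  (dO : measure_display) (Omega : measurableType dO) (P : probability Omega R)
  (p0 q0 m K0 : nat)
  (p0_ge1 : (1 <= p0)%N) (m_ge1 : (1 <= m)%N) (K0_ge1 : (1 <= K0)%N)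
  (* hypothesized and true families *)
  (F FA : R -> probability nat R)
  (F_mean : mean_param F) (FA_mean : mean_param FA)
  (F_order : stoch_order F) (FA_order : stoch_order FA)
  (F_neq_FA : exists (l : R) (B : set nat), 0 < l /\ F l B <> FA l B)
  (* (1) *)
  (c_h : R) (c_h_gt0 : 0 < c_h)
  (h0 : 'rV[R]_(p0 + q0 + m) -> 'rV[R]_K0 -> R)
  (r : 'rV[R]_p0 -> 'rV[R]_q0 -> 'rV[R]_K0 -> R)
  (pi : 'rV[R]_m -> 'rV[R]_K0 -> R)
  (h0_range : forall y l x th, nneg_row y -> nneg_row l ->
     c_h < h0 (row_mx (row_mx y l) x) th)
  (h0_split : forall y l x th, nneg_row y -> nneg_row l ->
     h0 (row_mx (row_mx y l) x) th = r y l th + pi x th)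
  (r_range : forall y l th, nneg_row y -> nneg_row l -> 0 < r y l th)
  (pi_range : forall x th, 0 < pi x th)
  (r_cont : {within
     [set z : 'rV[R]_p0 * 'rV[R]_q0 * 'rV[R]_K0 |
        nneg_row z.1.1 /\ nneg_row z.1.2],
     continuous (fun z => r z.1.1 z.1.2 z.2)})
  (pi_cont : continuous (fun z : 'rV[R]_m * 'rV[R]_K0 => pi z.1 z.2))
  (Theta : set 'rV[R]_K0)
  (alpha : 'I_p0 -> R) (beta : 'I_q0 -> R)
  (contraction : \sum_(i < p0) alpha i + \sum_(j < q0) beta j < 1)
  (r_lip : forall th y1 y2 l1 l2, Theta th ->
     nneg_row y1 -> nneg_row y2 -> nneg_row l1 -> nneg_row l2 ->
     `|r y1 l1 th - r y2 l2 th| <=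
       \sum_(i < p0) alpha i * `|y1 0 i - y2 0 i| +
       \sum_(j < q0) beta j * `|l1 0 j - l2 0 j|)
  (* (2) *)
  (Y : int -> Omega -> nat) (X : int -> Omega -> 'rV[R]_m)
  (Y_meas : forall t, measurable_fun setT (Y t))
  (X_meas : forall t, measurable_fun setT (X t))
  (X_stat : stationary_ergodic P X)
  (Theta0 : set 'rV[R]_K0) (theta0 : 'rV[R]_K0)
  (Theta0_compact : compact Theta0) (Theta0_sub : Theta0 `<=` Theta)
  (theta0_int : interior Theta0 theta0)
  (* lam th t is the stationary sequence lambda_t(th); lambda_t = lam theta0 t *)
  (lam : 'rV[R]_K0 -> int -> Omega -> R)
  (lam_gt0 : forall th t om, Theta th -> 0 < lam th t om)
  (lam_past : forall th (t : int), Theta th ->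
     measurable_wrt (past Y X (t - 1)) (lam th t))
  (lam_stat : forall th, Theta th -> strictly_stationary P (lam th))
  (lam_rec : forall th (t : int), Theta th ->
     {ae P, forall om, lam th t om =
        r (lagvec p0 (fun s => (Y s om)%:R) t) (lagvec q0 (fun s => lam th s om) t)
          th + pi (X (t - 1) om) th})
  (Z : int -> Omega -> 'rV[R]_(p0 + q0 + m))
  (Z_def : forall t om, Z t om =
     zvec p0 q0 (fun s => (Y s om)%:R) (fun s => lam theta0 s om)
       (fun s => X s om) t)
  (joint_stat : stationary_ergodic P
     (fun t om => (Y t om, lam theta0 t om, X t om)))
  (Y_law : forall t : int,
     cond_law P (past Y X (t - 1)) (Y t) (fun om => FA (lam theta0 t om)))
  (lam_link : forall t, {ae P, forall om, lam theta0 t om = h0 (Z t om) theta0})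
  (Z_moment : forall t, (\int[P]_om (enorm (Z t om) ^+ 2)%:E < +oo)%E)
  (* (3) *)
  (r_C3 : forall y, nneg_row y ->
     Ck 3 [set z : 'rV[R]_(q0 + K0) | pos_row (lsubmx z) /\ Theta (rsubmx z)]
       (fun z => r y (lsubmx z) (rsubmx z)))
  (dl : 'rV[R]_K0 -> 'rV[R]_q0)
  (r_dl : forall y l th, nneg_row y -> pos_row l -> Theta th ->
     grad (fun l' => r y l' th) l = dl th)
  (rho_lt1 : (ereal_sup [set (spectral_radius (companion (dl th)))%:E |
                           th in Theta0] < 1)%E)
  (pi_C2 : forall x, Ck 2 Theta (pi x))
  (kappa : R) (kappa_gt0 : 0 < kappa)
  (pi_grad : forall t : int, (\int[P]_om ereal_sup
     [set (enorm (grad (pi (X (t - 1) om)) th) `^ kappa)%:E | th in Theta0]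
       < +oo)%E)
  (r_grad : forall t, (\int[P]_om ereal_sup
     [set (enorm (grad (r (lagvec p0 (fun s => (Y s om)%:R) t)
                          (lagvec q0 (fun s => lam theta0 s om) t)) th)
             `^ kappa)%:E | th in Theta0]
       < +oo)%E)
  (* (4) *)
  (lam_C2 : forall t,
     {ae P, forall om, Ck 2 (interior Theta) (fun th => lam th t om)})
  (V : set 'rV[R]_K0) (V_nbhs : open_nbhs theta0 V) (V_sub : V `<=` Theta)
  (lam_d1 : forall t i j, (\int[P]_om ereal_sup
     [set `|partial i (fun th' => lam th' t om) th *
            partial j (fun th' => lam th' t om) th|%:E | th in V] < +oo)%E)
  (lam_d2 : forall t i j, (\int[P]_om ereal_sup
     [set `|partial i (partial j (fun th' => lam th' t om)) th|%:E | th in V]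
       < +oo)%E)
  (H : R -> R) (H_gt0 : forall z : R, 0 < z -> 0 < H z)
  (H_bound : forall u z : R, 0 < u < 1 -> 0 < z ->
     [/\ derivable (pgf F z) u 1,
         derivable (fun z' => derive1 (pgf F z') u) z 1 &
         `| derive1 (fun z' => derive1 (pgf F z') u) z | <= H z])
  (H_moment : forall t,
     P.-integrable setT (fun om => (H (lam theta0 t om) ^+ 2)%:E))
  (* (5) *)
  (w : R -> R) (omega : 'rV[R]_(p0 + q0 + m) -> R)
  (W : R -> 'rV[R]_(p0 + q0 + m) -> R)
  (W_def : forall (u : R) v, 0 < u < 1 -> W u v = w u * omega v)
  (w_meas : measurable_fun `]0 : R, 1 : R[%classic w) (omega_meas : measurable_fun setT omega)
  (w_gt0 : forall u : R, 0 < u < 1 -> 0 < w u) (omega_gt0 : forall v, 0 < omega v)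
  (omega_sym : forall v, omega v = omega (- v))
  (w_int : (0 < \int[lebesgue_measure]_(u in `]0%R, 1%R[) (w u)%:E < +oo)%E)
  (omega_int : forall k : nat, (k <= 4)%N ->
     (0 < \int[lebesgue_row (p0 + q0 + m)]_v (enorm v ^+ k * omega v)%:E
        < +oo)%E)
  (* (6) *)
  (M1 : R) (M1_gt0 : 0 < M1)
  (pgf_lip : forall u l : R, 0 <= u <= 1 -> 0 < l ->
     derivable (fun l' => pgf F l' u) l 1 /\
     `| derive1 (fun l' => pgf F l' u) l | < M1)
  (* (7): the estimator is a function of (Y_t, X_{t-1}), t = 1..T *)
  (thhat : nat -> Omega -> 'rV[R]_K0)
  (thhat_Theta : forall T om, (0 < T)%N -> Theta (thhat T om))
  (thhat_data : forall T : nat, (0 < T)%N ->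
     measurable_wrt (info Y X [set s : int | 1 <= s <= T%:Z]
                              [set s : int | 0 <= s <= T%:Z - 1]) (thhat T))
  (thhat_cvg : cvg_in_prob P
     (fun T om => (enorm (thhat T om - theta0))%:E) 0%E)
  (* initial values, used at times t <= 0 *)
  (y0 l0 : int -> R)
  (y0_ge0 : forall t : int, t <= 0 -> 0 <= y0 t)
  (l0_ge0 : forall t : int, t <= 0 -> 0 <= l0 t) :
  let Delta (T : nat) (om : Omega) : \bar R :=
    Delta_stat h0 F W y0 l0 (thhat T om)
      (fun t => Y t om) (fun t => X t om) T in
  let zeta (u : R) (v : 'rV[R]_(p0 + q0 + m)) : R :=
    fine 'E_P[fun om => (pgf FA (lam theta0 1 om) u - pgf F (lam theta0 1 om) u) *
                        alpha_fun (Z 1 om) v] in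
  cvg_in_prob P (fun T om => ((T%:R^-1)%:E * Delta T om)%E)
    (\int[lebesgue_measure]_(u in `]0%R, 1%R[)
       \int[lebesgue_row (p0 + q0 + m)]_v (zeta u v ^+ 2 * W u v)%:E)%E.
Proof.
have Theta_theta0 : Theta theta0 := Theta0_sub _ (interior_subset theta0_int).
have h0_gt0 y l x th : nneg_row y -> nneg_row l -> 0 < h0 (row_mx (row_mx y l) x) th.
  by move=> ny nl; apply: lt_trans c_h_gt0 _; exact: h0_range.
have thhat_meas T : (0 < T)%N -> measurable_fun setT (thhat T).
  move=> T_gt0 _ B mB; rewrite setTI; have := thhat_data T T_gt0 B mB.
  exact: measurable_info.
have omega_fin j : (j <= 1)%N ->
    (\int[lebesgue_row (p0 + q0 + m)]_v (enorm v ^+ j * omega v)%:E < +oo)%E.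
  by move=> j1; have /andP[] := omega_int j (leq_trans j1 (isT : (1 <= 4)%N)).
have pgf_lip_le (u l : R) : 0 <= u <= 1 -> 0 < l ->
    derivable (fun l' => pgf F l' u) l 1 /\ `| derive1 (fun l' => pgf F l' u) l | <= M1.
  by move=> u01 l_gt0; have [dF /ltW] := pgf_lip u l u01 l_gt0.
case/andP: w_int => _ w_fin.
have -> : Z = fun t om => zvec p0 q0 (fun s => (Y s om)%:R) (fun s => lam theta0 s om)
    (fun s => X s om) t.
  by apply/funext => t; apply/funext => om; exact: Z_def.
exact: (statistic_cvg_in_prob F_order FA_order h0_gt0 h0_split r_cont pi_cont contraction
  r_lip Y_meas X_meas Theta0_sub theta0_int (fun t om => lam_gt0 theta0 t om Theta_theta0)
  (fun t => lam_past theta0 t Theta_theta0) (fun t => lam_rec theta0 t Theta_theta0)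
  joint_stat Y_law r_C3 pi_C2 kappa_gt0 pi_grad r_grad y0_ge0 l0_ge0 thhat_Theta thhat_meas
  thhat_cvg w_meas omega_meas w_gt0 omega_gt0 omega_sym w_fin omega_fin (ltW M1_gt0) pgf_lip_le
  W_def).
Qed.
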